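(* Let $(Y_i(0),\beta_{is},w_{is},U_i,\mathcal{X}_s,\mathcal{Z}_s)_{1\le i\le N,\,1\le s\le S}$ be a triangular array as in the context (indexed by $S$, with $N=N_S$), let $X_i=\sum_{s=1}^S w_{is}\mathcal{X}_s$, $n_s=\sum_{i=1}^N w_{is}$, and let $\mathcal{F}_0$ be the $\sigma$-field generated by $(\mathcal{Z}_s,U_i,Y_i(0),\beta_{is},w_{is})_{i,s}$. Suppose that $\beta_{is}=\beta$ for all $i,s$, and put $\delta=E[Z'Z]^{-1}E[Z'(Y-X\beta)]$, $\check\delta=(Z'Z)^{-1}Z'(Y-X\beta)$, $\epsilon_i=Y_i-X_i\beta-Z_i'\delta$. Suppose: (1) $Y_i=Y_i(0)+\sum_{s=1}^S w_{is}\mathcal{X}_s\beta_{is}$ and $Z_i=\sum_{s=1}^S w_{is}\mathcal{Z}_s+U_i\in\mathbb{R}^K$ for all $i$; (2) for every $s$, $E[\mathcal{X}_s\mid\mathcal{F}_0]=E[\mathcal{X}_s\mid\mathcal{Z}_s]=\mathcal{Z}_s'\gamma$, for some $\gamma\in\mathbb{R}^K$; (3) for every $k$ with $\gamma_k\ne0$, $N^{-1}\sum_{i=1}^N E[U_{ik}^2]\to0$ and $(\sum_{s=1}^S n_s^2)^{-1/2}\sum_{i=1}^N E[U_{ik}^2]\to 0$; (4) conditional on $\mathcal{F}_0$, $\mathcal{X}_1,\dots,\mathcal{X}_S$ are independent; (5) $\max_s n_s/\sum_{t=1}^S n_t\to 0$ and $\max_s n_s^2/\sum_{t=1}^S n_t^2\to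 0$; (6) the support of $\beta_{is}$ is bounded (uniformly in $i,s,S$); (7) $\frac1N\sum_{i=1}^N\sum_{s=1}^S \mathrm{var}(\mathcal{X}_s\mid\mathcal{F}_0)\,w_{is}^2$ converges in probability to a strictly positive non-random limit; (8) for some $\nu>0$, $E[|\mathcal{X}_s|^{4+\nu}\mid\mathcal{F}_0]$ is uniformly bounded, and conditional on $W$ the fourth moments of $Y_i(0)$, $U_i$ and $\mathcal{Z}_s$ exist and are bounded uniformly over $i$ and $s$; (9) $Z'Z/N$ converges in probability to a positive definite non-random limit; (10) $\check\delta-\delta=O_p(q_S)$ for some sequence $q_S\to0$ such that $\frac{q_S^2N}{\sum_s n_s^2}\sum_{i=1}^N E[(U_i'\gamma)^2]\to0$, and $\gamma'U'\epsilon=o_p\big((\sum_s n_s^2)^{1/2}\big)$; (11) $\displaystyle \mathcal{V}_N=\frac{1}{\sum_{s=1}^S n_s^2}\,\mathrm{var}\Big(\sum_{i=1}^N (X_i-Z_i'\gamma)\epsilon_i\;\Big|\;\mathcal{F}_0\Big)$ converges in probability to a non-random limit; (12) $N\ge S$ and $W$ has full rank; (13) either $\max_s\sum_{i=1}^N\big|((W'W)^{-1}W')_{si}\big|$ is bounded and $\max_i E[(U_i'\gamma)^4\mid W]\to0$, or else $U_i=0$ for $i=1,\dots,N$. Let $\ddot X=X-Z(Z'Z)^{-1}Z'X$, $\widehat{\mathcal{X}}=(W'W)^{-1}W'\ddot X\in\mathbb{R}^S$, and $\hat R_s=\sum_{i=1}^N w_{is}\tilde\epsilon_i$, where $\tilde\epsilon_i=Y_i-X_i\tilde\beta-Z_i'\tilde\delta$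 and $\tilde\beta$, $\tilde\delta$ are consistent estimators of $\beta$ and $\delta$ (that is, $\tilde\beta-\beta=o_p(1)$ and $\tilde\delta-\delta=o_p(1)$). Then $$\frac{\sum_{s=1}^S\widehat{\mathcal{X}}_s^2\hat R_s^2}{\sum_{s=1}^S n_s^2}=\mathcal{V}_N+o_p(1).$$
   Context: All limits are as $S\to\infty$, with the number of regions $N=N_S$ depending on $S$; $K$ and $\gamma$ are fixed. For each $S$ there are, on some probability space, random variables $Y_i(0),\beta_{is},\mathcal{X}_s\in\mathbb{R}$, $U_i,\mathcal{Z}_s\in\mathbb{R}^K$, and shares $w_{is}\ge 0$ with $\sum_{s=1}^S w_{is}\le 1$ for every $i$ ($i=1,\dots,N$, $s=1,\dots,S$); their joint distribution may change with $S$ (the index $S$ is suppressed). $W=(w_{is})$ is the $N\times S$ share matrix; $X,Y,\epsilon$ are the $N$-vectors with entries $X_i,Y_i,\epsilon_i$; $Z$ and $U$ are the $N\times K$ matrices with rows $Z_i'$ and $U_i'$. ''Uniformly bounded'' means bounded (almost surely) by a non-random constant not depending on $S$. Limit and boundedness conditions involving functions of $W$ are understood to hold almost surely (with non-random bounds). *)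

(* Defs.v *)
From HB Require Import structures.
From mathcomp Require Export all_boot all_order all_algebra.
From mathcomp Require Export all_classical all_reals all_analysis.
Set Implicit Arguments.
Unset Strict Implicit.
Unset Printing Implicit Defensive.
Import Order.TTheory GRing.Theory Num.Theory.
Import numFieldNormedType.Exports.
Local Open Scope classical_set_scope.
Local Open Scope ring_scope.

Section Conditioning.
Context {d : measure_display} {T : measurableType d} {R : realType}.
Variable P : probability T R.

(* Real-valued expectation; it is only applied to integrable functions, as
   [fine] would send an infinite expectation to 0. *)
Definition expect (f : T -> R) : R := fine 'E_P[f].

Definition expect_mx m n (M : T -> 'M[R]_(m, n)) : 'M[R]_(m, n) :=
  \matrix_(i, j) expect (fun w => M w i j).

Definition sigma_gen (I : Type) (f : I -> T -> R) : set (set T) :=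
  <<s \bigcup_i preimage_set_system setT (f i) measurable >>.

(* [g] is a version of E[f | F], for a sub-sigma-field F of the sigma-field
   of T. *)
Definition is_condexp (F : set (set T)) (f g : T -> R) : Prop :=
  [/\ P.-integrable setT (EFin \o f),
      P.-integrable setT (EFin \o g),
      (forall B : set R, measurable B -> F (g @^-1` B)) &
      forall A, F A ->
        (\int[P]_(w in A) (g w)%:E = \int[P]_(w in A) (f w)%:E)%E].

(* [v] is a version of var(f | F). *)
Definition is_condvar (F : set (set T)) (f v : T -> R) : Prop :=
  exists2 m, is_condexp F f m & is_condexp F (fun w => (f w - m w) ^+ 2) v.

(* Taking some of the B s to be setT gives the product rule for every
   subfamily. *)
Definition cond_independent (F : set (set T)) (I : finType)
    (X : I -> T -> R) : Prop :=
  forall B : I -> set R, (forall s, measurable (B s)) ->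
  exists p : I -> T -> R,
    (forall s, is_condexp F \1_(X s @^-1` B s) (p s)) /\
    is_condexp F \1_(\bigcap_s (X s @^-1` B s)) (fun w => \prod_s p s w).

End Conditioning.

(* Asymptotics for sequences of random variables indexed by S, each one on its
   own probability space. *)
Section Asymptotics.
Context {R : realType} {d : nat -> measure_display}.
Context {T : forall S, measurableType (d S)}.
Variable P : forall S, probability (T S) R.

Definition cvg_prob (f : forall S, T S -> R) (l : R) : Prop :=
  forall e : R, 0 < e ->
    P S [set w | e <= `|f S w - l|] @[S --> \oo] --> 0%E.

(* f_S = O_p(q_S) *)
Definition bigO_prob (f : forall S, T S -> R) (q : nat -> R) : Prop :=
  forall e : R, 0 < e -> exists M : R,
    \forall S \near \oo,
      (P S [set w | (M * `|q S| < `|f S w|)%R] <= e%:E)%E.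

(* f_S -> 0 almost surely, with non-random bounds: since the probability
   spaces for different S are unrelated, this says that |f_S| is almost surely
   dominated by a non-random sequence tending to 0. *)
Definition as_cvg0 (f : forall S, T S -> R) : Prop :=
  forall e : R, 0 < e ->
    \forall S \near \oo, {ae P S, forall w, `|f S w| <= e}.

End Asymptotics.

Definition posdefmx (R : realType) n (Q : 'M[R]_n) : Prop :=
  Q^T = Q /\ forall v : 'cV[R]_n, v != 0 -> 0 < (v^T *m Q *m v) 0 0.

(* The S-th row of the triangular array: S sectors, K controls. *)
Record shift_share (R : realType) (K S : nat) := ShiftShare {
  regions : nat ;
  disp : measure_display ;
  sample : measurableType disp ;
  prob : probability sample R ;
  y0 : 'I_regions -> {RV prob >-> R} ;                (* Y_i(0) *)
  coef : 'I_regions -> 'I_S -> {RV prob >-> R} ;      (* beta_is *)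
  share : 'I_regions -> 'I_S -> {RV prob >-> R} ;     (* w_is *)
  noise : 'I_regions -> 'I_K -> {RV prob >-> R} ;     (* U_ik *)
  shock : 'I_S -> {RV prob >-> R} ;                   (* the shock X_s *)
  sctl : 'I_S -> 'I_K -> {RV prob >-> R} ;            (* the control Z_sk *)
  share_ge0 : forall i s w, 0 <= share i s w ;
  share_sum_le1 : forall i w, \sum_(s < S) share i s w <= 1
}.

Section Row.
Context {R : realType} {K S : nat} (A : shift_share R K S).
Local Notation N := (regions A).
Implicit Type w : sample A.

Definition Wmx w : 'M[R]_(N, S) := \matrix_(i, s) share i s w.
Definition Umx w : 'M[R]_(N, K) := \matrix_(i, k) noise i k w.
Definition shocks w : 'cV[R]_S := \col_s shock A s w.
Definition sctlmx w : 'M[R]_(S, K) := \matrix_(s, k) sctl A s k w.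

Definition Xv w : 'cV[R]_N := Wmx w *m shocks w.
Definition Zmx w : 'M[R]_(N, K) := Wmx w *m sctlmx w + Umx w.
Definition Yv w : 'cV[R]_N :=
  \col_i (y0 i w + \sum_(s < S) share i s w * shock A s w * coef i s w).

Definition sector_size (s : 'I_S) w : R := \sum_(i < N) share i s w.
Definition sum_n w : R := \sum_(s < S) sector_size s w.
Definition sum_n2 w : R := \sum_(s < S) sector_size s w ^+ 2.
Definition max_n w : R := \big[Num.max/0]_(s < S) sector_size s w.
Definition max_n2 w : R := \big[Num.max/0]_(s < S) sector_size s w ^+ 2.

Definition F0 : set (set (sample A)) :=
  <<s sigma_gen (fun j : 'I_S * 'I_K => sctl A j.1 j.2 : sample A -> R) `|`
      sigma_gen (fun j : 'I_N * 'I_K => noise j.1 j.2 : sample A -> R) `|`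
      sigma_gen (fun i : 'I_N => y0 i : sample A -> R) `|`
      sigma_gen (fun j : 'I_N * 'I_S => coef j.1 j.2 : sample A -> R) `|`
      sigma_gen (fun j : 'I_N * 'I_S => share j.1 j.2 : sample A -> R) >>.

Definition sigma_sctl (s : 'I_S) : set (set (sample A)) :=
  sigma_gen (fun k : 'I_K => sctl A s k : sample A -> R).

Definition sigma_W : set (set (sample A)) :=
  sigma_gen (fun j : 'I_N * 'I_S => share j.1 j.2 : sample A -> R).

(* [invmx M] is [M] itself when [M] is singular; the inverses below are only
   meaningful on the events where the matrices are invertible. *)
Definition delta (b : R) : 'cV[R]_K :=
  invmx (expect_mx (prob A) (fun w => (Zmx w)^T *m Zmx w))
    *m expect_mx (prob A) (fun w => (Zmx w)^T *m (Yv w - b *: Xv w)).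

Definition delta_check (b : R) w : 'cV[R]_K :=
  invmx ((Zmx w)^T *m Zmx w) *m ((Zmx w)^T *m (Yv w - b *: Xv w)).

Definition residual (b : R) (c : 'cV[R]_K) w : 'cV[R]_N :=
  Yv w - b *: Xv w - Zmx w *m c.

Definition Xddot w : 'cV[R]_N :=
  Xv w - Zmx w *m (invmx ((Zmx w)^T *m Zmx w) *m ((Zmx w)^T *m Xv w)).

Definition W_pinv w : 'M[R]_(S, N) :=
  invmx ((Wmx w)^T *m Wmx w) *m (Wmx w)^T.

Definition shock_hat w : 'cV[R]_S := W_pinv w *m Xddot w.

Definition R_hat (b : R) (c : 'cV[R]_K) w : 'cV[R]_S :=
  (Wmx w)^T *m residual b c w.

(* U_i' g *)
Definition Ug (g : 'cV[R]_K) (i : 'I_N) w : R := (Umx w *m g) i 0.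

(* sum_i (X_i - Z_i' g) e_i *)
Definition score (g : 'cV[R]_K) (e : sample A -> 'cV[R]_N) w : R :=
  \sum_(i < N) (Xv w - Zmx w *m g) i 0 * e w i 0.

End Row.

Arguments F0 {R K S} A _.
Arguments sigma_W {R K S} A _.
Arguments sigma_sctl {R K S} A s _.

(* Main.v *)
(* With homogeneous effects Y - X beta = Y(0), so that eps = Y(0) - Z delta is
   F_0-measurable.  Write R_s = sum_i w_is eps_i and Xt_s = X_s - Z_s' gamma.
   Since the Xt_s are centred and independent given F_0,
     V_N = sum_s var(X_s | F_0) R_s^2 / sum_s n_s^2,
   and sum_s Xt_s^2 R_s^2 / sum_s n_s^2 - V_N has a second moment of order
   max_s n_s^2 / sum_s n_s^2.  As W has full rank,
     X^_s - Xt_s = - Z_s' (g - gamma) - ((W'W)^-1 W'U g)_s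
   where g is the OLS coefficient of X on Z; it is consistent, because the
   second moment of Z'W Xt / N is at most of order max_s n_s / sum_s n_s.  With
   weights p_s = n_s^2 / sum_t n_t^2, Xt and R_s / n_s are bounded in
   probability in l^4(p), while X^ - Xt and (R^_s - R_s) / n_s tend to 0 there;
   this suffices to replace Xt_s R_s by X^_s R^_s.  By (10), delta is
   bounded because the OLS coefficient of Y(0) on Z is bounded in probability.
   Conditional moment bounds E[b | G] <= C are used in the form
     int g b <= C int g   for all G-measurable g >= 0. *)
Require Import Defs.
From mathcomp Require Import all_boot all_order all_algebra.
From mathcomp Require Import all_classical all_reals all_analysis.
From mathcomp Require Import measurable_realfun ring lra.
Set Implicit Arguments.
Unset Strict Implicit.
Unset Printing Implicit Defensive.
Import Order.TTheory GRing.Theory Num.Theory.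
Import numFieldNormedType.Exports.
Import HBSimple HBNNSimple.
Local Open Scope classical_set_scope.
Local Open Scope ring_scope.

(** * Conditioning on a generated sigma-algebra *)

(** Conditional expectations occur only as given versions ([is_condexp]), so E[b | G] of an
    auxiliary quantity b is not at hand without an existence argument. The two substitutes, [zmean]
    for E[f | G] = 0 and [wbnd] for E[b | G] <= C, need none; [wbnd] moreover allows infinite
    integrals, ignores null sets and passes to smaller sigma-fields by restricting the weights. Two
    levels of conditioning alternate. The shocks are controlled given F_0, while Y(0), U and Z have
    bounded fourth moments given W. A second moment is therefore first reduced, by orthogonality
    given F_0, to the mean of an F_0-measurable sum of squares, and this sum is then bounded given W
    with W-measurable weights. Orthogonality has to hold for unbounded coefficients, whereas
    conditional independence speaks of indicators only; passing from one to the other is the task of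
    the sets [rects]. The exponent four arises because each summand is a product of two squares,
    neither factor being bounded: separating them costs a fourth power of each. *)

Lemma weight_le_comp d d' (T : measurableType d) (T' : measurableType d')
    (R : realType) (P : {measure set T -> \bar R}) (phi : T -> T')
    (f m : T -> R) (g : T' -> R) :
  measurable_fun setT phi ->
  measurable_fun setT f -> measurable_fun setT m ->
  (forall x, 0 <= f x) -> (forall x, 0 <= m x) ->
  (forall A, measurable A ->
    (\int[P]_(x in phi @^-1` A) (f x)%:E <=
     \int[P]_(x in phi @^-1` A) (m x)%:E)%E) ->
  measurable_fun setT g -> (forall x, 0 <= g x) ->
  (\int[P]_x (g (phi x) * f x)%:E <= \int[P]_x (g (phi x) * m x)%:E)%E.
Proof.
move=> mphi mf mm f0 m0 fm mg g0.
have mg' : measurable_fun setT (EFin \o g) by exact/measurable_EFinP.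
have g0' t : [set: T'] t -> (0 <= (EFin \o g) t)%E by rewrite lee_fin.
have [h [ndh cvgh]] := approximation measurableT mg' g0'.
have mh n : measurable_fun setT (h n \o phi).
  exact: measurableT_comp.
have key (u : T -> R) : measurable_fun setT u -> (forall x, 0 <= u x) ->
    (\int[P]_x (h n (phi x) * u x)%:E @[n --> \oo]
     --> \int[P]_x (g (phi x) * u x)%:E)%E.
  move=> mu u0.
  have -> : (\int[P]_x (g (phi x) * u x)%:E =
             \int[P]_x limn (fun n => (h n (phi x) * u x)%:E))%E.
    apply: eq_integral => x _; apply/esym/cvg_lim => //.
    under eq_fun do rewrite EFinM; rewrite (EFinM (g (phi x))).
    by apply: cvgeZr => //; exact: cvgh.
  apply: cvg_monotone_convergence => //.
  - by move=> n; apply/measurable_EFinP; exact: (measurable_funM (mh n) mu).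
  - by move=> n x _; rewrite lee_fin mulr_ge0.
  - by move=> x _ a b ab; rewrite lee_fin ler_wpM2r//; exact/lefP/ndh.
have mS n y : measurable (phi @^-1` (h n @^-1` [set y])).
  rewrite -[X in measurable X]setTI; exact: mphi.
have simple (u : T -> R) n : measurable_fun setT u -> (forall x, 0 <= u x) ->
    (\int[P]_x (h n (phi x) * u x)%:E = \sum_(y \in range (h n))
      y%:E * \int[P]_(x in phi @^-1` (h n @^-1` [set y])) (u x)%:E)%E.
  move=> mu u0.
  under eq_integral => x _.
    rewrite fimfunE EFinM -fsumEFin// ge0_mule_fsuml; last first.
      move=> y; rewrite lee_fin indicE.
      have [|_] := boolP (phi x \in _); last by rewrite mulr0.
      by rewrite inE/= => <-; rewrite mulr1.
    over.
  rewrite ge0_integral_fsum//; last 2 first.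
  - move=> y; apply: emeasurable_funM; last exact/measurable_EFinP.
    apply/measurable_EFinP; apply: measurable_funM => //.
    apply: (measurableT_comp (measurable_indic _)) mphi.
    exact: (measurable_sfunP (h n) (measurable_set1 y)).
  - move=> y x _; rewrite -EFinM lee_fin mulr_ge0// indicE.
    have [|_] := boolP (phi x \in _); last by rewrite mulr0.
    by rewrite inE/= => <-; rewrite mulr1.
  apply: eq_fsbigr => y; rewrite inE/= => -[z _ <-{y}].
  rewrite [in RHS]integral_mkcond.
  rewrite -ge0_integralZl//=; last 3 first.
  - apply/(measurable_restrictT _ _).1 => //.
    by apply/measurable_EFinP; exact: measurable_funTS.
  - by move=> x _; rewrite patchE; case: ifPn; rewrite ?lee_fin.
  - by rewrite lee_fin.
  apply: eq_integral => x _; rewrite patchE indicE.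
  have -> : (x \in phi @^-1` (h n @^-1` [set h n z])) =
            (phi x \in h n @^-1` [set h n z]) by apply/idP/idP; rewrite !inE.
  by case: ifPn => _; rewrite ?mulr1// mulr0 mul0e mule0.
have le_n n : (\int[P]_x (h n (phi x) * f x)%:E <=
               \int[P]_x (h n (phi x) * m x)%:E)%E.
  rewrite !simple//; apply: lee_fsum => // y [z _ <-{y}].
  rewrite lee_wpmul2l ?lee_fin//; apply: fm.
  exact: (measurable_sfunP (h n) (measurable_set1 _)).
have cf := key _ mf f0; have cm := key _ mm m0.
rewrite -(cvg_lim _ cf)// -(cvg_lim _ cm)//; apply: lee_lim.
- by apply/cvg_ex; eexists; exact: cf.
- by apply/cvg_ex; eexists; exact: cm.
- by near=> n; exact: le_n.
Unshelve. all: by end_near. Qed.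

Section SubSigmaAlgebra.
Context {d : measure_display} {T : measurableType d} {R : realType}.
Variables (P : {measure set T -> \bar R}) (G : set (set T)).
Hypothesis GT : <<s G >> `<=` measurable.

(** Stated on the type [g_sigma_algebraType G], so that the library lemmas on sums, products and
    compositions apply unchanged; [gmeasP] recovers the form that occurs in [is_condexp]. *)
Definition gmeas (f : T -> R) : Prop :=
  measurable_fun [set: g_sigma_algebraType G] (f : g_sigma_algebraType G -> R).

Lemma gmeas_measurable (f : T -> R) : gmeas f -> measurable_fun setT f.
Proof. by move=> mf _ B mB; apply: GT; exact: mf. Qed.

Lemma gmeasP (f : T -> R) :
  gmeas f <-> (forall B : set R, measurable B -> <<s G >> (f @^-1` B)).
Proof.
split=> [mf B mB|mf _ B mB]; last by rewrite setTI; exact: mf.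
by rewrite -[f @^-1` B]setTI; exact: mf.
Qed.

Lemma measurable_id_sigma :
  measurable_fun [set: T] (id : T -> g_sigma_algebraType G).
Proof. by move=> _ B mB; rewrite setTI; exact: GT. Qed.

(** The map of the preceding comparison is taken to be [id] into [g_sigma_algebraType G]: the level
    sets of the simple functions approximating g are then G-sets. *)
Lemma weight_le (f m g : T -> R) :
  measurable_fun setT f -> measurable_fun setT m ->
  (forall x, 0 <= f x) -> (forall x, 0 <= m x) ->
  (forall A, <<s G >> A ->
    (\int[P]_(x in A) (f x)%:E <= \int[P]_(x in A) (m x)%:E)%E) ->
  gmeas g -> (forall x, 0 <= g x) ->
  (\int[P]_x (g x * f x)%:E <= \int[P]_x (g x * m x)%:E)%E.
Proof.
move=> mf mm f0 m0 fm mg g0.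
exact: (weight_le_comp measurable_id_sigma mf mm f0 m0 fm mg g0).
Qed.

Lemma gmeasM f g : gmeas f -> gmeas g -> gmeas (fun x => f x * g x).
Proof. exact: measurable_funM. Qed.

Lemma gmeasD f g : gmeas f -> gmeas g -> gmeas (fun x => f x + g x).
Proof. exact: measurable_funD. Qed.

Lemma gmeasB f g : gmeas f -> gmeas g -> gmeas (fun x => f x - g x).
Proof. exact: measurable_funB. Qed.

Lemma gmeasX f n : gmeas f -> gmeas (fun x => f x ^+ n).
Proof. exact: measurable_funX. Qed.

Lemma gmeas_cst (k : R) : gmeas (fun=> k).
Proof. exact: measurable_cst. Qed.

Lemma gmeas_sum (I : Type) (s : seq I) (h : I -> T -> R) :
  (forall i, gmeas (h i)) -> gmeas (fun x => \sum_(i <- s) h i x).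
Proof. exact: measurable_sum. Qed.

End SubSigmaAlgebra.

(** * Integrable variables and zero conditional mean *)

Section ZeroMean.
Context {d : measure_display} {T : measurableType d} {R : realType}.
Variable P : probability T R.
Implicit Types (G : set (set T)) (f g h : T -> R).

Definition L1 f := P.-integrable setT (EFin \o f).

Lemma L1_measurable f : L1 f -> measurable_fun setT f.
Proof. by move/measurable_int/measurable_EFinP. Qed.

Lemma L1_dom f g : measurable_fun setT f -> L1 g ->
  (forall x, `|f x| <= `|g x|) -> L1 f.
Proof.
move=> mf ig fg; apply: (@le_integrable _ _ _ P setT _ _ (EFin \o g)) => //.
  exact/measurable_EFinP.
by move=> x _ /=; rewrite lee_fin.
Qed.

Lemma L1D f g : L1 f -> L1 g -> L1 (fun x => f x + g x).
Proof. by move=> f1 g1; exact: (integrableD measurableT f1 g1). Qed.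

Lemma L1B f g : L1 f -> L1 g -> L1 (fun x => f x - g x).
Proof. by move=> f1 g1; exact: (integrableB measurableT f1 g1). Qed.

Lemma L1Z (k : R) f : L1 f -> L1 (fun x => k * f x).
Proof. by move=> f1; exact: (integrableZl measurableT k f1). Qed.

Lemma L1_cst (k : R) : L1 (fun=> k).
Proof. exact: finite_measure_integrable_cst. Qed.

Lemma L1_sum (I : Type) (s : seq I) (Q : pred I) (h : I -> T -> R) :
  (forall i, Q i -> L1 (h i)) -> L1 (fun x => \sum_(i <- s | Q i) h i x).
Proof.
move=> hi; rewrite /L1.
have -> : EFin \o (fun x => \sum_(i <- s | Q i) h i x) =
    (fun x => \sum_(i <- s | Q i) (h i x)%:E)%E.
  by apply/funext => x /=; rewrite sumEFin.
by apply: integrable_sum => // i Qi; exact: hi.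
Qed.

Lemma L1_lty f : measurable_fun setT f -> (forall x, 0 <= f x) ->
  (\int[P]_x (f x)%:E < +oo)%E -> L1 f.
Proof.
move=> mf f0 foo; apply/integrableP; split; first exact/measurable_EFinP.
by under eq_integral do rewrite /= ger0_norm//.
Qed.

Lemma L1_indicM A f : measurable A -> L1 f -> L1 (fun x => \1_A x * f x).
Proof.
move=> mA f1; apply: (L1_dom _ f1).
  apply: measurable_funM; first exact: measurable_indic.
  exact: L1_measurable.
move=> x; rewrite normrM indicE; case: (x \in A); last by rewrite normr0 mul0r.
by rewrite normr1 mul1r.
Qed.

Lemma int_indicM A f : measurable A ->
  (\int[P]_(x in A) (f x)%:E = \int[P]_x (\1_A x * f x)%:E)%E.
Proof.
move=> mA; rewrite integral_mkcond; apply: eq_integral => x _.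
by rewrite patchE indicE; case: ifPn => _; rewrite ?mul1r ?mul0r.
Qed.

Lemma intD A f g : measurable A -> L1 f -> L1 g ->
  (\int[P]_(x in A) (f x + g x)%:E =
   \int[P]_(x in A) (f x)%:E + \int[P]_(x in A) (g x)%:E)%E.
Proof.
move=> mA f1 g1; under eq_integral do rewrite EFinD.
by rewrite integralD//; [exact: integrableS f1|exact: integrableS g1].
Qed.

Lemma intB A f g : measurable A -> L1 f -> L1 g ->
  (\int[P]_(x in A) (f x - g x)%:E =
   \int[P]_(x in A) (f x)%:E - \int[P]_(x in A) (g x)%:E)%E.
Proof.
move=> mA f1 g1; under eq_integral do rewrite EFinB.
by rewrite integralB_EFin//; [exact: integrableS f1|exact: integrableS g1].
Qed.

Lemma int_fin_num A f : measurable A -> L1 f ->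
  (\int[P]_(x in A) (f x)%:E \is a fin_num)%E.
Proof. by move=> mA f1; apply: integrable_fin_num => //; exact: integrableS f1. Qed.

(** Reduces weights of either sign to nonnegative ones: both parts of a product are sums of products
    of parts. *)
Lemma funrposnegM f g x :
  ((fun x => g x * f x)^\+ x = g^\+ x * f^\+ x + g^\- x * f^\- x) *
  ((fun x => g x * f x)^\- x = g^\+ x * f^\- x + g^\- x * f^\+ x).
Proof.
rewrite /funrpos /funrneg.
have pos (y : R) : 0 <= y -> (Num.max y 0 = y) * (Num.max (- y) 0 = 0).
  by move=> y0; rewrite max_l// max_r// oppr_le0.
have neg (y : R) : y <= 0 -> (Num.max y 0 = 0) * (Num.max (- y) 0 = - y).
  by move=> y0; rewrite max_r// max_l// oppr_ge0.
case: (orP (le_total 0 (f x))) => fx; case: (orP (le_total 0 (g x))) => gx.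
- by split; rewrite ?(pos _ fx) ?(pos _ gx) ?(pos _ (mulr_ge0 gx fx)); ring.
- by split; rewrite ?(pos _ fx) ?(neg _ gx) ?(neg _ (mulr_le0_ge0 gx fx)); ring.
- by split; rewrite ?(neg _ fx) ?(pos _ gx) ?(neg _ (mulr_ge0_le0 gx fx)); ring.
- by split; rewrite ?(neg _ fx) ?(neg _ gx) ?(pos _ (mulr_le0 gx fx)); ring.
Qed.

Lemma posneg_int f A : measurable A -> L1 f ->
  (\int[P]_(x in A) (f x)%:E = 0)%E <->
  (\int[P]_(x in A) (f^\+ x)%:E = \int[P]_(x in A) (f^\- x)%:E)%E.
Proof.
move=> mA f1; have fA : P.-integrable A (EFin \o f) by exact: integrableS f1.
rewrite (integralE P A (EFin \o f)) funerpos funerneg /=.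
have fp := integrable_pos_fin_num mA fA; rewrite funerpos in fp.
have fn := integrable_neg_fin_num mA fA; rewrite funerneg in fn.
split=> [/eqP|->]; last by rewrite subee.
by rewrite sube_eq ?add0e ?fin_num_adde_defr//; exact/eqP.
Qed.

(* E[f | G] = 0 *)
Definition zmean G f :=
  L1 f /\ forall A, <<s G >> A -> (\int[P]_(x in A) (f x)%:E = 0)%E.

(** The hypothesis says that f^+ and f^- have the same integral over every G-set, hence against
    every nonnegative G-measurable weight, infinite values included. Integrability of the product is
    called upon only when the parts are reassembled. *)
Lemma zmean_weight G f g : <<s G >> `<=` measurable ->
  zmean G f -> gmeas G g -> L1 (fun x => g x * f x) ->
  (\int[P]_x (g x * f x)%:E = 0)%E.
Proof.
move=> GT [f1 f0] mg gf1.
have mf := L1_measurable f1.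
have mfp : measurable_fun setT f^\+ by exact: measurable_funrpos.
have mfn : measurable_fun setT f^\- by exact: measurable_funrneg.
have pn A : <<s G >> A ->
    (\int[P]_(x in A) (f^\+ x)%:E = \int[P]_(x in A) (f^\- x)%:E)%E.
  by move=> GA; apply/posneg_int => //; [exact: GT|exact: f0].
have w u : gmeas G u -> (forall x, 0 <= u x) ->
    (\int[P]_x (u x * f^\+ x)%:E = \int[P]_x (u x * f^\- x)%:E)%E.
  move=> mu u0; apply/eqP; rewrite eq_le; apply/andP; split;
    apply: (weight_le GT) => //; do ?[by move=> x; exact: funrpos_ge0|
     by move=> x; exact: funrneg_ge0|by move=> A GA; rewrite pn].
have mgp : gmeas G g^\+ by exact: measurable_funrpos.
have mgn : gmeas G g^\- by exact: measurable_funrneg.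
have mgpT := gmeas_measurable GT mgp; have mgnT := gmeas_measurable GT mgn.
apply/posneg_int => //.
under eq_integral => x _ do rewrite (funrposnegM f g x).1 EFinD.
under [RHS]eq_integral => x _ do rewrite (funrposnegM f g x).2 EFinD.
rewrite !ge0_integralD//; last first.
all: try by apply/measurable_EFinP; exact: measurable_funM.
all: try by move=> x _; rewrite lee_fin mulr_ge0 ?funrpos_ge0 ?funrneg_ge0.
by rewrite (w _ mgp (funrpos_ge0 _)) -(w _ mgn (funrneg_ge0 _)).
Qed.

Lemma zmean_pi G f : setI_closed G -> G `<=` measurable -> G setT -> L1 f ->
  (forall A, G A -> (\int[P]_(x in A) (f x)%:E = 0)%E) -> zmean G f.
Proof.
move=> GI GT GsT f1 f0; split=> // A GA.
have sGT : <<s G >> `<=` measurable.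
  by apply: smallest_sub => //; exact: sigma_algebra_measurable.
move: A GA; apply: (@dynkin_induction _ (g_sigma_algebraType G) G
    (fun A => (\int[P]_(x in A) (f x)%:E = 0)%E)) => //.
- exact: f0.
- move=> S mS S0; have := f0 _ GsT.
  have mS' : measurable (S : set T) by exact: sGT.
  rewrite -(setvU S) integral_setU//; first by rewrite S0 adde0.
  + exact: measurableC.
  + by apply/measurable_EFinP/measurable_funTS; exact: L1_measurable.
  + by apply/disj_setPS => x [].
- move=> F mF tF F0; rewrite integral_bigcup//.
  + by rewrite eseries0// => i _ _; exact: F0.
  + by move=> k; apply: sGT; exact: mF.
  + apply: integrableS f1 => //; apply: bigcup_measurable => k _; apply: sGT.
    exact: mF.
Qed.

Lemma ae_le_int G f g : <<s G >> `<=` measurable ->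
  gmeas G f -> gmeas G g -> L1 f -> L1 g ->
  (forall A, <<s G >> A ->
    (\int[P]_(x in A) (f x)%:E <= \int[P]_(x in A) (g x)%:E)%E) ->
  {ae P, forall x, f x <= g x}.
Proof.
(* The exceptional set is itself a G-set, and on it the positive function f - g has integral at most
   0. *)
move=> GT mf mg f1 g1 fg; pose A := [set x | g x < f x].
have GA : <<s G >> A.
  have : measurable_fun setT ((fun x => g x < f x) : g_sigma_algebraType G -> bool).
    exact: measurable_fun_ltr.
  move=> /(_ measurableT [set true] I); rewrite setTI.
  by congr (<<s G >> _); apply/seteqP; split=> x.
have mA := GT _ GA.
have h1 : L1 (fun x => f x - g x) by exact: L1B.
have i0 : (\int[P]_(x in A) `|(f x - g x)%:E| = 0)%E.
  apply/eqP; rewrite eq_le integral_ge0// andbT.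
  rewrite (eq_integral (fun x => (f x - g x)%:E)); last first.
    by move=> x; rewrite inE /A/= => /ltW gf; rewrite ger0_norm// subr_ge0.
  by rewrite intB// sube_le0 ?fg// int_fin_num.
have mh : measurable_fun A (fun x => (f x - g x)%:E).
  by apply/measurable_EFinP/measurable_funTS; exact: L1_measurable.
have /(ae_eq_integral_abs P mA mh) := i0.
apply: filterS => x /= Ax; rewrite leNgt; apply/negP => gf.
by have /eqP := Ax gf; rewrite eqe subr_eq0 => /eqP fE; rewrite fE ltxx in gf.
Qed.

End ZeroMean.

(** * Conditional independence and orthogonality *)

Section ConditionalIndependence.
Context {d : measure_display} {T : measurableType d} {R : realType}.
Variables (P : probability T R) (G : set (set T)).
Hypothesis GT : <<s G >> `<=` measurable.
Implicit Types (f g m q V W X Y : T -> R).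

Lemma gmeas_indic (A : set T) : <<s G >> A -> gmeas G (\1_A : T -> R).
Proof. by move=> GA; exact: (@measurable_indic _ (g_sigma_algebraType G)). Qed.

Lemma sigma_setI (A B : set T) : <<s G >> A -> <<s G >> B -> <<s G >> (A `&` B).
Proof. exact: (@measurableI _ (g_sigma_algebraType G)). Qed.

Lemma sigma_setT : <<s G >> setT.
Proof. exact: (@measurableT _ (g_sigma_algebraType G)). Qed.

Lemma condexp_gmeas f m : is_condexp P <<s G >> f m -> gmeas G m.
Proof. by case=> _ _ mm _; apply/gmeasP. Qed.

Lemma condexp_L1 f m : is_condexp P <<s G >> f m -> L1 P f /\ L1 P m.
Proof. by case. Qed.

Lemma condexp_zmean f m :
  is_condexp P <<s G >> f m -> zmean P G (fun x => f x - m x).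
Proof.
move=> [f1 m1 _ fm]; split=> [|A GA]; first exact: L1B.
by rewrite intB//; [rewrite fm// subee// int_fin_num//; exact: GT|exact: GT].
Qed.

Lemma ae_eq_int f g : gmeas G f -> gmeas G g -> L1 P f -> L1 P g ->
  (forall A, <<s G >> A ->
    (\int[P]_(x in A) (f x)%:E = \int[P]_(x in A) (g x)%:E)%E) ->
  {ae P, forall x, f x = g x}.
Proof.
move=> mf mg f1 g1 fg.
have fgle : {ae P, forall x, f x <= g x}.
  by apply: (ae_le_int GT) => // A GA; rewrite fg.
have gfle : {ae P, forall x, g x <= f x}.
  by apply: (ae_le_int GT) => // A GA; rewrite fg.
by apply: filterS2 fgle gfle => x xfg xgf; apply/eqP; rewrite eq_le xfg xgf.
Qed.

Lemma condexp_ae_eq f m m' : is_condexp P <<s G >> f m ->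
  is_condexp P <<s G >> f m' -> {ae P, forall x, m x = m' x}.
Proof.
move=> cm cm'; apply: ae_eq_int; do ?exact: (condexp_gmeas cm);
  do ?exact: (condexp_gmeas cm'); do ?exact: (condexp_L1 cm).2;
  do ?exact: (condexp_L1 cm').2.
by move=> A GA; case: cm => _ _ _ ->//; case: cm' => _ _ _ ->.
Qed.

Lemma int_ae_eq A f g : measurable A ->
  measurable_fun setT f -> measurable_fun setT g ->
  {ae P, forall x, f x = g x} ->
  (\int[P]_(x in A) (f x)%:E = \int[P]_(x in A) (g x)%:E)%E.
Proof.
move=> mA mf mg fg; apply: ae_eq_integral => //.
- by apply/measurable_EFinP; exact: measurable_funTS.
- by apply/measurable_EFinP; exact: measurable_funTS.
- by apply: filterS fg => x -> _.
Qed.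

Lemma L1_ae_eq f g : measurable_fun setT f -> {ae P, forall x, f x = g x} ->
  L1 P g -> L1 P f.
Proof.
move=> mf fg /integrableP[/measurable_EFinP mg goo].
apply/integrableP; split; first exact/measurable_EFinP.
rewrite (ae_eq_integral (fun x => `|(g x)%:E|%E))//.
- by apply: measurableT_comp => //; exact/measurable_EFinP.
- by apply: measurableT_comp => //; exact/measurable_EFinP.
- by apply: filterS fg => x /= -> _.
Qed.

(* A pi-system generating the join of <<s G>> and sigma(X). *)
Definition rects X : set (set T) :=
  [set E | exists2 A, <<s G >> A & exists2 B, measurable B & E = A `&` X @^-1` B].

Lemma rects_measurable X : measurable_fun setT X -> rects X `<=` measurable.
Proof.
move=> mX E [A GA [B mB ->]]; apply: measurableI; first exact: GT.
by rewrite -[X in measurable X]setTI; exact: mX.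
Qed.

Lemma sigma_rects_measurable X : measurable_fun setT X ->
  <<s rects X >> `<=` measurable.
Proof.
move=> mX; apply: smallest_sub; first exact: sigma_algebra_measurable.
exact: rects_measurable.
Qed.

Lemma rects_setI X : setI_closed (rects X).
Proof.
move=> _ _ [A GA [B mB ->]] [A' GA' [B' mB' ->]].
exists (A `&` A'); first exact: sigma_setI.
by exists (B `&` B'); [exact: measurableI|rewrite preimage_setI setIACA].
Qed.

Lemma rectsT X : rects X setT.
Proof. by exists setT; [exact: sigma_setT|exists setT; rewrite ?setIT]. Qed.

Lemma gmeas_rects X f : gmeas G f -> gmeas (rects X) f.
Proof.
move=> /gmeasP mf; apply/gmeasP => B mB; apply: sub_sigma_algebra.
by exists (f @^-1` B); [exact: mf|exists setT; rewrite ?setIT].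
Qed.

Lemma gmeas_rects_self X : gmeas (rects X) X.
Proof.
apply/gmeasP => B mB; apply: sub_sigma_algebra.
by exists setT; [exact: sigma_setT|exists B; rewrite ?setTI].
Qed.

(** As in [cond_independent], every pair of sets comes with its own versions p and q; versions from
    different instances agree only almost surely. *)
Definition pair_independent X Y := forall B C : set R,
  measurable B -> measurable C -> exists p q : T -> R,
  [/\ is_condexp P <<s G >> \1_(X @^-1` B) p,
      is_condexp P <<s G >> \1_(Y @^-1` C) q,
      L1 P (fun x => p x * q x) &
      forall A, <<s G >> A ->
        (\int[P]_(x in A) (p x * q x)%:E =
         \int[P]_(x in A) (\1_(X @^-1` B) x * \1_(Y @^-1` C) x)%:E)%E].

Lemma cond_independent_pair (J : finType) (X : J -> T -> R) (s t : J) :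
  s != t -> (forall i, measurable_fun setT (X i)) ->
  cond_independent P <<s G >> X -> pair_independent (X s) (X t).
Proof.
move=> st mX indX B C mB mC.
pose D i := if i == s then B else if i == t then C else setT.
have mD i : measurable (D i) by rewrite /D; do !case: ifP.
have [p [pD pprod]] := indX D mD.
have Ds : D s = B by rewrite /D eqxx.
have Dt : D t = C by rewrite /D eq_sym (negPf st) eqxx.
(* The other indices carry the set [setT], and every version of E[1 | G] is 1 almost surely, so they
   drop out of the product. *)
have p1 i : i != s -> i != t -> {ae P, forall x, p i x = 1}.
  move=> si ti; have pi := pD i.
  apply: (condexp_ae_eq pi); rewrite /D (negPf si) (negPf ti) preimage_setT.
  split.
  - by apply: integrable_indic.
  - exact: L1_cst.
  - have /gmeasP mc : gmeas G (fun=> 1 : R) by exact: measurable_cst.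
    by move=> E mE; exact: mc.
  - by move=> A GA; apply: eq_integral => x _; rewrite indicE in_setT.
have ae1 : {ae P, forall x, forall i, i != s -> i != t -> p i x = 1}.
  apply: filter_forall => i; have [->|si] := eqVneq i s.
    by apply: aeW => x.
  have [->|ti] := eqVneq i t; first by apply: aeW => x.
  by apply: filterS (p1 i si ti) => x ->.
have prodE : {ae P, forall x, p s x * p t x = \prod_i p i x}.
  apply: filterS ae1 => x xp; rewrite (bigD1 s)//= (bigD1 t) 1?eq_sym//=.
  by rewrite big1 ?mulr1// => i /andP[si ti]; exact: xp.
have mp i : measurable_fun setT (p i).
  exact: (gmeas_measurable GT (condexp_gmeas (pD i))).
have mst : measurable_fun setT (fun x => p s x * p t x) by exact: measurable_funM.
exists (p s), (p t); split.
- by have := pD s; rewrite Ds.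
- by have := pD t; rewrite Dt.
- by apply: L1_ae_eq prodE _ => //; case: pprod.
- move=> A GA; rewrite (int_ae_eq _ mst _ prodE); last 2 first.
  + exact: GT.
  + exact: (gmeas_measurable GT (condexp_gmeas pprod)).
  case: pprod => _ _ _ ->//; apply: eq_integral => x _.
  congr EFin; rewrite -[RHS]/((\1_(X s @^-1` B) \* \1_(X t @^-1` C)) x).
  rewrite -indicI; congr (\1_ _ x); apply/seteqP; split=> y /=.
    by move=> yD; split; [have := yD s I; rewrite Ds|have := yD t I; rewrite Dt].
  move=> [ys yt] i _; rewrite /D /=; case: eqP => [->//|_].
  by case: eqP => [->//|_].
Qed.

(** A version of a conditional probability lies in [0, 1] only almost surely; truncation makes it so
    everywhere, which the pointwise domination in [L1_dom] requires. *)
Lemma condexp_indic_clip (E : set T) q : measurable E ->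
  is_condexp P <<s G >> \1_E q ->
  exists2 q', is_condexp P <<s G >> \1_E q' & forall x, 0 <= q' x <= 1.
Proof.
move=> mE cq; have [E1 q1] := condexp_L1 cq; have mq := condexp_gmeas cq.
have q0 : {ae P, forall x, 0 <= q x}.
  apply: (ae_le_int GT) => //.
  - exact: measurable_cst.
  - exact: L1_cst.
  - move=> A GA; case: cq => _ _ _ ->//; rewrite integral0.
    by apply: integral_ge0 => x _; rewrite lee_fin indicE.
have qle1 : {ae P, forall x, q x <= 1}.
  apply: (ae_le_int GT) => //.
  - exact: measurable_cst.
  - exact: L1_cst.
  - move=> A GA; case: cq => _ _ _ ->//; apply: ge0_le_integral => //.
    + exact: GT.
    + by apply/measurable_EFinP/measurable_indic.
    + by move=> x _; rewrite lee_fin indicE lern1 leq_b1.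
pose q' x := Num.min (Num.max (q x) 0) 1.
have mq' : gmeas G q'.
  by apply: measurable_minr; [apply: measurable_maxr|]; do ?exact: measurable_cst.
have qq' : {ae P, forall x, q' x = q x}.
  by apply: filterS2 q0 qle1 => x x0 x1; rewrite /q' max_l// min_l.
exists q'; last first.
  by move=> x; rewrite /q' ge_min lexx orbT le_min ler01 le_max lexx orbT.
split=> //.
- by apply: L1_ae_eq qq' q1; exact: (gmeas_measurable GT).
- exact/gmeasP.
- move=> A GA; rewrite (int_ae_eq _ _ _ qq').
  + by case: cq => _ _ _ ->.
  + exact: GT.
  + exact: (gmeas_measurable GT).
  + exact: (gmeas_measurable GT).
Qed.

Lemma pair_independent_indic X Y (C : set R) q :
  measurable_fun setT X -> measurable_fun setT Y -> pair_independent X Y ->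
  measurable C -> is_condexp P <<s G >> \1_(Y @^-1` C) q ->
  zmean P (rects X) (fun x => \1_(Y @^-1` C) x - q x).
Proof.
move=> mX mY indXY mC cq.
have [_ q1] := condexp_L1 cq; have mq := condexp_gmeas cq.
have mqT := gmeas_measurable GT mq.
have mYC : measurable (Y @^-1` C).
  by rewrite -[X in measurable X]setTI; exact: mY.
have iYC : L1 P \1_(Y @^-1` C) by exact: integrable_indic.
apply: zmean_pi.
- exact: rects_setI.
- exact: rects_measurable.
- exact: rectsT.
- exact: L1B.
move=> _ [A GA [B mB ->]].
have mA := GT GA.
have mXB : measurable (X @^-1` B).
  by rewrite -[X in measurable X]setTI; exact: mX.
have [p [q' [cp cq' pq1 pqE]]] := indXY B C mB mC.
have mp := gmeas_measurable GT (condexp_gmeas cp).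
have mq' := gmeas_measurable GT (condexp_gmeas cq').
have qq' := condexp_ae_eq cq cq'.
have pqae : {ae P, forall x, p x * q x = p x * q' x}.
  by apply: filterS qq' => x ->.
have pq1' : L1 P (fun x => p x * q x).
  by apply: L1_ae_eq pqae pq1; exact: measurable_funM.
have XBYC : L1 P (fun x => \1_(X @^-1` B) x * \1_(Y @^-1` C) x).
  exact: L1_indicM.
have XBq : L1 P (fun x => \1_(X @^-1` B) x * q x) by exact: L1_indicM.
rewrite int_indicM; last exact: measurableI.
have -> : (\int[P]_x (\1_(A `&` X @^-1` B) x * (\1_(Y @^-1` C) x - q x))%:E =
  \int[P]_(x in A) (\1_(X @^-1` B) x * \1_(Y @^-1` C) x - \1_(X @^-1` B) x * q x)%:E)%E.
  rewrite [RHS]int_indicM//; apply: eq_integral => x _; congr EFin.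
  by rewrite indicI /= -mulrBr mulrA.
rewrite intB// -pqE// -(int_ae_eq mA _ _ pqae); [|exact: measurable_funM..].
(* The sign is changed so that the integrand becomes (1_A q) (1_B(X) - p): a G-measurable weight
   times a variable of zero mean given G. *)
rewrite -intB//; apply/eqP; rewrite -oppe_eq0 -integralN; last first.
  by apply: integrable_add_def => //; apply: integrableS (L1B pq1' XBq).
have := @zmean_weight _ _ _ P G _ (fun x => \1_A x * q x) GT (condexp_zmean cp).
move=> H; apply/eqP; rewrite -[RHS]H; last 2 first.
- by apply: measurable_funM => //; exact: gmeas_indic.
- have -> : (fun x => \1_A x * q x * (\1_(X @^-1` B) x - p x)) =
            (fun x => \1_A x * (\1_(X @^-1` B) x * q x - p x * q x)).
    by apply/funext => x; ring.
  by apply: L1_indicM => //; exact: L1B.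
transitivity (\int[P]_(x in A) (\1_(X @^-1` B) x * q x - p x * q x)%:E)%E.
  by apply: eq_integral => x _; rewrite -EFinN opprB.
by rewrite int_indicM//; apply: eq_integral => x _; congr EFin; ring.
Qed.

(* Conditional independence of X and Y makes E[V | G] = 0 persist after
   conditioning on Y as well: E[1_C(Y) - P(Y in C | G) | G, X] = 0. *)
Lemma cond_orthogonal X Y V W :
  measurable_fun setT X -> measurable_fun setT Y -> pair_independent X Y ->
  gmeas (rects X) V -> zmean P G V -> gmeas (rects Y) W ->
  L1 P (fun x => W x * V x) -> (\int[P]_x (W x * V x)%:E = 0)%E.
Proof.
move=> mX mY indXY mV zV mW WV1.
have V1 : L1 P V by case: zV.
suff zV' : zmean P (rects Y) V.
  by apply: (zmean_weight _ zV') => //; exact: sigma_rects_measurable.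
apply: zmean_pi => //.
- exact: rects_setI.
- exact: rects_measurable.
- exact: rectsT.
move=> _ [A GA [C mC ->]].
have mA := GT GA.
have mYC : measurable (Y @^-1` C).
  by rewrite -[X in measurable X]setTI; exact: mY.
have [_ [q0 [_ cq0 _ _]]] := indXY setT C measurableT mC.
have [q cq q01] := condexp_indic_clip mYC cq0.
have mq := gmeas_measurable GT (condexp_gmeas cq).
have Vq1 : L1 P (fun x => q x * V x).
  apply: (L1_dom _ V1).
    by apply: measurable_funM => //; exact: (L1_measurable V1).
  move=> x; rewrite normrM ler_piMl//; have /andP[? ?] := q01 x.
  by rewrite ger0_norm.
(* 1_A 1_C(Y) V is split into 1_A V (1_C(Y) - q) and 1_A q V. The first vanishes by conditioning on
   G and X, the second by conditioning on G. *)
have E1 : (\int[P]_x (\1_A x * V x * (\1_(Y @^-1` C) x - q x))%:E = 0)%E.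
  apply: (zmean_weight (sigma_rects_measurable mX)
    (pair_independent_indic mX mY indXY mC cq)).
    by apply: measurable_funM => //; apply: gmeas_rects; exact: gmeas_indic.
  have -> : (fun x => \1_A x * V x * (\1_(Y @^-1` C) x - q x)) =
     (fun x => \1_A x * (\1_(Y @^-1` C) x * V x - q x * V x)).
    by apply/funext => x; ring.
  by apply: L1_indicM => //; apply: L1B => //; exact: L1_indicM.
have E2 : (\int[P]_x (\1_A x * q x * V x)%:E = 0)%E.
  apply: (zmean_weight GT zV).
    by apply: measurable_funM; [exact: gmeas_indic|exact: (condexp_gmeas cq)].
  under eq_fun do rewrite -mulrA.
  exact: L1_indicM.
rewrite int_indicM; last exact: measurableI.
have -> : (fun x => (\1_(A `&` Y @^-1` C) x * V x)%:E) =
  (fun x => ((\1_A x * V x * (\1_(Y @^-1` C) x - q x)) + \1_A x * q x * V x)%:E).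
  by apply/funext => x; congr EFin; rewrite indicI /=; ring.
rewrite intD ?E1 ?E2 ?adde0//.
- have -> : (fun x => \1_A x * V x * (\1_(Y @^-1` C) x - q x)) =
     (fun x => \1_A x * (\1_(Y @^-1` C) x * V x - q x * V x)).
    by apply/funext => x; ring.
  by apply: L1_indicM => //; apply: L1B => //; exact: L1_indicM.
- under eq_fun do rewrite -mulrA.
  exact: L1_indicM.
Qed.

End ConditionalIndependence.

(** * Conditional moment bounds in weighted form *)

Section WeightedBounds.
Context {d : measure_display} {T : measurableType d} {R : realType}.
Variables (P : probability T R).
Implicit Types (G : set (set T)) (f g b : T -> R).

(* E[b | G] <= C, phrased without conditional expectations. *)
Definition wbnd G b (C : R) :=
  [/\ measurable_fun setT b, forall x, 0 <= b x, 0 <= C &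
    forall g, gmeas G g -> (forall x, 0 <= g x) ->
      (\int[P]_x (g x * b x)%:E <= C%:E * \int[P]_x (g x)%:E)%E].

Lemma gmeas_sub G G' g : <<s G >> `<=` <<s G' >> -> gmeas G g -> gmeas G' g.
Proof. by move=> GG' /gmeasP mg; apply/gmeasP => B mB; apply: GG'; exact: mg. Qed.

(** Tower property: a smaller sigma-field has fewer weights to test. It turns bounds given F_0 into
    bounds given W. *)
Lemma wbnd_sub G G' b C : <<s G' >> `<=` <<s G >> -> wbnd G b C -> wbnd G' b C.
Proof.
by move=> GG' [mb b0 C0 bC]; split=> // g mg; apply: bC; exact: gmeas_sub mg.
Qed.

Lemma ge0_int_ae_le f g : measurable_fun setT f -> measurable_fun setT g ->
  (forall x, 0 <= f x) -> (forall x, 0 <= g x) -> {ae P, forall x, f x <= g x} ->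
  (\int[P]_x (f x)%:E <= \int[P]_x (g x)%:E)%E.
Proof.
move=> mf mg f0 g0 fg; apply: ae_ge0_le_integral => //.
- by move=> x _; rewrite lee_fin.
- exact/measurable_EFinP.
- by move=> x _; rewrite lee_fin.
- exact/measurable_EFinP.
- by apply: filterS fg => x fgx _; rewrite lee_fin.
Qed.

Lemma ge0_intZ (k : R) f : 0 <= k -> measurable_fun setT f ->
  (forall x, 0 <= f x) ->
  (\int[P]_x (k * f x)%:E = k%:E * \int[P]_x (f x)%:E)%E.
Proof.
move=> k0 mf f0; under eq_integral do rewrite EFinM.
rewrite ge0_integralZl//; first exact/measurable_EFinP.
by move=> x _; rewrite lee_fin.
Qed.

Lemma ge0_intD f g : measurable_fun setT f -> measurable_fun setT g ->
  (forall x, 0 <= f x) -> (forall x, 0 <= g x) ->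
  (\int[P]_x (f x + g x)%:E = \int[P]_x (f x)%:E + \int[P]_x (g x)%:E)%E.
Proof.
move=> mf mg f0 g0; under eq_integral do rewrite EFinD.
by rewrite ge0_integralD//; do ?[exact/measurable_EFinP|
  by move=> x _; rewrite lee_fin].
Qed.

Lemma ge0_int_sum (J : finType) (f : J -> T -> R) :
  (forall j, measurable_fun setT (f j)) -> (forall j x, 0 <= f j x) ->
  (\int[P]_x (\sum_j f j x)%:E = \sum_j \int[P]_x (f j x)%:E)%E.
Proof.
move=> mf f0; under eq_integral do rewrite -sumEFin.
rewrite ge0_integral_sum//; first by move=> j; exact/measurable_EFinP.
by move=> j x _; rewrite lee_fin.
Qed.

Lemma wbnd_le G b b' C : <<s G >> `<=` measurable -> wbnd G b' C ->
  measurable_fun setT b -> (forall x, 0 <= b x) ->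
  {ae P, forall x, b x <= b' x} -> wbnd G b C.
Proof.
move=> GT [mb' b'0 C0 bC] mb b0 bb'; split=> // g mg g0.
have mgT := gmeas_measurable GT mg.
apply: le_trans (bC g mg g0); apply: ge0_int_ae_le.
- exact: measurable_funM.
- exact: measurable_funM.
- by move=> x; rewrite mulr_ge0.
- by move=> x; rewrite mulr_ge0.
- by apply: filterS bb' => x bb'x; rewrite ler_wpM2l.
Qed.

Lemma wbnd_weaken G b C C' : C <= C' -> wbnd G b C -> wbnd G b C'.
Proof.
move=> CC' [mb b0 C0 bC]; split=> //; first exact: le_trans CC'.
move=> g mg g0; apply: le_trans (bC g mg g0) _.
by rewrite lee_wpmul2r ?lee_fin//; apply: integral_ge0 => x _; rewrite lee_fin.
Qed.

Lemma wbnd_cst G (k : R) : <<s G >> `<=` measurable -> 0 <= k ->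
  wbnd G (fun=> k) k.
Proof.
move=> GT k0; split=> // g mg g0; under eq_integral do rewrite mulrC.
by rewrite ge0_intZ//; exact: (gmeas_measurable GT).
Qed.

Lemma wbndD G b b' C C' : <<s G >> `<=` measurable ->
  wbnd G b C -> wbnd G b' C' -> wbnd G (fun x => b x + b' x) (C + C').
Proof.
move=> GT [mb b0 C0 bC] [mb' b'0 C'0 bC']; split.
- exact: measurable_funD.
- by move=> x; rewrite addr_ge0.
- by rewrite addr_ge0.
- move=> g mg g0; have mgT := gmeas_measurable GT mg.
  under eq_integral do rewrite mulrDr.
  rewrite ge0_intD; [|exact: measurable_funM|exact: measurable_funM|
    by move=> x; rewrite mulr_ge0|by move=> x; rewrite mulr_ge0].
  rewrite EFinD ge0_muleDl ?lee_fin//; apply: leeD; first exact: bC.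
  exact: bC'.
Qed.

Lemma wbndM G b c C D : <<s G >> `<=` measurable -> wbnd G b C ->
  gmeas G c -> (forall x, 0 <= c x) -> 0 <= D -> {ae P, forall x, c x <= D} ->
  wbnd G (fun x => c x * b x) (C * D).
Proof.
move=> GT [mb b0 C0 bC] mc c0 D0 cD; have mcT := gmeas_measurable GT mc.
split; [exact: measurable_funM|by move=> x; rewrite mulr_ge0|exact: mulr_ge0|].
move=> g mg g0; have mgT := gmeas_measurable GT mg.
under eq_integral do rewrite mulrA.
apply: le_trans (bC (fun x => g x * c x) _ _) _.
- exact: measurable_funM.
- by move=> x; rewrite mulr_ge0.
- rewrite EFinM -muleA lee_wpmul2l ?lee_fin//.
  rewrite -ge0_intZ//; apply: ge0_int_ae_le => //.
  + exact: measurable_funM.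
  + by apply: measurable_funM => //; exact: measurable_cst.
  + by move=> x; rewrite mulr_ge0.
  + by move=> x; rewrite mulr_ge0.
  + by apply: filterS cD => x cDx; rewrite mulrC ler_wpM2r.
Qed.

Lemma wbndZ G b (k : R) C : <<s G >> `<=` measurable -> wbnd G b C -> 0 <= k ->
  wbnd G (fun x => k * b x) (k * C).
Proof.
move=> GT bC k0; rewrite mulrC; apply: wbndM => //; first exact: measurable_cst.
exact: aeW.
Qed.

(** The coefficients may be random: if g is an admissible weight, so is g c_j. This is how averages
    whose weights are functions of W are bounded given W. *)
Lemma wbnd_comb G (J : finType) (c b : J -> T -> R) C D :
  <<s G >> `<=` measurable -> 0 <= C -> (forall j, wbnd G (b j) C) ->
  (forall j, gmeas G (c j)) -> (forall j x, 0 <= c j x) ->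
  0 <= D -> {ae P, forall x, \sum_j c j x <= D} ->
  wbnd G (fun x => \sum_j c j x * b j x) (C * D).
Proof.
move=> GT C0 bC mc c0 D0 cD; have mcT j := gmeas_measurable GT (mc j).
have mb j : measurable_fun setT (b j) by case: (bC j).
have b0 j x : 0 <= b j x by case: (bC j).
split.
- by apply: measurable_sum => j; exact: measurable_funM.
- by move=> x; apply: sumr_ge0 => j _; rewrite mulr_ge0.
- exact: mulr_ge0.
- move=> g mg g0; have mgT := gmeas_measurable GT mg.
  under eq_integral do rewrite mulr_sumr.
  rewrite ge0_int_sum; last 2 first.
  + by move=> j; do 2?apply: measurable_funM.
  + by move=> j x; rewrite !mulr_ge0.
  apply: (@le_trans _ _ (C%:E * \int[P]_x (\sum_j g x * c j x)%:E)%E).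
    rewrite ge0_int_sum; last 2 first.
    * by move=> j; exact: measurable_funM.
    * by move=> j x; rewrite !mulr_ge0.
    rewrite ge0_sume_distrr; last first.
      by move=> j _; apply: integral_ge0 => x _; rewrite lee_fin mulr_ge0.
    apply: lee_sum => j _; under eq_integral do rewrite mulrA.
    case: (bC j) => _ _ _ /(_ (fun x => g x * c j x)); apply.
      exact: (measurable_funM mg (mc j)).
    by move=> x; rewrite mulr_ge0.
  rewrite EFinM -muleA lee_wpmul2l ?lee_fin//.
  rewrite -ge0_intZ//; apply: ge0_int_ae_le => //.
  + by apply: measurable_sum => j; exact: measurable_funM.
  + by apply: measurable_funM => //; exact: measurable_cst.
  + by move=> x; apply: sumr_ge0 => j _; rewrite mulr_ge0.
  + by move=> x; rewrite mulr_ge0.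
  + by apply: filterS cD => x cDx; rewrite -mulr_sumr mulrC ler_wpM2r.
Qed.

Lemma wbnd_int G b C : wbnd G b C -> (\int[P]_x (b x)%:E <= C%:E)%E.
Proof.
case=> mb b0 C0 bC; have := bC (fun=> 1) (measurable_cst _) (fun=> ler01).
under eq_integral do rewrite mul1r.
have -> : (\int[P]_x 1%:E = 1)%E; last by rewrite mule1.
by rewrite integral_cst//= probability_setT mul1e.
Qed.

Lemma wbnd_L1 G b C : wbnd G b C -> L1 P b.
Proof.
move=> bC; case: (bC) => mb b0 _ _; apply: L1_lty => //.
by apply: le_lt_trans (wbnd_int bC) _; rewrite ltry.
Qed.

Lemma wbnd_of_int G b C : <<s G >> `<=` measurable ->
  measurable_fun setT b -> (forall x, 0 <= b x) -> 0 <= C ->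
  (forall A, <<s G >> A -> (\int[P]_(x in A) (b x)%:E <= C%:E * P A)%E) ->
  wbnd G b C.
Proof.
move=> GT mb b0 C0 bC; split=> // g mg g0.
have mgT := gmeas_measurable GT mg.
apply: (@le_trans _ _ (\int[P]_x (g x * C)%:E)%E).
  apply: (weight_le GT) => // A GA.
  by rewrite integral_cst; [exact: bC|exact: GT].
by under eq_integral do rewrite mulrC; rewrite ge0_intZ.
Qed.

Lemma wbnd_condexp G b m C : <<s G >> `<=` measurable ->
  (forall x, 0 <= b x) -> 0 <= C -> is_condexp P <<s G >> b m ->
  {ae P, forall x, m x <= C} -> wbnd G b C.
Proof.
move=> GT b0 C0 cm mC; have [b1 m1] := condexp_L1 cm.
apply: wbnd_of_int => //; first exact: (L1_measurable b1).
move=> A GA; have mA := GT _ GA.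
case: cm => _ _ _ <-//; rewrite -integral_cst//.
(* Truncation at C makes the almost sure bound pointwise, as [le_integral] demands, and leaves the
   integral unchanged. *)
pose k x := Num.min (m x) C.
have mm := L1_measurable m1.
have mk : measurable_fun setT k by apply: measurable_minr.
have mkE : {ae P, forall x, m x = k x}.
  by apply: filterS mC => x mx; rewrite /k min_l.
rewrite (int_ae_eq mA mm mk mkE); apply: le_integral => //.
- by apply: integrableS (L1_ae_eq mk _ m1) => //; apply: filterS mkE => x ->.
- by apply: integrableS (L1_cst P C).
- by move=> x _; rewrite /= lee_fin /k ge_min lexx orbT.
Qed.

End WeightedBounds.

(** * Second moments of conditionally orthogonal sums *)

Section OrthogonalSum.
Context {d : measure_display} {T : measurableType d} {R : realType}.
Variables (P : probability T R) (G : set (set T)).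
Hypothesis GT : <<s G >> `<=` measurable.
Variables (J : finType) (X V z : J -> T -> R).
Hypothesis mX : forall j, measurable_fun setT (X j).
Hypothesis indX : forall i j, i != j -> pair_independent P G (X i) (X j).
Hypothesis mV : forall j, gmeas (rects G (X j)) (V j).
Hypothesis V0 : forall j, zmean P G (V j).
Hypothesis mz : forall j, gmeas G (z j).
Hypothesis Vz2 : forall j, L1 P (fun x => (V j x * z j x) ^+ 2).

Let mVT j : measurable_fun setT (V j).
Proof. exact: (gmeas_measurable (sigma_rects_measurable GT (mX j))). Qed.

Let mzT j : measurable_fun setT (z j).
Proof. exact: (gmeas_measurable GT). Qed.

Let cross i j : L1 P (fun x => V i x * z i x * (V j x * z j x)).
Proof.
apply: (L1_dom _ (L1D (Vz2 i) (Vz2 j))).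
  by do !apply: measurable_funM.
move=> x; set a := V i x * z i x; set b := V j x * z j x.
rewrite [leRHS]ger0_norm ?addr_ge0 ?sqr_ge0//.
have [ab|ab] := leP 0 (a * b).
  by rewrite ger0_norm//; have := sqr_ge0 (a - b); nra.
by rewrite ltr0_norm//; have := sqr_ge0 (a + b); nra.
Qed.

Lemma L1_orthogonal_sum : L1 P (fun x => (\sum_j V j x * z j x) ^+ 2).
Proof.
have -> : (fun x => (\sum_j V j x * z j x) ^+ 2) =
  (fun x => \sum_i \sum_j V i x * z i x * (V j x * z j x)).
  apply/funext => x; rewrite expr2 mulr_suml; apply: eq_bigr => i _.
  by rewrite mulr_sumr.
by apply: L1_sum => i _; apply: L1_sum => j _; exact: cross.
Qed.

Lemma int_orthogonal_sum :
  (\int[P]_x ((\sum_j V j x * z j x) ^+ 2)%:E =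
   \sum_j \int[P]_x ((V j x * z j x) ^+ 2)%:E)%E.
Proof.
transitivity (\int[P]_x
    (\sum_i \sum_j (V i x * z i x * (V j x * z j x))%:E)%E)%E.
  apply: eq_integral => x _; rewrite expr2 mulr_suml -sumEFin.
  by apply: eq_bigr => i _; rewrite mulr_sumr -sumEFin.
rewrite integral_sum//; last first.
  by move=> i; apply: integrable_sum => // j _; exact: cross.
apply: eq_bigr => i _; rewrite integral_sum//; last by move=> j; exact: cross.
rewrite (bigD1 i)//= big1 ?adde0; last first.
  move=> j ji; have ij : i != j by rewrite eq_sym.
  (* The cross term is z_i z_j V_j times V_i: the first factor is measurable with respect to G and
     X_j, the second is a function of G and X_i with zero mean given G. *)
  have := @cond_orthogonal _ _ _ P G GT (X i) (X j) (V i)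
    (fun x => z i x * z j x * V j x) (mX i) (mX j) (indX ij) (@mV i) (@V0 i).
  have E : (fun x => z i x * z j x * V j x * V i x) =
           (fun x => V i x * z i x * (V j x * z j x)).
    by apply/funext => x; ring.
  move=> H; rewrite -[RHS]H; first by apply: eq_integral => x _; congr EFin; ring.
  - exact: gmeasM (gmeasM (gmeas_rects (@mz i)) (gmeas_rects (@mz j))) (@mV j).
  - by rewrite E.
by apply: eq_integral => x _; rewrite expr2.
Qed.

Lemma int_orthogonal_sum_le C : (forall j, wbnd P G (fun x => V j x ^+ 2) C) ->
  (\int[P]_x ((\sum_j V j x * z j x) ^+ 2)%:E <=
   C%:E * \int[P]_x (\sum_j z j x ^+ 2)%:E)%E.
Proof.
move=> VC; rewrite int_orthogonal_sum ge0_int_sum; last 2 first.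
- by move=> j; exact: measurable_funX.
- by move=> j x; exact: sqr_ge0.
rewrite ge0_sume_distrr; last first.
  by move=> j _; apply: integral_ge0 => x _; rewrite lee_fin sqr_ge0.
apply: lee_sum => j _; case: (VC j) => _ _ _ /(_ (fun x => z j x ^+ 2)).
move=> /(_ (measurable_funX _ (mz j)) (fun x => sqr_ge0 _)).
by under eq_integral do rewrite -exprMn mulrC.
Qed.

End OrthogonalSum.

(** * Stochastic orders of magnitude *)

Section StochasticOrder.
Context {R : realType} {d : nat -> measure_display}.
Context {T : forall S, measurableType (d S)}.
Variable P : forall S, probability (T S) R.
Implicit Types (f g : forall S, T S -> R) (Q : forall S, T S -> Prop).

(* [Q] holds off a measurable event of probability at most [eta], for large S;
   unlike a statement on the probability of [Q], this needs no measurability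
   of [Q]. *)
Definition offset (eta : R) Q := \forall S \near \oo, exists B,
  [/\ measurable B, (P S B <= eta%:E)%E & forall w, ~ B w -> Q S w].

Definition whp Q := forall eta : R, 0 < eta -> offset eta Q.

Definition op1 f := forall e : R, 0 < e -> whp (fun S w => `|f S w| <= e).

Definition Op1 f := forall eta : R, 0 < eta ->
  exists M : R, offset eta (fun S w => `|f S w| <= M).

Lemma offset_imp eta Q Q' : (forall S w, Q S w -> Q' S w) ->
  offset eta Q -> offset eta Q'.
Proof.
move=> QQ'; apply: filterS => S [B [mB PB BQ]]; exists B; split=> // w Bw.
exact/QQ'/BQ.
Qed.

Lemma offset_and eta eta' Q Q' : offset eta Q -> offset eta' Q' ->
  offset (eta + eta') (fun S w => Q S w /\ Q' S w).
Proof.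
apply: filterS2 => S [B [mB PB BQ]] [B' [mB' PB' BQ']].
exists (B `|` B'); split; first exact: measurableU.
  rewrite EFinD; apply: le_trans (leeD PB PB').
  by apply: measureU2.
by move=> w /not_orP[Bw B'w]; split; [exact: BQ|exact: BQ'].
Qed.

Lemma whp_imp Q Q' : (forall S w, Q S w -> Q' S w) -> whp Q -> whp Q'.
Proof. by move=> QQ' wQ eta eta0; exact: offset_imp (wQ _ eta0). Qed.

Lemma whp_and Q Q' : whp Q -> whp Q' -> whp (fun S w => Q S w /\ Q' S w).
Proof.
move=> wQ wQ' eta eta0; rewrite (splitr eta); apply: offset_and.
  by apply: wQ; rewrite divr_gt0.
by apply: wQ'; rewrite divr_gt0.
Qed.

Lemma whp_ae Q : (\forall S \near \oo, {ae P S, forall w, Q S w}) -> whp Q.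
Proof.
move=> aeQ eta eta0; apply: filterS aeQ => S [B [mB PB QB]].
exists B; split=> //; first by rewrite PB lee_fin ltW.
by move=> w Bw; apply: contrapT => Qw; exact/Bw/QB.
Qed.

Lemma whpW Q : (forall S w, Q S w) -> whp Q.
Proof. by move=> HQ; apply: whp_ae; apply: nearW => S; exact: aeW. Qed.

Lemma whp_near (Q : nat -> Prop) : (\forall S \near \oo, Q S) ->
  whp (fun S _ => Q S).
Proof. by move=> nQ; apply: whp_ae; apply: filterS nQ => S QS; exact: aeW. Qed.

Lemma whp_all (I : finType) (Q : I -> forall S, T S -> Prop) :
  (forall i, whp (Q i)) -> whp (fun S w => forall i, Q i S w).
Proof.
move=> wQ.
have H (s : seq I) : whp (fun S w => forall i, i \in s -> Q i S w).
  elim: s => [|i s ih]; first by apply: whpW.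
  apply: whp_imp (whp_and (wQ i) ih) => S w [Qi Qs] j.
  by rewrite inE => /predU1P[->//|]; exact: Qs.
by apply: whp_imp (H (enum I)) => S w Hw i; apply: Hw; rewrite mem_enum.
Qed.

Lemma op1_Op1 f : op1 f -> Op1 f.
Proof. by move=> f0 eta eta0; exists 1; exact: f0. Qed.

Lemma op1_dom f g : op1 g -> whp (fun S w => `|f S w| <= `|g S w|) -> op1 f.
Proof.
move=> og fg e e0; apply: whp_imp (whp_and fg (og e e0)) => S w [].
exact: le_trans.
Qed.

Lemma Op1_dom f g : Op1 g -> whp (fun S w => `|f S w| <= `|g S w|) -> Op1 f.
Proof.
move=> Og fg eta eta0; have eta2 : 0 < eta / 2 by rewrite divr_gt0.
have [M gM] := Og _ eta2; exists M; rewrite (splitr eta).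
apply: offset_imp (offset_and (fg _ eta2) gM) => S w [].
exact: le_trans.
Qed.

Lemma op1_eq f g : op1 g -> whp (fun S w => f S w = g S w) -> op1 f.
Proof. by move=> og fg; apply: op1_dom og _; apply: whp_imp fg => S w ->. Qed.

Lemma op1D f g : op1 f -> op1 g -> op1 (fun S w => f S w + g S w).
Proof.
move=> of_ og e e0; have e2 : 0 < e / 2 by rewrite divr_gt0.
apply: whp_imp (whp_and (of_ _ e2) (og _ e2)) => S w [fe ge].
by rewrite (le_trans (ler_normD _ _))// (splitr e) lerD.
Qed.

Lemma op1N f : op1 f -> op1 (fun S w => - f S w).
Proof. by move=> of_ e e0; apply: whp_imp (of_ e e0) => S w; rewrite normrN. Qed.

Lemma Op1D f g : Op1 f -> Op1 g -> Op1 (fun S w => f S w + g S w).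
Proof.
move=> of_ og e e0; have e2 : 0 < e / 2 by rewrite divr_gt0.
have [M fM] := of_ _ e2; have [M' gM'] := og _ e2.
exists (M + M'); rewrite (splitr e).
apply: offset_imp (offset_and fM gM') => S w [fe ge].
by rewrite (le_trans (ler_normD _ _))// lerD.
Qed.

Lemma Op1_cst (c : nat -> R) (M : R) : (\forall S \near \oo, `|c S| <= M) ->
  Op1 (fun S _ => c S).
Proof. by move=> cM eta eta0; exists M; exact: (whp_near cM). Qed.

Lemma Op1M f g : Op1 f -> Op1 g -> Op1 (fun S w => f S w * g S w).
Proof.
move=> of_ og e e0; have e2 : 0 < e / 2 by rewrite divr_gt0.
have [M fM] := of_ _ e2; have [M' gM'] := og _ e2.
exists (M * M'); rewrite (splitr e).
apply: offset_imp (offset_and fM gM') => S w [fe ge].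
by rewrite normrM ler_pM.
Qed.

Lemma op1Mr f g : Op1 f -> op1 g -> op1 (fun S w => f S w * g S w).
Proof.
move=> of_ og e e0 eta eta0; have eta2 : 0 < eta / 2 by rewrite divr_gt0.
have [M fM] := of_ _ eta2; have M0 : 0 < `|M| + 1 by rewrite ltr_wpDl.
have eM : 0 < e / (`|M| + 1) by rewrite divr_gt0.
rewrite (splitr eta).
apply: offset_imp (offset_and fM (og _ eM _ eta2)) => S w [fe ge].
rewrite normrM; apply: (@le_trans _ _ ((`|M| + 1) * (e / (`|M| + 1)))).
  rewrite ler_pM//; apply: le_trans fe _; apply: le_trans (ler_norm M) _.
  by rewrite lerDl.
by rewrite mulrCA divff ?mulr1// gt_eqF.
Qed.

Lemma op1X f n : op1 f -> op1 (fun S w => f S w ^+ n.+1).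
Proof.
move=> of_; elim: n => [|n ih].
  by apply: op1_eq of_ _; apply: whpW => S w; rewrite expr1.
apply: op1_eq (op1Mr (op1_Op1 of_) ih) _.
by apply: whpW => S w; rewrite exprS.
Qed.

Lemma op1_sum (I : Type) (s : seq I) (f : I -> forall S, T S -> R) :
  (forall i, op1 (f i)) -> op1 (fun S w => \sum_(i <- s) f i S w).
Proof.
move=> of_; elim: s => [|i s ih].
  by move=> e e0; apply: whpW => S w; rewrite big_nil normr0 ltW.
apply: (@op1_eq _ (fun S w => f i S w + \sum_(j <- s) f j S w)).
  exact: op1D.
by apply: whpW => S w; rewrite big_cons.
Qed.

Lemma Op1_sum (I : Type) (s : seq I) (f : I -> forall S, T S -> R) :
  (forall i, Op1 (f i)) -> Op1 (fun S w => \sum_(i <- s) f i S w).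
Proof.
move=> of_; elim: s => [|i s ih].
  apply: (@Op1_dom _ (fun S w => 0)).
    by apply: (@Op1_cst (fun=> 0) 0); apply: nearW => S; rewrite normr0.
  by apply: whpW => S w; rewrite big_nil.
apply: (@Op1_dom _ (fun S w => f i S w + \sum_(j <- s) f j S w)).
  exact: Op1D.
by apply: whpW => S w; rewrite big_cons.
Qed.

Lemma op1_sqr f : op1 (fun S w => f S w ^+ 2) -> op1 f.
Proof.
move=> of_ e e0; apply: whp_imp (of_ (e ^+ 2) _) => [S w|].
  by rewrite normrX ler_pXn2r ?nnegrE// ltW.
by rewrite exprn_gt0.
Qed.

(* Cauchy-Schwarz type bounds enter in this linearised form. *)
Lemma op1_interp f g : Op1 g ->
  (forall a, 0 < a -> exists2 h : forall S, T S -> R, op1 h &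
    whp (fun S w => `|f S w| <= a * g S w + h S w)) ->
  op1 f.
Proof.
move=> Og fgh e e0 eta eta0; have eta2 : 0 < eta / 2 by rewrite divr_gt0.
have [M gM] := Og _ eta2; have M0 : 0 < `|M| + 1 by rewrite ltr_wpDl.
have e2 : 0 < e / 2 by rewrite divr_gt0.
pose a := e / 2 / (`|M| + 1); have a0 : 0 < a by rewrite divr_gt0.
have [h oh fh] := fgh a a0; rewrite (splitr eta).
apply: offset_imp (offset_and gM (whp_and (oh _ e2) fh eta2)) => S w [ge [he fe]].
apply: le_trans fe _; rewrite (splitr e); apply: lerD; last first.
  exact: le_trans (ler_norm _) he.
apply: (@le_trans _ _ (a * (`|M| + 1))); last first.
  by rewrite /a divfK// gt_eqF.
rewrite ler_pM2l//; apply: le_trans (ler_norm _) _; apply: le_trans ge _.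
by apply: le_trans (ler_norm M) _; rewrite lerDl.
Qed.

Lemma markov_bound S (f : T S -> R) (a : R) (C : \bar R) :
  measurable_fun setT f -> (forall w, 0 <= f w) -> 0 < a ->
  (\int[P S]_w (f w)%:E <= C)%E ->
  (P S [set w | (a <= f w)%R] <= (a^-1)%:E * C)%E.
Proof.
move=> mf f0 a0 fC.
have mF : measurable_fun setT (EFin \o f) by exact/measurable_EFinP.
have := le_integral_abse (P S) measurableT mF a0; rewrite setTI.
have -> : [set x | (a%:E <= `|(EFin \o f) x|)%E] = [set w | a <= f w].
  by apply/seteqP; split=> w /=; rewrite lee_fin ger0_norm.
under eq_integral do rewrite /= ger0_norm//.
move=> H; have := le_trans H fC => {}H.
have : ((a^-1)%:E * (a%:E * P S [set w | (a <= f w)%R]) <= (a^-1)%:E * C)%E.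
  by rewrite lee_pmul2l ?lte_fin ?invr_gt0// ?fin_numE.
by rewrite muleA -EFinM mulVf ?gt_eqF// mul1e.
Qed.

Lemma Op1_int f (C : R) :
  (\forall S \near \oo, [/\ measurable_fun setT (f S), forall w, 0 <= f S w &
    (\int[P S]_w (f S w)%:E <= C%:E)%E]) -> Op1 f.
Proof.
move=> fC eta eta0; have C0 : 0 < `|C| + 1 by rewrite ltr_wpDl.
pose M := (`|C| + 1) / eta; have M0 : 0 < M by rewrite divr_gt0.
exists M; apply: filterS fC => S [mf f0 fC].
exists [set w | M <= f S w]; split.
- have := measurable_fun_ler (measurable_cst M) mf.
  by move=> /(_ measurableT [set true] I); rewrite setTI.
- apply: le_trans (markov_bound mf f0 M0 fC) _.
  rewrite -EFinM lee_fin /M invfM invrK -mulrA mulrC ler_pdivrMr//.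
  rewrite ler_pM2l//; apply: le_trans (ler_norm C) _.
  by rewrite lerDl.
- by move=> w /negP; rewrite -ltNge => /ltW; rewrite ger0_norm.
Qed.

Lemma op1_int f :
  (forall c : R, 0 < c -> \forall S \near \oo,
    [/\ measurable_fun setT (f S), forall w, 0 <= f S w &
      (\int[P S]_w (f S w)%:E <= c%:E)%E]) -> op1 f.
Proof.
move=> fc e e0 eta eta0; have ee : 0 < e * eta by rewrite mulr_gt0.
apply: filterS (fc _ ee) => S [mf f0 fC].
exists [set w | e <= f S w]; split.
- have := measurable_fun_ler (measurable_cst e) mf.
  by move=> /(_ measurableT [set true] I); rewrite setTI.
- apply: le_trans (markov_bound mf f0 e0 fC) _.
  by rewrite -EFinM lee_fin mulrA mulVf ?mul1r// gt_eqF.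
- by move=> w /negP; rewrite -ltNge => /ltW; rewrite ger0_norm.
Qed.

Lemma measurable_normB_le S (f : T S -> R) (l e : R) :
  measurable_fun setT f -> measurable [set w | e <= `|f w - l|].
Proof.
move=> mf; have mh : measurable_fun setT (fun w => `|f w - l|).
  by apply: measurableT_comp => //; exact: measurable_funB.
have := measurable_fun_ler (measurable_cst e) mh.
by move=> /(_ measurableT [set true] I); rewrite setTI.
Qed.

Lemma cvg_prob_op1 f (l : R) : (forall S, measurable_fun setT (f S)) ->
  cvg_prob P f l -> op1 (fun S w => f S w - l).
Proof.
move=> mf fl e e0 eta eta0.
have := fl _ e0; move/fine_cvgP => [fin].
move/cvgrPdist_le => /(_ _ eta0); apply: filterS2 fin => S fin dS.
exists [set w | e <= `|f S w - l|]; split.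
- exact: measurable_normB_le.
- rewrite -(fineK fin) lee_fin.
  by move: dS; rewrite /= sub0r normrN; exact: le_trans (ler_norm _).
- by move=> w /negP; rewrite -ltNge => /ltW.
Qed.

Lemma op1_cvg_prob f (l : R) : (forall S, measurable_fun setT (f S)) ->
  op1 (fun S w => f S w - l) -> cvg_prob P f l.
Proof.
(* [cvg_prob] measures the closed event e <= |f - l|, which is disjoint from |f - l| <= e / 2 but
   need not be from |f - l| <= e. *)
move=> mf of_ e e0; have e2 : 0 < e / 2 by rewrite divr_gt0.
have fin S : P S [set w | e <= `|f S w - l|] \is a fin_num.
  by apply: fin_num_measure; exact: measurable_normB_le.
apply/fine_cvgP; split; first exact: nearW.
apply/cvgrPdist_le => eta eta0; apply: filterS (of_ _ e2 _ eta0) => S.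
move=> [B [mB PB BQ]]; rewrite /= sub0r normrN ger0_norm ?fine_ge0//.
rewrite -lee_fin fineK//; apply: le_trans PB; apply: le_measure.
- by rewrite inE; exact: measurable_normB_le.
- by rewrite inE.
- move=> w /= ew; apply: contrapT => /BQ fe.
  by have := le_trans ew fe; rewrite leNgt ltr_pdivrMr// ltr_pMr// ltrDl ltr01.
Qed.

Lemma bigO_prob_op1 f (q : nat -> R) : (forall S, measurable_fun setT (f S)) ->
  q @ \oo --> (0 : R) -> bigO_prob P f q -> op1 f.
Proof.
move=> mf q0 fq e e0 eta eta0; have [M fM] := fq _ eta0.
have M0 : 0 < `|M| + 1 by rewrite ltr_wpDl.
have eM : 0 < e / (`|M| + 1) by rewrite divr_gt0.
move/cvgrPdist_le : q0 => /(_ _ eM); apply: filterS2 fM => S PS.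
rewrite sub0r normrN => qS.
exists [set w | M * `|q S| < `|f S w|]; split=> //.
- have mh : measurable_fun setT (fun w => `|f S w|) by exact: measurableT_comp.
  have := measurable_fun_ltr (measurable_cst (M * `|q S|)) mh.
  by move=> /(_ measurableT [set true] I); rewrite setTI.
- move=> w /negP; rewrite -leNgt => /le_trans; apply.
  apply: (@le_trans _ _ ((`|M| + 1) * (e / (`|M| + 1)))).
    apply: le_trans (ler_wpM2l (ltW M0) qS); apply: ler_wpM2r => //.
    by apply: le_trans (ler_norm M) _; rewrite lerDl.
  by rewrite mulrCA divff ?mulr1// gt_eqF.
Qed.

(** If the bound fails for c_S it fails at every point, so the exceptional event is the whole space,
    although its probability is at most 1/2. *)
Lemma Op1_nonrandom (c : nat -> R) : Op1 (fun S _ => c S) ->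
  exists M : R, \forall S \near \oo, `|c S| <= M.
Proof.
have h0 : 0 < 2^-1 :> R by rewrite invr_gt0.
move=> /(_ _ h0)[M cM]; exists M; apply: filterS cM => S [B [mB PB BQ]].
apply: contrapT => cM.
have BT : B = setT.
  by apply/seteqP; split=> // w _; apply: contrapT => /BQ.
move: PB; rewrite BT probability_setT lee_fin leNgt invf_lt1//.
by rewrite ltr1n.
Qed.

End StochasticOrder.

(** * Inequalities and matrix inversion *)

Section Inequalities.
Context {R : realType}.
Implicit Types (a x y r u : R).

Lemma amgm a x y : 0 < a -> 2 * (x * y) <= a * x ^+ 2 + a^-1 * y ^+ 2.
Proof.
move=> a0; have an0 : a != 0 by rewrite gt_eqF.
have : 0 <= a^-1 * (a * x - y) ^+ 2 by rewrite mulr_ge0 ?sqr_ge0// invr_ge0 ltW.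
have -> : a^-1 * (a * x - y) ^+ 2 =
          a * x ^+ 2 + a^-1 * y ^+ 2 - 2 * (x * y) by field.
by rewrite subr_ge0.
Qed.

(** By Lagrange's identity, twice the gap is a double sum of weighted squares; no square root of a
    weight appears. *)
Lemma weighted_sqr_sum (I : finType) (c b : I -> R) : (forall i, 0 <= c i) ->
  (\sum_i c i * b i) ^+ 2 <= (\sum_i c i) * \sum_i c i * b i ^+ 2.
Proof.
move=> c0; rewrite -subr_ge0 -(@pmulr_rge0 _ 2)//.
suff -> : 2 * ((\sum_i c i) * (\sum_i c i * b i ^+ 2) - (\sum_i c i * b i) ^+ 2)
    = \sum_i \sum_j c i * c j * (b i - b j) ^+ 2.
  apply: sumr_ge0 => i _; apply: sumr_ge0 => j _.
  by apply: mulr_ge0; [exact: mulr_ge0|exact: sqr_ge0].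
have E1 : (\sum_i c i) * (\sum_i c i * b i ^+ 2) =
    \sum_i \sum_j c i * c j * b j ^+ 2.
  rewrite mulr_suml; apply: eq_bigr => i _; rewrite mulr_sumr.
  by apply: eq_bigr => j _; rewrite mulrA.
have E2 : (\sum_i c i) * (\sum_i c i * b i ^+ 2) =
    \sum_i \sum_j c i * c j * b i ^+ 2.
  rewrite mulrC mulr_suml; apply: eq_bigr => i _; rewrite mulr_sumr.
  by apply: eq_bigr => j _; ring.
have E3 : (\sum_i c i * b i) ^+ 2 = \sum_i \sum_j c i * c j * (b i * b j).
  rewrite expr2 mulr_suml; apply: eq_bigr => i _; rewrite mulr_sumr.
  by apply: eq_bigr => j _; ring.
rewrite mulrBr (mulr_natl _ 2) mulr2n {1}E1 E2 E3 mulr_sumr -big_split/= -sumrB.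
apply: eq_bigr => i _; rewrite mulr_sumr -big_split/= -sumrB.
by apply: eq_bigr => j _; ring.
Qed.

Lemma weighted_pow4_sum (I : finType) (c b : I -> R) : (forall i, 0 <= c i) ->
  (\sum_i c i * b i) ^+ 4 <= (\sum_i c i) ^+ 3 * \sum_i c i * b i ^+ 4.
Proof.
move=> c0; have s0 : 0 <= \sum_i c i by exact: sumr_ge0.
have s1 : 0 <= \sum_i c i * b i ^+ 2.
  by apply: sumr_ge0 => i _; rewrite mulr_ge0 ?sqr_ge0.
have H1 := weighted_sqr_sum b c0.
have H2 := weighted_sqr_sum (fun i => b i ^+ 2) c0.
have -> : (\sum_i c i * b i) ^+ 4 = ((\sum_i c i * b i) ^+ 2) ^+ 2.
  by rewrite -exprM.
apply: (@le_trans _ _ (((\sum_i c i) * \sum_i c i * b i ^+ 2) ^+ 2)).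
  by rewrite ler_pXn2r ?nnegrE ?sqr_ge0 ?mulr_ge0.
rewrite exprMn (exprSr (\sum_i c i) 2) -mulrA; apply: ler_wpM2l; first exact: sqr_ge0.
apply: le_trans H2 _; rewrite ler_wpM2l//.
by apply: ler_sum => i _; rewrite -exprM.
Qed.

(** The signs of the weights are moved into b, where the fourth power removes them. *)
Lemma abs_weighted_pow4_sum (I : finType) (c b : I -> R) :
  (\sum_i c i * b i) ^+ 4 <= (\sum_i `|c i|) ^+ 3 * \sum_i `|c i| * b i ^+ 4.
Proof.
have -> : \sum_i c i * b i = \sum_i `|c i| * (Num.sg (c i) * b i).
  by apply: eq_bigr => i _; rewrite {1}[c i]numEsg mulrCA mulrA mulrC.
apply: le_trans (weighted_pow4_sum _ (fun i => normr_ge0 (c i))) _.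
apply: ler_wpM2l; first by apply: exprn_ge0; exact: sumr_ge0.
apply: ler_sum => i _; have [->|ci] := eqVneq (c i) 0; first by rewrite normr0 !mul0r.
by rewrite exprMn [_ ^+ 4](exprM _ 2 2) sqr_sg ci expr1n mul1r.
Qed.

Lemma pow4_sum (I : finType) (b : I -> R) :
  (\sum_i b i) ^+ 4 <= #|I|%:R ^+ 3 * \sum_i b i ^+ 4.
Proof.
have := @weighted_pow4_sum I (fun=> 1) b (fun=> ler01).
under eq_bigr do rewrite mul1r; under [X in _ * X]eq_bigr do rewrite mul1r.
by rewrite sumr_const.
Qed.

Lemma pow4D x y : (x + y) ^+ 4 <= 8 * (x ^+ 4 + y ^+ 4).
Proof.
have H a b : (a + b) ^+ 2 <= 2 * (a ^+ 2 + b ^+ 2) :> R.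
  by have := sqr_ge0 (a - b); nra.
have -> : (x + y) ^+ 4 = ((x + y) ^+ 2) ^+ 2 by rewrite -exprM.
apply: (@le_trans _ _ ((2 * (x ^+ 2 + y ^+ 2)) ^+ 2)).
  by rewrite ler_pXn2r ?nnegrE ?sqr_ge0// mulr_ge0// addr_ge0 ?sqr_ge0.
have := H (x ^+ 2) (y ^+ 2); rewrite -!exprM exprMn; lra.
Qed.

Lemma cauchy_schwarz (I : finType) (b c : I -> R) :
  (\sum_i b i * c i) ^+ 2 <= (\sum_i b i ^+ 2) * \sum_i c i ^+ 2.
Proof.
rewrite -subr_ge0 -(@pmulr_rge0 _ 2)//.
suff -> : 2 * ((\sum_i b i ^+ 2) * (\sum_i c i ^+ 2) - (\sum_i b i * c i) ^+ 2)
    = \sum_i \sum_j (b i * c j - b j * c i) ^+ 2.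
  by apply: sumr_ge0 => i _; apply: sumr_ge0 => j _; exact: sqr_ge0.
have E1 : (\sum_i b i ^+ 2) * (\sum_i c i ^+ 2) =
    \sum_i \sum_j (b i * c j) ^+ 2.
  rewrite mulr_suml; apply: eq_bigr => i _; rewrite mulr_sumr.
  by apply: eq_bigr => j _; rewrite exprMn.
have E2 : (\sum_i b i ^+ 2) * (\sum_i c i ^+ 2) =
    \sum_i \sum_j (b j * c i) ^+ 2.
  rewrite mulrC mulr_suml; apply: eq_bigr => i _; rewrite mulr_sumr.
  by apply: eq_bigr => j _; rewrite exprMn mulrC.
have E3 : (\sum_i b i * c i) ^+ 2 = \sum_i \sum_j b i * c j * (b j * c i).
  rewrite expr2 mulr_suml; apply: eq_bigr => i _; rewrite mulr_sumr.
  by apply: eq_bigr => j _; ring.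
rewrite mulrBr (mulr_natl _ 2) mulr2n {1}E1 E2 E3 mulr_sumr -big_split/= -sumrB.
apply: eq_bigr => i _; rewrite mulr_sumr -big_split/= -sumrB.
by apply: eq_bigr => j _; ring.
Qed.

(* With [p = x r] and [q = u r + x v + u v] the difference is [2 p q + q^2];
   every product is then split by AM-GM. *)
Lemma sqr_prod_perturb a : 0 < a -> exists2 C, 0 <= C & forall x r u v : R,
  `|((x + u) * (r + v)) ^+ 2 - (x * r) ^+ 2| <=
    a * (x ^+ 4 + r ^+ 4) + C * (u ^+ 4 + v ^+ 4).
Proof.
(* B is the factor of q^2 after 2 p q is split with parameter a / 2. D comes from splitting 3 B u^2
   r^2 = 2 r^2 (3 B u^2 / 2), and likewise for x and v, with parameter a / 4. In all, x^4 and r^4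
   receive a / 2 each. *)
move=> a0; pose B := 1 + (a / 2)^-1; pose D := (a / 4)^-1 * (3 * B / 2) ^+ 2.
have a2 : 0 < a / 2 by rewrite divr_gt0.
have a4 : 0 < a / 4 by rewrite divr_gt0.
have B0 : 0 <= B by rewrite addr_ge0// invr_ge0 ltW.
have D0 : 0 <= D by rewrite mulr_ge0 ?sqr_ge0// invr_ge0 ltW.
exists (D + 3 * B / 2); first by rewrite addr_ge0// divr_ge0// mulr_ge0.
move=> x r u v; set p := x * r; pose q := u * r + x * v + u * v.
have -> : (x + u) * (r + v) = p + q by rewrite /p /q; ring.
have -> : (p + q) ^+ 2 - p ^+ 2 = 2 * (p * q) + q ^+ 2 by ring.
have pq : `|2 * (p * q) + q ^+ 2| <= a / 2 * p ^+ 2 + B * q ^+ 2.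
  apply: le_trans (ler_normD _ _) _.
  rewrite (ger0_norm (sqr_ge0 q)) (normrM 2) (normrM p) ger0_norm//.
  have := amgm `|p| `|q| a2; rewrite !real_normK ?num_real//.
  by rewrite /B mulrDl mul1r; lra.
have p2 : p ^+ 2 <= (x ^+ 4 + r ^+ 4) / 2.
  have := sqr_ge0 (x ^+ 2 - r ^+ 2); rewrite /p exprMn.
  rewrite sqrrB -!exprM; lra.
have q2 : q ^+ 2 <= 3 * (u ^+ 2 * r ^+ 2 + x ^+ 2 * v ^+ 2 + u ^+ 2 * v ^+ 2).
  have h1 := sqr_ge0 (u * r - x * v); have h2 := sqr_ge0 (x * v - u * v).
  have h3 := sqr_ge0 (u * r - u * v).
  have -> : 3 * (u ^+ 2 * r ^+ 2 + x ^+ 2 * v ^+ 2 + u ^+ 2 * v ^+ 2) =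
     q ^+ 2 + (u * r - x * v) ^+ 2 + (x * v - u * v) ^+ 2 + (u * r - u * v) ^+ 2.
    by rewrite /q; ring.
  by lra.
have h1 := amgm (r ^+ 2) (3 * B / 2 * u ^+ 2) a4.
have h2 := amgm (x ^+ 2) (3 * B / 2 * v ^+ 2) a4.
have h3 : u ^+ 2 * v ^+ 2 <= (u ^+ 4 + v ^+ 4) / 2.
  have := sqr_ge0 (u ^+ 2 - v ^+ 2); rewrite sqrrB -!exprM; lra.
apply: le_trans pq _.
have Bq : B * q ^+ 2 <= 3 * B * (u ^+ 2 * r ^+ 2) + 3 * B * (x ^+ 2 * v ^+ 2)
    + 3 * B * (u ^+ 2 * v ^+ 2).
  apply: le_trans (ler_wpM2l B0 q2) _.
  by rewrite le_eqVlt; apply/orP; left; apply/eqP; ring.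
have h1' : 3 * B * (u ^+ 2 * r ^+ 2) <= a / 4 * r ^+ 4 + D * u ^+ 4.
  have <- : 2 * (r ^+ 2 * (3 * B / 2 * u ^+ 2)) = 3 * B * (u ^+ 2 * r ^+ 2) by field.
  by apply: le_trans h1 _; rewrite le_eqVlt; apply/orP; left; apply/eqP; rewrite /D; ring.
have h2' : 3 * B * (x ^+ 2 * v ^+ 2) <= a / 4 * x ^+ 4 + D * v ^+ 4.
  have <- : 2 * (x ^+ 2 * (3 * B / 2 * v ^+ 2)) = 3 * B * (x ^+ 2 * v ^+ 2) by field.
  by apply: le_trans h2 _; rewrite le_eqVlt; apply/orP; left; apply/eqP; rewrite /D; ring.
have h3' := ler_wpM2l (mulr_ge0 (ler0n _ 3) B0) h3.
have p2' := ler_wpM2l (ltW a2) p2.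
have x4 : 0 <= a * x ^+ 4 by rewrite mulr_ge0 ?(ltW a0)// exprn_even_ge0.
have r4 : 0 <= a * r ^+ 4 by rewrite mulr_ge0 ?(ltW a0)// exprn_even_ge0.
by lra.
Qed.

End Inequalities.

(** * Invertible matrices and their perturbation *)

Section MatrixInversion.
Context {R : realType}.

Lemma unitmx_inj n (M : 'M[R]_n) :
  (forall v : 'cV_n, M *m v = 0 -> v = 0) -> M \in unitmx.
Proof.
move=> M0; rewrite -unitmx_tr -row_free_unit -kermx_eq0; apply/rowV0P => u.
move=> /sub_kermxP uM; apply: trmx_inj; rewrite trmx0; apply: M0.
by apply: trmx_inj; rewrite trmx_mul trmxK uM trmx0.
Qed.

Lemma gram_unitmx m n (W : 'M[R]_(m, n)) : \rank W = n -> W^T *m W \in unitmx.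
Proof.
move=> rW; apply: unitmx_inj => v WWv.
have freeW : row_free W^T by rewrite /row_free mxrank_tr rW.
have Wv : W *m v = 0.
  have E : (v^T *m W^T) *m (W *m v) = 0.
    by rewrite -mulmxA (mulmxA W^T) WWv mulmx0.
  rewrite -trmx_mul in E; move: (W *m v) E => y E.
  have /eqP : \sum_i y i 0 ^+ 2 = 0.
    have := congr1 (fun M : matrix R 1 1 => M 0 0) E.
    rewrite [in RHS]mxE => E0; rewrite -[RHS]E0 mxE.
    by apply: eq_bigr => i _; rewrite mxE expr2.
  rewrite psumr_eq0; last by move=> i _; exact: sqr_ge0.
  move=> /allP y0; apply/colP => i; rewrite mxE; apply/eqP.
  by rewrite -sqrf_eq0; apply: y0; rewrite mem_index_enum.
apply: trmx_inj; apply/eqP; rewrite trmx0 -(mulmx_free_eq0 _ freeW).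
by rewrite -trmx_mul Wv trmx0.
Qed.

Lemma posdefmx_unit n (Q : 'M[R]_n) : posdefmx Q -> Q \in unitmx.
Proof.
move=> [_ Q0]; apply: unitmx_inj => v Qv; apply/eqP/negP => /negP v0.
by have := Q0 v v0; rewrite -mulmxA Qv mulmx0 mxE ltxx.
Qed.

Definition norm1 n (v : 'cV[R]_n) : R := \sum_i `|v i 0|.

Lemma norm1_mulmx_le m n (L : 'M[R]_(m, n)) (v : 'cV[R]_n) (e : R) :
  (forall i j, `|L i j| <= e) -> norm1 (L *m v) <= m%:R * e * norm1 v.
Proof.
move=> Le; rewrite /norm1.
apply: (@le_trans _ _ (\sum_(i < m) e * \sum_j `|v j 0|)); last first.
  by rewrite sumr_const card_ord -mulrA mulr_natl.
apply: ler_sum => i _; rewrite mxE; apply: le_trans (ler_norm_sum _ _ _) _.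
by rewrite mulr_sumr; apply: ler_sum => j _; rewrite normrM ler_wpM2r.
Qed.

Lemma norm1D n (u v : 'cV[R]_n) : norm1 (u + v) <= norm1 u + norm1 v.
Proof.
by rewrite /norm1 -big_split; apply: ler_sum => i _; rewrite mxE ler_normD.
Qed.

Lemma norm1N n (u : 'cV[R]_n) : norm1 (- u) = norm1 u.
Proof. by apply: eq_bigr => i _; rewrite mxE normrN. Qed.

Lemma norm1_ge0 n (u : 'cV[R]_n) : 0 <= norm1 u.
Proof. by apply: sumr_ge0. Qed.

Lemma norm1_eq0 n (u : 'cV[R]_n) : norm1 u <= 0 -> u = 0.
Proof.
move=> u0; have /eqP : norm1 u = 0 by apply/eqP; rewrite eq_le u0 norm1_ge0.
rewrite psumr_eq0// => /allP H; apply/colP => i; rewrite mxE.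
by apply/eqP; rewrite -normr_eq0; apply: H; rewrite mem_index_enum.
Qed.

(** A lower bound on M v replaces continuity of the inverse: it yields invertibility and a bound on
    the inverse at once. From v = Q^-1 (M v - (M - Q) v) one gets |v| <= k |M v| + k n e |v|, and
    the last term is absorbed when k n e <= 1/2. *)
Lemma perturb_unitmx n (Q : 'M[R]_n) : Q \in unitmx ->
  exists e c : R, [/\ 0 < e, 0 <= c & forall M : 'M[R]_n,
    (forall i j, `|M i j - Q i j| <= e) ->
    M \in unitmx /\ forall v : 'cV_n, norm1 v <= c * norm1 (M *m v)].
Proof.
move=> Qu; pose b := \sum_i \sum_j `|invmx Q i j|.
have b0 : 0 <= b by apply: sumr_ge0 => i _; exact: sumr_ge0.
have bQ i j : `|invmx Q i j| <= b.
  rewrite /b (bigD1 i)//= (bigD1 j)//= -addrA lerDl addr_ge0//.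
    exact: sumr_ge0.
  by apply: sumr_ge0 => k _; exact: sumr_ge0.
(* k bounds the operator norm of Q^-1 for [norm1]; the 1 added below keeps e meaningful when k n =
   0. *)
pose k := n%:R * b; have k0 : 0 <= k by rewrite mulr_ge0.
have d0 : 0 < 2 * (k * n%:R + 1) by rewrite mulr_gt0// ltr_wpDl// mulr_ge0.
pose e := (2 * (k * n%:R + 1))^-1; have e0 : 0 < e by rewrite invr_gt0.
exists e, (2 * k); split; [exact: e0|by rewrite mulr_ge0|].
move=> M MQ.
have bound v : norm1 v <= 2 * k * norm1 (M *m v).
  have vE : v = invmx Q *m (M *m v - (M - Q) *m v).
    by rewrite -mulmxBl opprB addrCA subrr addr0 mulKmx.
  have h1 : norm1 v <= k * norm1 (M *m v - (M - Q) *m v).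
    by rewrite {1}vE; exact: norm1_mulmx_le.
  have h2 := norm1D (M *m v) (- ((M - Q) *m v)).
  rewrite norm1N in h2.
  have h3 : norm1 ((M - Q) *m v) <= n%:R * e * norm1 v.
    by apply: norm1_mulmx_le => i j; rewrite !mxE.
  have h4 : k * (n%:R * e) <= 2^-1.
    rewrite mulrA /e ler_pdivrMr// mulrA mulVf// mul1r; lra.
  have h5 := ler_wpM2l k0 (le_trans h2 (lerD (lexx _) h3)).
  have h6 := ler_wpM2r (norm1_ge0 v) h4.
  have : k * (n%:R * e * norm1 v) = k * (n%:R * e) * norm1 v by rewrite mulrA.
  rewrite mulrDr in h5; lra.
split=> //; apply: unitmx_inj => v Mv; apply: norm1_eq0.
apply: le_trans (bound v) _; rewrite Mv /norm1 big1 ?mulr0// => i _.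
by rewrite mxE normr0.
Qed.

End MatrixInversion.

(** * Moment bounds for shift-share aggregates *)

Section MatrixMeasurability.
Context {d : measure_display} {T : measurableType d} {R : realType}.
Variable G : set (set T).
Implicit Types f g : T -> R.

Lemma gmeasV f : gmeas G f -> gmeas G (fun x => (f x)^-1).
Proof.
move=> mf.
(* The measurable function [powR] computes the inverse at the nonnegative argument f^2; the factor f
   restores the sign and gives the value 0 where f = 0. *)
have -> : (fun x => (f x)^-1) = (fun x => f x * powR (f x ^+ 2) (-1)).
  apply/funext => x; rewrite powR_inv1 ?sqr_ge0//.
  have [->|fx] := eqVneq (f x) 0; first by rewrite invr0 mul0r.
  by field.
apply: gmeasM => //.
have mp : measurable_fun [set: R] (fun y : R => powR y (-1)).
  exact: measurable_powR.
exact: (measurableT_comp mp (gmeasX 2 mf)).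
Qed.

Lemma gmeas_prod (I : Type) (s : seq I) (h : I -> T -> R) :
  (forall i, gmeas G (h i)) -> gmeas G (fun x => \prod_(i <- s) h i x).
Proof.
move=> mh; elim: s => [|i s ih].
  by under eq_fun do rewrite big_nil; exact: gmeas_cst.
by under eq_fun do rewrite big_cons; exact: gmeasM.
Qed.

Lemma gmeas_norm f : gmeas G f -> gmeas G (fun x => `|f x|).
Proof. by move=> mf; exact: (measurableT_comp (@normr_measurable R setT) mf). Qed.

Definition gmx m n (M : T -> 'M[R]_(m, n)) := forall i j, gmeas G (fun x => M x i j).

Lemma gmx_mulmx m n p (M : T -> 'M[R]_(m, n)) (M' : T -> 'M[R]_(n, p)) :
  gmx M -> gmx M' -> gmx (fun x => M x *m M' x).
Proof.
move=> mM mM' i j; under eq_fun do rewrite mxE.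
by apply: gmeas_sum => k; apply: gmeasM; [exact: mM|exact: mM'].
Qed.

Lemma gmx_add m n (M M' : T -> 'M[R]_(m, n)) :
  gmx M -> gmx M' -> gmx (fun x => M x + M' x).
Proof.
by move=> mM mM' i j; under eq_fun do rewrite mxE; apply: gmeasD; [exact: mM|exact: mM'].
Qed.

Lemma gmx_sub m n (M M' : T -> 'M[R]_(m, n)) :
  gmx M -> gmx M' -> gmx (fun x => M x - M' x).
Proof.
by move=> mM mM' i j; under eq_fun do rewrite !mxE; apply: gmeasB; [exact: mM|exact: mM'].
Qed.

Lemma gmx_scale m n (k : T -> R) (M : T -> 'M[R]_(m, n)) :
  gmeas G k -> gmx M -> gmx (fun x => k x *: M x).
Proof.
by move=> mk mM i j; under eq_fun do rewrite mxE; apply: gmeasM => //; exact: mM.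
Qed.

Lemma gmx_cst m n (M : 'M[R]_(m, n)) : gmx (fun=> M).
Proof. by move=> i j; exact: gmeas_cst. Qed.

Lemma gmx_tr m n (M : T -> 'M[R]_(m, n)) : gmx M -> gmx (fun x => (M x)^T).
Proof. by move=> mM i j; under eq_fun do rewrite mxE; exact: mM. Qed.

Lemma gmeas_det n (M : T -> 'M[R]_n) : gmx M -> gmeas G (fun x => \det (M x)).
Proof.
move=> mM; apply: gmeas_sum => s; apply: gmeasM; first exact: gmeas_cst.
by apply: gmeas_prod => i; exact: mM.
Qed.

Lemma gmx_invmx n (M : T -> 'M[R]_n) : gmx M -> gmx (fun x => invmx (M x)).
Proof.
move=> mM i j; have mD := gmeas_det mM.
have mA : gmeas G (fun x => (\adj (M x)) i j).
  under eq_fun do rewrite mxE; apply: gmeasM; first exact: gmeas_cst.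
  by apply: gmeas_det => k l; under eq_fun do rewrite !mxE; exact: mM.
(* Cramer's formula, plus a term equal to M where the determinant vanishes and to 0 elsewhere:
   [invmx] returns a singular matrix unchanged. *)
have -> : (fun x => invmx (M x) i j) = (fun x => (\det (M x))^-1 * (\adj (M x)) i j +
    (1 - \det (M x) * (\det (M x))^-1) * M x i j).
  apply/funext => x; rewrite /invmx unitmxE unitfE.
  case: eqP => [->|/eqP dM] /=; first by rewrite invr0 mul0r add0r mulr0 subr0 mul1r.
  by rewrite mxE divff// subrr mul0r addr0.
apply: gmeasD; first by apply: gmeasM => //; exact: gmeasV.
apply: gmeasM; last exact: mM.
by apply: gmeasB; [exact: gmeas_cst|apply: gmeasM => //; exact: gmeasV].
Qed.

End MatrixMeasurability.

(** * Conditional fourth moments *)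

Section FourthMoments.
Context {d : measure_display} {T : measurableType d} {R : realType}.
Variables (P : probability T R) (G : set (set T)).
Hypothesis GT : <<s G >> `<=` measurable.
Implicit Types a b : T -> R.

(* E[a^4 | G] <= C *)
Definition w4 a (C : R) :=
  measurable_fun setT a /\ wbnd P G (fun x => a x ^+ 4) C.

Lemma pow4_ge0 (x : R) : 0 <= x ^+ 4.
Proof. by rewrite exprn_even_ge0. Qed.

Lemma w4_le a b C : measurable_fun setT a -> w4 b C ->
  {ae P, forall x, `|a x| <= `|b x|} -> w4 a C.
Proof.
move=> ma [mb bC] ab; split=> //; apply: (wbnd_le GT bC).
- exact: measurable_funX.
- by move=> x; exact: pow4_ge0.
- apply: filterS ab => x abx.
  rewrite -(ger0_norm (pow4_ge0 (a x))) -(ger0_norm (pow4_ge0 (b x))) !normrX.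
  by rewrite ler_pXn2r ?nnegrE.
Qed.

Lemma w4_bounded a (B : R) : measurable_fun setT a -> 0 <= B ->
  {ae P, forall x, `|a x| <= B} -> w4 a (B ^+ 4).
Proof.
move=> ma B0 aB; apply: (@w4_le _ (fun=> B)) => //; last first.
  by apply: filterS aB => x; rewrite (ger0_norm B0).
by split=> //; apply: wbnd_cst => //; exact: pow4_ge0.
Qed.

Lemma w4D a b C C' : w4 a C -> w4 b C' ->
  w4 (fun x => a x + b x) (8 * (C + C')).
Proof.
move=> [ma aC] [mb bC]; split; first exact: measurable_funD.
apply: (wbnd_le GT (wbndZ GT (wbndD GT aC bC) (ler0n R 8))).
- by apply: measurable_funX; exact: measurable_funD.
- by move=> x; exact: pow4_ge0.
- by apply: aeW => x; exact: pow4D.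
Qed.

Lemma w4B a b C C' : w4 a C -> w4 b C' ->
  w4 (fun x => a x - b x) (8 * (C + C')).
Proof.
move=> aC bC; apply: w4D => //; apply: (w4_le _ bC).
  by apply: measurable_funN; case: bC.
by apply: aeW => x; rewrite normrN.
Qed.

(** The power mean inequality with weights |c_j| of total mass at most D costs D^3; the remaining
    average of fourth powers costs C D. For a row of shares, D = 1. *)
Lemma w4_comb (J : finType) (c a : J -> T -> R) (C D : R) : 0 <= C ->
  (forall j, w4 (a j) C) -> (forall j, gmeas G (c j)) -> 0 <= D ->
  {ae P, forall x, \sum_j `|c j x| <= D} ->
  w4 (fun x => \sum_j c j x * a j x) (D ^+ 3 * (C * D)).
Proof.
move=> C0 aC mc D0 cD.
have mcT j := gmeas_measurable GT (mc j).
have ma j : measurable_fun setT (a j) by case: (aC j).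
have mS : measurable_fun setT (fun x => \sum_j c j x * a j x).
  by apply: measurable_sum => j; exact: measurable_funM.
split=> //.
have aC4 j : wbnd P G (fun x => a j x ^+ 4) C by case: (aC j).
have mN j : gmeas G (fun x => `|c j x|) by exact: gmeas_norm.
have H := wbndZ GT (wbnd_comb GT C0 aC4 mN (fun j x => normr_ge0 _) D0 cD)
  (exprn_ge0 3 D0).
apply: (wbnd_le GT H).
- exact: measurable_funX.
- by move=> x; exact: pow4_ge0.
- apply: filterS cD => x cDx; apply: le_trans (abs_weighted_pow4_sum _ _) _.
  rewrite ler_wpM2r//.
    by apply: sumr_ge0 => j _; rewrite mulr_ge0// pow4_ge0.
  by rewrite ler_pXn2r ?nnegrE//; exact: sumr_ge0.
Qed.

Lemma w4_w2 a C : w4 a C -> wbnd P G (fun x => a x ^+ 2) (1 + C).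
Proof.
move=> [ma aC]; apply: (wbnd_le GT (wbndD GT (wbnd_cst P GT ler01) aC)).
- exact: measurable_funX.
- by move=> x; exact: sqr_ge0.
- apply: aeW => x; have := sqr_ge0 (a x ^+ 2 - 1); have := sqr_ge0 (a x ^+ 2 + 1).
  by rewrite sqrrB sqrrD -!exprM !expr1n; have := sqr_ge0 (a x); lra.
Qed.

Lemma w4_L1sqr a C : w4 a C -> L1 P (fun x => a x ^+ 2).
Proof. by move/w4_w2; exact: wbnd_L1. Qed.

Lemma L1M_of_sqr a b : measurable_fun setT a -> measurable_fun setT b ->
  L1 P (fun x => a x ^+ 2) -> L1 P (fun x => b x ^+ 2) ->
  L1 P (fun x => a x * b x).
Proof.
move=> ma mb a2 b2; apply: (L1_dom _ (L1D a2 b2)); first exact: measurable_funM.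
move=> x; rewrite [leRHS]ger0_norm ?addr_ge0 ?sqr_ge0//.
rewrite normrM -(real_normK (num_real (a x))) -(real_normK (num_real (b x))).
by have := sqr_ge0 (`|a x| - `|b x|); have := normr_ge0 (a x);
  have := normr_ge0 (b x); nra.
Qed.

End FourthMoments.

Section SigmaGen.
Context {d : measure_display} {T : measurableType d} {R : realType}.

Lemma sigma_gen_preimage (I : Type) (f : I -> T -> R) i (B : set R) :
  measurable B -> sigma_gen f (f i @^-1` B).
Proof.
move=> mB; apply: sub_sigma_algebra; exists i => //.
by exists B => //; rewrite setTI.
Qed.

Lemma sigma_gen_measurable (I : Type) (f : I -> T -> R) :
  (forall i, measurable_fun setT (f i)) -> sigma_gen f `<=` measurable.
Proof.
move=> mf; apply: smallest_sub; first exact: sigma_algebra_measurable.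
by move=> _ [i _ [B mB <-]]; exact: mf.
Qed.

End SigmaGen.

(** * One row of the array: sigma-fields and weighted averages *)

Section RowSigma.
Context {R : realType} {K S : nat} (A : shift_share R K S).
Local Notation N := (regions A).
Local Notation T := (sample A).
Local Notation P := (prob A).

(** [gen_W] and [gen_0] name the generating families, so that [<<s gen_W >>] and [<<s gen_0 >>] are
    [sigma_W] and [F0] by conversion, in the shape that the lemmas on a family G expect. *)
Definition gen_W : set (set T) :=
  \bigcup_j preimage_set_system setT
    ((fun j : 'I_N * 'I_S => share j.1 j.2 : T -> R) j) measurable.

Definition gen_0 : set (set T) :=
  sigma_gen (fun j : 'I_S * 'I_K => sctl A j.1 j.2 : T -> R) `|`
  sigma_gen (fun j : 'I_N * 'I_K => noise j.1 j.2 : T -> R) `|`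
  sigma_gen (fun i : 'I_N => y0 i : T -> R) `|`
  sigma_gen (fun j : 'I_N * 'I_S => coef j.1 j.2 : T -> R) `|`
  sigma_gen (fun j : 'I_N * 'I_S => share j.1 j.2 : T -> R).

Lemma gen_0_measurable : <<s gen_0 >> `<=` measurable.
Proof.
apply: smallest_sub; first exact: sigma_algebra_measurable.
by move=> E [[[[]|]|]|]; apply: sigma_gen_measurable => j.
Qed.

Lemma gen_W_sub0 : <<s gen_W >> `<=` <<s gen_0 >>.
Proof. by move=> E WE; apply: sub_sigma_algebra; right. Qed.

Lemma gen_W_measurable : <<s gen_W >> `<=` measurable.
Proof. exact: subset_trans gen_W_sub0 gen_0_measurable. Qed.

Lemma gW_share i s : gmeas gen_W (share i s : T -> R).
Proof. by apply/gmeasP => B mB; exact: (@sigma_gen_preimage _ _ _ _ (fun j : 'I_N * 'I_S => share j.1 j.2 : T -> R) (i, s)). Qed.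

Lemma g0_share i s : gmeas gen_0 (share i s : T -> R).
Proof. exact: (gmeas_sub gen_W_sub0 (@gW_share i s)). Qed.

Lemma g0_sctl s k : gmeas gen_0 (sctl A s k : T -> R).
Proof.
apply/gmeasP => B mB; apply: sub_sigma_algebra; do 4 left.
exact: (@sigma_gen_preimage _ _ _ _ (fun j : 'I_S * 'I_K => sctl A j.1 j.2 : T -> R) (s, k)).
Qed.

Lemma g0_noise i k : gmeas gen_0 (noise i k : T -> R).
Proof.
apply/gmeasP => B mB; apply: sub_sigma_algebra; do 3 left; right.
exact: (@sigma_gen_preimage _ _ _ _ (fun j : 'I_N * 'I_K => noise j.1 j.2 : T -> R) (i, k)).
Qed.

Lemma g0_y0 i : gmeas gen_0 (y0 i : T -> R).
Proof.
apply/gmeasP => B mB; apply: sub_sigma_algebra; do 2 left; right.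
exact: (@sigma_gen_preimage _ _ _ _ (fun i : 'I_N => y0 i : T -> R) i).
Qed.

Lemma gW_sector_size s : gmeas gen_W (@sector_size _ _ _ A s).
Proof. by apply: gmeas_sum => i; exact: gW_share. Qed.

Lemma gW_sum_n2 : gmeas gen_W (@sum_n2 _ _ _ A).
Proof. by apply: gmeas_sum => s; apply: gmeasX; exact: gW_sector_size. Qed.

Lemma gW_Wmx : gmx gen_W (@Wmx _ _ _ A).
Proof. by move=> i s; under eq_fun do rewrite mxE; exact: gW_share. Qed.

Lemma gW_W_pinv : gmx gen_W (@W_pinv _ _ _ A).
Proof.
have mW := gW_Wmx; apply: gmx_mulmx; last exact: gmx_tr.
by apply: gmx_invmx; apply: gmx_mulmx => //; exact: gmx_tr.
Qed.

Lemma g0_Zmx : gmx gen_0 (@Zmx _ _ _ A).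
Proof.
apply: gmx_add; last by move=> i k; under eq_fun do rewrite mxE; exact: g0_noise.
apply: gmx_mulmx; first by move=> i s; under eq_fun do rewrite mxE; exact: g0_share.
by move=> s k; under eq_fun do rewrite mxE; exact: g0_sctl.
Qed.

Implicit Types (w : T) (s : 'I_S) (i : 'I_N).

Lemma sector_size_ge0 s w : 0 <= sector_size s w.
Proof. by apply: sumr_ge0 => i _; exact: share_ge0. Qed.

Lemma sum_n2_ge0 w : 0 <= sum_n2 w.
Proof. by apply: sumr_ge0 => s _; exact: sqr_ge0. Qed.

Lemma sum_n_ge0 w : 0 <= sum_n w.
Proof. by apply: sumr_ge0 => s _; exact: sector_size_ge0. Qed.

Lemma sum_n_le w : sum_n w <= N%:R.
Proof.
rewrite /sum_n /sector_size exchange_big/=.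
apply: le_trans (ler_sum _ (fun i _ => share_sum_le1 i w)) _.
by rewrite sumr_const card_ord.
Qed.

Lemma sum_n2_le w : sum_n2 w <= max_n w * sum_n w.
Proof.
rewrite /sum_n2 /sum_n mulr_sumr; apply: ler_sum => s _.
rewrite expr2 ler_wpM2r ?sector_size_ge0//.
exact: (le_bigmax _ (fun s => sector_size s w)).
Qed.

Lemma sum_n4_le w : \sum_s sector_size s w ^+ 4 <= max_n2 w * sum_n2 w.
Proof.
rewrite /sum_n2 mulr_sumr; apply: ler_sum => s _.
rewrite (exprD _ 2 2) ler_wpM2r ?sqr_ge0//.
exact: (le_bigmax _ (fun s => sector_size s w ^+ 2)).
Qed.

(* With p_s = n_s^2 / sum_t n_t^2, [Phi a] is sum_s p_s a_s^4 and [Psi r] is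
   sum_s p_s (r_s / n_s)^4; a sector with n_s = 0 contributes 0 to both. *)
Definition Phi (a : 'I_S -> T -> R) w : R :=
  \sum_s sector_size s w ^+ 2 / sum_n2 w * a s w ^+ 4.

Definition Psi (r : 'I_S -> T -> R) w : R :=
  \sum_s (sector_size s w ^+ 2)^-1 / sum_n2 w * r s w ^+ 4.

Definition Wsum (e : 'I_N -> T -> R) (s : 'I_S) w : R :=
  \sum_i share i s w * e i w.

Lemma sum_n2_weights w : \sum_s sector_size s w ^+ 2 / sum_n2 w <= 1.
Proof.
rewrite -mulr_suml -/(sum_n2 w); have [->|n0] := eqVneq (sum_n2 w) 0.
  by rewrite mul0r.
by rewrite divff.
Qed.

Lemma Phi_wbnd a C : 0 <= C -> (forall s, w4 P gen_W (a s) C) ->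
  wbnd P gen_W (Phi a) C.
Proof.
move=> C0 aC; rewrite -[C]mulr1; apply: wbnd_comb => //.
- exact: gen_W_measurable.
- by move=> s; case: (aC s).
- move=> s; apply: gmeasM; first by apply: gmeasX; exact: gW_sector_size.
  by apply: gmeasV; exact: gW_sum_n2.
- by move=> s w; rewrite divr_ge0 ?sqr_ge0// sum_n2_ge0.
- by apply: aeW; exact: sum_n2_weights.
Qed.

Lemma Wsum_measurable e s : (forall i, measurable_fun setT (e i)) ->
  measurable_fun setT (Wsum e s).
Proof.
move=> me; apply: measurable_sum => i; apply: measurable_funM => //.
Qed.

Lemma Wsum_pow4_le e s w :
  Wsum e s w ^+ 4 <= sector_size s w ^+ 3 * \sum_i share i s w * e i w ^+ 4.
Proof. exact: (weighted_pow4_sum (fun i => e i w) (fun i => share_ge0 i s w)). Qed.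

(** Over pairs (s, i) the weights phi_s w_is are W-measurable, and summing over i first makes their
    total mass sum_s phi_s n_s. *)
Lemma pair_wbnd (phi : 'I_S -> T -> R) (f : 'I_N -> T -> R) C D : 0 <= C ->
  (forall i, wbnd P gen_W (f i) C) ->
  (forall s, gmeas gen_W (phi s)) -> (forall s w, 0 <= phi s w) ->
  0 <= D -> {ae P, forall w, \sum_s phi s w * sector_size s w <= D} ->
  wbnd P gen_W (fun w => \sum_s phi s w * \sum_i share i s w * f i w) (C * D).
Proof.
move=> C0 fC mphi phi0 D0 phiD.
pose c (j : 'I_S * 'I_N) w := phi j.1 w * share j.2 j.1 w.
have cE w (b : 'I_N -> R) : \sum_s phi s w * \sum_i share i s w * b i =
    \sum_j c j w * b j.2.
  rewrite -(pair_bigA _ (fun s i => c (s, i) w * b i))/=; apply: eq_bigr => s _.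
  by rewrite mulr_sumr; apply: eq_bigr => i _; rewrite /c/=; ring.
have c1 w : \sum_j c j w = \sum_s phi s w * sector_size s w.
  have := cE w (fun=> 1); under [in RHS]eq_bigr do rewrite mulr1; move=> <-.
  by apply: eq_bigr => s _; under eq_bigr do rewrite mulr1.
have -> : (fun w => \sum_s phi s w * \sum_i share i s w * f i w) =
    (fun w => \sum_j c j w * f j.2 w).
  by apply/funext => w; rewrite (cE w (fun i => f i w)).
apply: wbnd_comb => //; first exact: gen_W_measurable.
- by move=> j; apply: gmeasM; [exact: mphi|exact: gW_share].
- by move=> j w; rewrite mulr_ge0// share_ge0.
- by apply: filterS phiD => w; rewrite c1.
Qed.

(** The fourth power of sum_i w_is e_i is at most n_s^3 sum_i w_is e_i^4, so the factor n_s^-2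
    leaves n_s, and the pairs (s, i) have total weight sum_s n_s^2 / sum_t n_t^2 <= 1. *)
Lemma Psi_wbnd e C : 0 <= C -> (forall i, w4 P gen_W (e i) C) ->
  wbnd P gen_W (Psi (Wsum e)) C.
Proof.
move=> C0 eC.
have me i : measurable_fun setT (e i) by case: (eC i).
have H : wbnd P gen_W (fun w => \sum_s (sector_size s w / sum_n2 w) *
    \sum_i share i s w * e i w ^+ 4) (C * 1).
  apply: pair_wbnd => //.
  - by move=> i; case: (eC i).
  - move=> s; apply: gmeasM; first exact: gW_sector_size.
    by apply: gmeasV; exact: gW_sum_n2.
  - by move=> s w; rewrite divr_ge0 ?sum_n2_ge0// sector_size_ge0.
  - apply: aeW => w; apply: le_trans (sum_n2_weights w); apply: ler_sum => s _.
    by rewrite le_eqVlt; apply/orP; left; apply/eqP; ring.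
rewrite mulr1 in H; apply: (wbnd_le gen_W_measurable H).
- apply: measurable_sum => s; apply: measurable_funM.
    apply: (gmeas_measurable gen_W_measurable); apply: gmeasM; apply: gmeasV.
      by apply: gmeasX; exact: gW_sector_size.
    exact: gW_sum_n2.
  by apply: measurable_funX; exact: Wsum_measurable.
- move=> w; apply: sumr_ge0 => s _; apply: mulr_ge0; last exact: pow4_ge0.
  by rewrite divr_ge0 ?sum_n2_ge0// invr_ge0 sqr_ge0.
- apply: aeW => w; apply: ler_sum => s _.
  apply: le_trans (ler_wpM2l _ (Wsum_pow4_le e s w)) _.
    by rewrite divr_ge0 ?sum_n2_ge0// invr_ge0 sqr_ge0.
  have [->|n0] := eqVneq (sector_size s w) 0.
    by rewrite !expr0n/= !(mul0r, mulr0).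
  have [->|n20] := eqVneq (sum_n2 w) 0; first by rewrite invr0 !(mul0r, mulr0).
  rewrite le_eqVlt; apply/orP; left; apply/eqP.
  by field; rewrite n20 n0.
Qed.

Lemma share_le1 i s w : share i s w <= 1.
Proof.
apply: le_trans (share_sum_le1 i w); rewrite (bigD1 s)//= lerDl.
by apply: sumr_ge0 => t _; exact: share_ge0.
Qed.

(** The constant grows with N; the lemma serves for square-integrability only, never for a rate. *)
Lemma Wsum_w4 e C s : 0 <= C -> (forall i, w4 P gen_W (e i) C) ->
  w4 P gen_W (Wsum e s) (N%:R ^+ 3 * (C * N%:R)).
Proof.
move=> C0 eC; apply: w4_comb => //; first exact: gen_W_measurable.
  by move=> i; exact: gW_share.
apply: aeW => w; apply: (@le_trans _ _ (\sum_(i < N) 1)).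
  by apply: ler_sum => i _; rewrite ger0_norm ?share_ge0// share_le1.
by rewrite sumr_const card_ord.
Qed.

Lemma share_comb_w4 i a C : 0 <= C -> (forall s, w4 P gen_W (a s) C) ->
  w4 P gen_W (fun w => \sum_s share i s w * a s w) C.
Proof.
move=> C0 aC; rewrite -[C]mulr1 -[C * 1]mul1r -{1}(expr1n _ 3).
apply: w4_comb => //; first exact: gen_W_measurable.
  by move=> s; exact: gW_share.
apply: aeW => w; apply: le_trans (share_sum_le1 i w).
by apply: ler_sum => s _; rewrite ger0_norm// share_ge0.
Qed.

Lemma pinv_comb_w4 e (C L : R) s : 0 <= C -> (forall i, w4 P gen_W (e i) C) ->
  0 <= L ->
  {ae P, forall w, \big[Num.max/0]_(s < S) \sum_(i < N) `|W_pinv w s i| <= L} ->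
  w4 P gen_W (fun w => \sum_i W_pinv w s i * e i w) (L ^+ 3 * (C * L)).
Proof.
move=> C0 eC L0 WL; apply: w4_comb => //; first exact: gen_W_measurable.
  by move=> i; exact: gW_W_pinv.
apply: filterS WL => w; apply: le_trans.
exact: (le_bigmax _ (fun s => \sum_i `|W_pinv w s i|)).
Qed.

Lemma ZmxE w i k :
  Zmx w i k = \sum_s share i s w * sctl A s k w + noise i k w.
Proof. by rewrite !mxE; congr (_ + _); apply: eq_bigr => s _; rewrite !mxE. Qed.

Lemma Zmx_w4 i k C : 0 <= C -> (forall s, w4 P gen_W (sctl A s k) C) ->
  w4 P gen_W (noise i k) C -> w4 P gen_W (fun w => Zmx w i k) (8 * (C + C)).
Proof.
move=> C0 sC nC; under eq_fun do rewrite ZmxE.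
by apply: w4D => //; [exact: gen_W_measurable|exact: share_comb_w4].
Qed.

(* eps_i when beta_is = beta: then Y_i - X_i beta = Y_i(0). *)
Definition fit_err (c : 'cV[R]_K) i w : R := y0 i w - (Zmx w *m c) i 0.

Lemma g0_fit_err c i : gmeas gen_0 (fit_err c i).
Proof.
apply: gmeasB; first exact: g0_y0.
by apply: gmx_mulmx; [exact: g0_Zmx|exact: gmx_cst].
Qed.

Lemma g0_Wsum e s : (forall i, gmeas gen_0 (e i)) -> gmeas gen_0 (Wsum e s).
Proof.
by move=> me; apply: gmeas_sum => i; apply: gmeasM; [exact: g0_share|exact: me].
Qed.

Lemma g0_Ug c i : gmeas gen_0 (Ug c i : T -> R).
Proof.
apply: gmx_mulmx; last exact: gmx_cst.
by move=> j k; under eq_fun do rewrite mxE; exact: g0_noise.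
Qed.

Lemma linear_comb_w4 m (M : T -> 'M[R]_(m, K)) (c : 'cV[R]_K) (j : 'I_m) C D :
  0 <= C -> (forall k, w4 P gen_W (fun w => M w j k) C) -> norm1 c <= D ->
  w4 P gen_W (fun w => (M w *m c) j 0) (D ^+ 3 * (C * D)).
Proof.
move=> C0 MC cD; have D0 : 0 <= D by exact: le_trans (norm1_ge0 c) cD.
have -> : (fun w => (M w *m c) j 0) = (fun w => \sum_k c k 0 * M w j k).
  by apply/funext => w; rewrite mxE; apply: eq_bigr => k _; rewrite mulrC.
apply: w4_comb => //; first exact: gen_W_measurable.
  by move=> k; exact: gmeas_cst.
exact: aeW.
Qed.

Lemma Ug_w4 c i C : 0 <= C -> (forall k, w4 P gen_W (noise i k) C) ->
  w4 P gen_W (Ug c i) (norm1 c ^+ 3 * (C * norm1 c)).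
Proof.
move=> C0 nC; apply: linear_comb_w4 => // k.
by under eq_fun do rewrite mxE; exact: nC.
Qed.

Lemma fit_err_w4 c i C D : 0 <= C -> w4 P gen_W (y0 i) C ->
  (forall s k, w4 P gen_W (sctl A s k) C) -> (forall k, w4 P gen_W (noise i k) C) ->
  norm1 c <= D ->
  w4 P gen_W (fit_err c i) (8 * (C + D ^+ 3 * (8 * (C + C) * D))).
Proof.
move=> C0 yC sC nC cD; apply: w4B => //; first exact: gen_W_measurable.
apply: linear_comb_w4 => //; first by rewrite mulr_ge0// addr_ge0.
by move=> k; apply: Zmx_w4.
Qed.

Lemma residual_ae (b : R) c :
  (forall i s, {ae P, forall w, coef i s w = b}) ->
  {ae P, forall w, forall i, residual b c w i 0 = fit_err c i w}.
Proof.
move=> cb.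
have : {ae P, forall w, forall i s, coef i s w = b}.
  by apply: filter_forall => i; apply: filter_forall => s; exact: cb.
apply: filterS => w wb i; rewrite /residual /fit_err mxE [in LHS]mxE [X in _ + X]mxE.
congr (_ - _); rewrite [X in _ + X = _]mxE [X in X - _]mxE [X in _ - X]mxE.
rewrite -addrA -[RHS]addr0; congr (_ + _).
rewrite [X in _ * X]mxE mulr_sumr -sumrB big1// => s _.
by rewrite wb !mxE; ring.
Qed.

End RowSigma.

Arguments gen_0 {R K S} A _.
Arguments gen_W {R K S} A _.

Section MoreMoments.
Context {d : measure_display} {T : measurableType d} {R : realType}.
Variables (P : probability T R) (G : set (set T)).
Hypothesis GT : <<s G >> `<=` measurable.
Implicit Types f g b m : T -> R.

Lemma L1_ae_dom f g : measurable_fun setT f -> L1 P g ->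
  {ae P, forall x, `|f x| <= `|g x|} -> L1 P f.
Proof.
move=> mf g1 fg; have mg := L1_measurable g1.
apply/integrableP; split; first exact/measurable_EFinP.
move/integrableP : g1 => [_]; apply: le_lt_trans.
apply: (@ge0_int_ae_le _ _ _ P (fun x => `|f x|) (fun x => `|g x|)) => //.
- exact: measurableT_comp.
- exact: measurableT_comp.
Qed.

Lemma wbnd_int_on b C A : wbnd P G b C -> <<s G >> A ->
  (\int[P]_(x in A) (b x)%:E <= C%:E * P A)%E.
Proof.
move=> [mb b0 C0 bC] GA; have mA := GT GA.
rewrite int_indicM//; apply: le_trans (bC _ (gmeas_indic GA) _) _.
  by move=> x; rewrite indicE.
by rewrite integral_indic// setIT.
Qed.

Lemma condexp_opp f m : is_condexp P <<s G >> f m ->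
  is_condexp P <<s G >> (fun x => - f x) (fun x => - m x).
Proof.
move=> cm; have [f1 m1] := condexp_L1 cm; have mm := condexp_gmeas cm.
have opp (h : T -> R) : L1 P h -> L1 P (fun x => - h x).
  by move=> h1; have := L1Z (-1) h1; under eq_fun do rewrite mulN1r.
split; [exact: opp|exact: opp| |].
- by apply/gmeasP; exact: measurable_funN.
- move=> A GA; have mA := GT GA.
  have E (h : T -> R) : L1 P h -> (\int[P]_(x in A) (- h x)%:E =
      \int[P]_(x in A) (0 : R)%:E - \int[P]_(x in A) (h x)%:E)%E.
    move=> h1; rewrite -intB//; last exact: L1_cst.
    by apply: eq_integral => x _; rewrite sub0r.
  by rewrite !E//; case: cm => _ _ _ ->.
Qed.

(** Counterpart of [wbnd_condexp]: a weighted bound is turned back into an almost sure bound on a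
    given version, by comparing integrals over G-sets. *)
Lemma condexp_le_wbnd f m b C : is_condexp P <<s G >> f m ->
  wbnd P G b C -> {ae P, forall x, f x <= b x} -> {ae P, forall x, m x <= C}.
Proof.
move=> cm bC fb; have [f1 m1] := condexp_L1 cm; have mm := condexp_gmeas cm.
apply: (ae_le_int GT mm _ m1); [exact: gmeas_cst|exact: L1_cst|].
move=> A GA; have mA := GT GA; rewrite integral_cst//.
apply: le_trans (wbnd_int_on bC GA); case: cm => _ _ _ ->//.
have b1 := wbnd_L1 bC; pose f' x := Num.min (f x) (b x).
have mf' : measurable_fun setT f'.
  by apply: measurable_minr; [exact: (L1_measurable f1)|exact: (L1_measurable b1)].
have ff' : {ae P, forall x, f x = f' x}.
  by apply: filterS fb => x fbx; rewrite /f' min_l.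
rewrite (int_ae_eq mA (L1_measurable f1) mf' ff'); apply: le_integral => //.
- apply: integrableS (L1_ae_eq mf' _ f1) => //.
  by apply: filterS ff' => x ->.
- by apply: integrableS b1.
- by move=> x _; rewrite /= lee_fin /f' ge_min lexx orbT.
Qed.

Lemma condexp_ge0 f m : is_condexp P <<s G >> f m -> (forall x, 0 <= f x) ->
  {ae P, forall x, 0 <= m x}.
Proof.
move=> cm f0; have : {ae P, forall x, - m x <= 0}.
  apply: (condexp_le_wbnd (condexp_opp cm) (wbnd_cst P GT (lexx 0))).
  by apply: aeW => x; rewrite oppr_le0.
by apply: filterS => x; rewrite oppr_le0.
Qed.

Lemma wbnd_sqr_L1 b z C : wbnd P G (fun x => b x ^+ 2) C ->
  measurable_fun setT b -> gmeas G z -> L1 P (fun x => z x ^+ 2) ->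
  L1 P (fun x => (b x * z x) ^+ 2).
Proof.
move=> [_ _ C0 bC] mb mz z1; have mzT := gmeas_measurable GT mz.
apply: L1_lty.
- by apply: measurable_funX; exact: measurable_funM.
- by move=> x; exact: sqr_ge0.
- have := bC (fun x => z x ^+ 2) (gmeasX 2 mz) (fun x => sqr_ge0 _).
  under eq_integral do rewrite mulrC -exprMn.
  move/le_lt_trans; apply.
  have : (\int[P]_x (z x ^+ 2)%:E < +oo)%E by exact: (integrable_lty measurableT z1).
  have : (0 <= \int[P]_x (z x ^+ 2)%:E)%E.
    by apply: integral_ge0 => x _; rewrite lee_fin sqr_ge0.
  by case: (\int[P]_x (z x ^+ 2)%:E)%E => // r _ _; rewrite -EFinM ltry.
Qed.

End MoreMoments.

(** * Conditionally independent shocks *)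

Section Shocks.
Context {R : realType} {K S : nat} (A : shift_share R K S).
Variable gamma : 'cV[R]_K.
Local Notation N := (regions A).
Local Notation T := (sample A).
Local Notation P := (prob A).
Implicit Types (s : 'I_S) (i : 'I_N) (w : T).

Definition shock_mean s w : R := (sctlmx w *m gamma) s 0.

Definition shock_err s w : R := shock A s w - shock_mean s w.

Variables (nu Mx : R) (v : 'I_S -> T -> R).
Hypothesis nu0 : 0 < nu.
Hypothesis meanX : forall s, is_condexp P (F0 A) (shock A s) (shock_mean s).
Hypothesis indepX :
  cond_independent P (F0 A) (fun s => shock A s : T -> R).
Hypothesis momX : forall s, exists2 m,
  is_condexp P (F0 A) (fun w => `|shock A s w| `^ (4 + nu)) m &
  {ae P, forall w, m w <= Mx}.
Hypothesis varX : forall s, is_condvar P (F0 A) (shock A s) (v s).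

Let GT := @gen_0_measurable _ _ _ A.

(** The constants come from x^4 <= 1 + |x|^(4 + nu); from |x| <= 1 + x^4, which bounds the
    conditional mean m by 1 + [shock_bound], with (x - m)^4 <= 8 (x^4 + m^4); and, for an error y
    with conditional variance v, from (y^2 - v)^2 <= 2 (y^4 + v^2) with 0 <= v <= 1 +
    [err_bound]. *)
Definition shock_bound : R := 1 + `|Mx|.
Definition err_bound : R := 8 * (shock_bound + (1 + shock_bound) ^+ 4).
Definition sqr_err_bound : R := 2 * (err_bound + (1 + err_bound) ^+ 2).

Let sb0 : 0 <= shock_bound. Proof. by rewrite addr_ge0. Qed.
Let eb0 : 0 <= err_bound.
Proof. by rewrite mulr_ge0// addr_ge0// exprn_ge0// addr_ge0. Qed.

Lemma shock_w4 s : w4 P (gen_0 A) (shock A s) shock_bound.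
Proof.
split=> //; have [m cm mM] := momX s.
have H : wbnd P (gen_0 A) (fun w => `|shock A s w| `^ (4 + nu)) `|Mx|.
  apply: (wbnd_condexp GT _ _ cm) => //.
  by apply: filterS mM => w /le_trans; apply; exact: ler_norm.
apply: (wbnd_le GT (wbndD GT (wbnd_cst P GT ler01) H)).
- exact: measurable_funX.
- by move=> w; exact: pow4_ge0.
- apply: aeW => w; have [x1|x1] := leP `|shock A s w| 1.
    apply: (@le_trans _ _ 1); last by rewrite lerDl powR_ge0.
    by rewrite -(ger0_norm (pow4_ge0 _)) normrX exprn_ile1.
  apply: (@le_trans _ _ (`|shock A s w| `^ (4 + nu))); last by rewrite lerDr.
  rewrite -(ger0_norm (pow4_ge0 _)) normrX -powR_mulrn// ler_powR ?(ltW x1)//.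
  by rewrite lerDl ltW.
Qed.

Lemma shock_mean_bounded s : {ae P, forall w, `|shock_mean s w| <= 1 + shock_bound}.
Proof.
have [_ sw] := shock_w4 s.
have H := wbndD GT (wbnd_cst P GT ler01) sw.
have pow4 (x : R) : `|x| <= 1 + x ^+ 4.
  rewrite -(ger0_norm (pow4_ge0 x)) normrX; set y := `|x|.
  have y0 : 0 <= y by exact: normr_ge0.
  have [y1|y1] := leP y 1; first by apply: le_trans y1 _; rewrite lerDl exprn_ge0.
  apply: (@le_trans _ _ (y ^+ 4)); last by rewrite lerDr.
  by rewrite ler_eXnr// ltW.
have up : {ae P, forall w, shock_mean s w <= 1 + shock_bound}.
  apply: (condexp_le_wbnd GT (meanX s) H); apply: aeW => w.
  exact: le_trans (ler_norm _) (pow4 _).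
have down : {ae P, forall w, - shock_mean s w <= 1 + shock_bound}.
  apply: (condexp_le_wbnd GT (condexp_opp GT (meanX s)) H); apply: aeW => w.
  by apply: le_trans (ler_norm _) _; rewrite normrN; exact: pow4.
apply: filterS2 up down => w h1 h2; rewrite ler_norml h1 andbT.
by rewrite lerNl.
Qed.

Lemma g0_shock_mean s : gmeas (gen_0 A) (shock_mean s).
Proof. exact: condexp_gmeas (meanX s). Qed.

Lemma shock_err_measurable s : measurable_fun setT (shock_err s).
Proof.
by apply: measurable_funB => //; exact: (gmeas_measurable GT (g0_shock_mean s)).
Qed.

Lemma shock_err_w4 s : w4 P (gen_0 A) (shock_err s) err_bound.
Proof.
apply: w4B; [exact: GT|exact: shock_w4|].
apply: (w4_bounded GT); last exact: shock_mean_bounded.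
- exact: (gmeas_measurable GT (g0_shock_mean s)).
- by rewrite addr_ge0.
Qed.

Lemma shock_err_zmean s : zmean P (gen_0 A) (shock_err s).
Proof. exact: condexp_zmean (meanX s). Qed.

(** [is_condvar] brings its own version of the conditional mean, equal to Z_s' gamma only almost
    surely; here v is tied to [shock_err] itself. *)
Lemma condvar_shock_err s :
  [/\ gmeas (gen_0 A) (v s), L1 P (v s),
      {ae P, forall w, `|v s w| <= 1 + err_bound} &
      zmean P (gen_0 A) (fun w => shock_err s w ^+ 2 - v s w)].
Proof.
have [m cm cv] := varX s; have [sq1 v1] := condexp_L1 cv.
have mm : {ae P, forall w, m w = shock_mean s w} := condexp_ae_eq GT cm (meanX s).
have eE : {ae P, forall w, shock_err s w ^+ 2 = (shock A s w - m w) ^+ 2}.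
  by apply: filterS mm => w ->.
have e2 := w4_w2 GT (shock_err_w4 s).
have me := shock_err_measurable s.
split; [exact: condexp_gmeas cv|exact: v1| |].
- have up : {ae P, forall w, v s w <= 1 + err_bound}.
    apply: (condexp_le_wbnd GT cv e2).
    by apply: filterS eE => w ->.
  have lo : {ae P, forall w, 0 <= v s w}.
    by apply: (condexp_ge0 GT cv) => w; exact: sqr_ge0.
  by apply: filterS2 up lo => w up lo; rewrite ger0_norm.
- split; first by apply: L1B => //; exact: wbnd_L1 e2.
  move=> B GB; have mB := GT GB; rewrite intB//; last exact: wbnd_L1 e2.
  rewrite (int_ae_eq mB _ _ eE); last 2 first.
    exact: measurable_funX.
    exact: (L1_measurable sq1).
  by case: cv => _ _ _ <-//; rewrite subee// int_fin_num.
Qed.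

Lemma sqr_err_wbnd s :
  wbnd P (gen_0 A) (fun w => (shock_err s w ^+ 2 - v s w) ^+ 2) sqr_err_bound.
Proof.
have [mv v1 vb _] := condvar_shock_err s; have [me e4] := shock_err_w4 s.
have c0 : 0 <= (1 + err_bound) ^+ 2 by exact: sqr_ge0.
have H := wbndZ GT (wbndD GT e4 (wbnd_cst P GT c0)) (ler0n R 2).
have mvT := L1_measurable v1.
apply: (wbnd_le GT H).
- by apply: measurable_funX; apply: measurable_funB => //; exact: measurable_funX.
- by move=> w; exact: sqr_ge0.
- apply: filterS vb => w vw.
  have v2 : v s w ^+ 2 <= (1 + err_bound) ^+ 2.
    by rewrite -(real_normK (num_real (v s w))) ler_pXn2r ?nnegrE// addr_ge0.
  move: (shock_err s w) (v s w) v2 => x y v2.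
  have := sqr_ge0 (x ^+ 2 + y).
  by rewrite sqrrD sqrrB -!exprM; lra.
Qed.

Lemma shock_pair s t : s != t -> pair_independent P (gen_0 A) (shock A s) (shock A t).
Proof.
move=> st.
by apply: (cond_independent_pair GT (X := fun s => shock A s : T -> R)).
Qed.

Lemma rects_shock_err s : gmeas (rects (gen_0 A) (shock A s)) (shock_err s).
Proof.
apply: gmeasB; first exact: gmeas_rects_self.
by apply: gmeas_rects; exact: g0_shock_mean.
Qed.

Lemma rects_sqr_err s :
  gmeas (rects (gen_0 A) (shock A s)) (fun w => shock_err s w ^+ 2 - v s w).
Proof.
apply: gmeasB; first by apply: gmeasX; exact: rects_shock_err.
by apply: gmeas_rects; case: (condvar_shock_err s).
Qed.

Section Sums.
Variable z : 'I_S -> T -> R.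
Hypothesis mz : forall s, gmeas (gen_0 A) (z s).
Hypothesis z1 : forall s, L1 P (fun w => z s w ^+ 2).

Let errz s : L1 P (fun w => (shock_err s w * z s w) ^+ 2).
Proof.
apply: (wbnd_sqr_L1 GT (w4_w2 GT (shock_err_w4 s))) => //.
exact: shock_err_measurable.
Qed.

Lemma err_sum_L1 : L1 P (fun w => (\sum_s shock_err s w * z s w) ^+ 2).
Proof.
exact: (@L1_orthogonal_sum _ _ _ P (gen_0 A) GT _ (fun s => shock A s : T -> R)
  shock_err z (fun s => measurable_funPT _) rects_shock_err mz errz).
Qed.

Lemma int_err_sum :
  (\int[P]_w ((\sum_s shock_err s w * z s w) ^+ 2)%:E =
   \sum_s \int[P]_w ((shock_err s w * z s w) ^+ 2)%:E)%E.
Proof.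
exact: (@int_orthogonal_sum _ _ _ P (gen_0 A) GT _ (fun s => shock A s : T -> R)
  shock_err z (fun s => measurable_funPT _) shock_pair rects_shock_err
  shock_err_zmean mz errz).
Qed.

Lemma int_err_sum_le :
  (\int[P]_w ((\sum_s shock_err s w * z s w) ^+ 2)%:E <=
   (1 + err_bound)%:E * \int[P]_w (\sum_s z s w ^+ 2)%:E)%E.
Proof.
exact: (@int_orthogonal_sum_le _ _ _ P (gen_0 A) GT _ (fun s => shock A s : T -> R)
  shock_err z (fun s => measurable_funPT _) shock_pair rects_shock_err
  shock_err_zmean mz errz _ (fun s => w4_w2 GT (shock_err_w4 s))).
Qed.

Lemma int_sqr_err_sum_le :
  (\int[P]_w ((\sum_s (shock_err s w ^+ 2 - v s w) * z s w) ^+ 2)%:E <=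
   sqr_err_bound%:E * \int[P]_w (\sum_s z s w ^+ 2)%:E)%E.
Proof.
have mV s : measurable_fun setT (fun w => shock_err s w ^+ 2 - v s w).
  apply: measurable_funB; first by apply: measurable_funX; exact: shock_err_measurable.
  by case: (condvar_shock_err s) => _ /L1_measurable.
have V0 s : zmean P (gen_0 A) (fun w => shock_err s w ^+ 2 - v s w).
  by case: (condvar_shock_err s).
exact: (@int_orthogonal_sum_le _ _ _ P (gen_0 A) GT _ (fun s => shock A s : T -> R)
  (fun s w => shock_err s w ^+ 2 - v s w) z (fun s => measurable_funPT _)
  shock_pair rects_sqr_err V0 mz
  (fun s => wbnd_sqr_L1 GT (sqr_err_wbnd s) (mV s) (mz s) (z1 s)) _ sqr_err_wbnd).
Qed.

End Sums.

(** From X - Z gamma = W (shocks - controls gamma) - U gamma, by exchanging the sums over i and s.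
    The vector e is left general: it will be the residual, and also a column of Z. *)
Lemma score_decomp (e : T -> 'cV[R]_N) (f : 'I_N -> R) w :
  (forall i, e w i 0 = f i) ->
  score gamma e w = \sum_s shock_err s w * (\sum_i share i s w * f i) -
    \sum_i Ug gamma i w * f i.
Proof.
move=> ef; rewrite /score.
have E : Xv w - Zmx w *m gamma =
    Wmx w *m (shocks w - sctlmx w *m gamma) - Umx w *m gamma.
  by rewrite /Xv /Zmx mulmxDl mulmxBr opprD addrA mulmxA.
have Ei i : (Xv w - Zmx w *m gamma) i 0 =
    \sum_s share i s w * shock_err s w - Ug gamma i w.
  rewrite E mxE; congr (_ + _); last by rewrite mxE.
  rewrite mxE; apply: eq_bigr => s _; rewrite /shock_err /shock_mean.
  by rewrite [in LHS]mxE [in X in _ * X = _]mxE [(shocks w) s 0]mxE [in X in _ * (_ + X) = _]mxE.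
under eq_bigr do rewrite Ei ef mulrBl mulr_suml.
rewrite sumrB exchange_big/=; congr (_ - _); apply: eq_bigr => s _.
by rewrite mulr_sumr; apply: eq_bigr => i _; ring.
Qed.

(** The part of the score containing U is F_0-measurable and the part containing the shocks is
    centred given F_0. Hence the former is the conditional mean, it cancels in the variance, and
    orthogonality leaves the diagonal terms. *)
Lemma condvar_scoreE (b : R) (c : 'cV[R]_K) (cv : T -> R) (C C' : R) :
  0 <= C -> (forall i, w4 P (gen_W A) (fit_err c i) C) ->
  (forall i, w4 P (gen_W A) (Ug gamma i) C') ->
  (forall i s, {ae P, forall w, coef i s w = b}) ->
  is_condvar P (F0 A) (score gamma (fun w => residual b c w)) cv ->
  {ae P, forall w, cv w = \sum_s v s w * Wsum (fit_err c) s w ^+ 2}.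
Proof.
move=> C0 fC uC coefb [m cm cvm].
pose r s (w : T) := Wsum (fit_err c) s w.
pose D w := \sum_s shock_err s w * r s w.
pose u w := - \sum_i Ug gamma i w * fit_err c i w.
have mfT i : measurable_fun setT (fit_err c i) by case: (fC i).
have muT i : measurable_fun setT (Ug gamma i : T -> R) by case: (uC i).
have rw4 s := Wsum_w4 s C0 fC.
have mr s : gmeas (gen_0 A) (r s) by apply: g0_Wsum => i; exact: g0_fit_err.
have mrT s : measurable_fun setT (r s) by exact: (gmeas_measurable GT).
have r2 s : L1 P (fun w => r s w ^+ 2) := w4_L1sqr (@gen_W_measurable _ _ _ A) (rw4 s).
have me s := shock_err_measurable s.
have e2 s : L1 P (fun w => shock_err s w ^+ 2) := w4_L1sqr GT (shock_err_w4 s).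
have er s : L1 P (fun w => shock_err s w * r s w) by exact: L1M_of_sqr.
have D1 : L1 P D by apply: L1_sum => s _; exact: er.
have mu : gmeas (gen_0 A) u.
  apply: measurable_funN; apply: gmeas_sum => i.
  by apply: gmeasM; [exact: g0_Ug|exact: g0_fit_err].
have u1 : L1 P u.
  have : L1 P (fun w => \sum_i Ug gamma i w * fit_err c i w).
    apply: L1_sum => i _; apply: L1M_of_sqr => //.
      exact: (w4_L1sqr (@gen_W_measurable _ _ _ A) (uC i)).
    exact: (w4_L1sqr (@gen_W_measurable _ _ _ A) (fC i)).
  by move/(L1Z (-1)); under eq_fun do rewrite mulN1r.
have scoreE : {ae P, forall w, score gamma (fun w => residual b c w) w = D w + u w}.
  apply: filterS (residual_ae c coefb) => w rw.
  exact: (score_decomp (f := fun i => fit_err c i w)).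
have [s1 m1] := condexp_L1 cm; have mm := condexp_gmeas cm.
have ms := L1_measurable s1.
have mD : measurable_fun setT D by exact: (L1_measurable D1).
have muT' := gmeas_measurable GT mu.
have intA B : <<s gen_0 A >> B -> (\int[P]_(w in B) (D w)%:E = 0)%E.
  move=> GB; have mB := GT GB; rewrite /D; under eq_integral do rewrite -sumEFin.
  rewrite integral_sum//; last by move=> s; apply: integrableS (er s).
  apply: big1 => s _; rewrite int_indicM//.
  have E : (fun w => \1_B w * r s w * shock_err s w) =
           (fun w => \1_B w * (shock_err s w * r s w)).
    by apply/funext => w; ring.
  under eq_integral do rewrite (mulrC (shock_err s _)) mulrA.
  apply: (zmean_weight GT (shock_err_zmean s)).
    by apply: gmeasM => //; exact: gmeas_indic.
  by rewrite E; exact: L1_indicM.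
have mE : {ae P, forall w, m w = u w}.
  apply: (ae_eq_int GT) => // B GB; have mB := GT GB.
  case: cm => _ _ _ ->//.
  rewrite (int_ae_eq mB ms _ scoreE); last exact: measurable_funD.
  by rewrite intD// intA// add0e.
have sq : {ae P, forall w,
    (score gamma (fun w => residual b c w) w - m w) ^+ 2 = D w ^+ 2}.
  by apply: filterS2 scoreE mE => w -> ->; rewrite addrK.
have [sq1 cv1] := condexp_L1 cvm; have mcv := condexp_gmeas cvm.
have D2 : L1 P (fun w => D w ^+ 2) by exact: err_sum_L1.
have vr s : L1 P (fun w => v s w * r s w ^+ 2).
  have [mv v1 vb _] := condvar_shock_err s.
  apply: (L1_ae_dom _ (L1Z (1 + err_bound) (r2 s))).
    by apply: measurable_funM; [exact: (L1_measurable v1)|exact: measurable_funX].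
  apply: filterS vb => w vw; rewrite !normrM ler_wpM2r//.
  by rewrite (ger0_norm (_ : 0 <= 1 + err_bound)) ?addr_ge0.
apply: (ae_eq_int GT) => //.
- apply: gmeas_sum => s; apply: gmeasM; first by case: (condvar_shock_err s).
  exact: gmeasX.
- by apply: L1_sum => s _; exact: vr.
move=> B GB; have mB := GT GB; case: cvm => _ _ _ ->//.
rewrite (int_ae_eq mB (L1_measurable sq1) (measurable_funX 2 mD) sq).
(* The indicator is absorbed into the coefficients, so that 1_B D^2 is again the square of an
   orthogonal sum with F_0-measurable coefficients. *)
pose z s w := \1_B w * r s w.
have mz s : gmeas (gen_0 A) (z s) by apply: gmeasM => //; exact: gmeas_indic.
have zE s w : z s w ^+ 2 = \1_B w * r s w ^+ 2.
  by rewrite /z indicE; case: (w \in B); rewrite ?mul1r// !mul0r expr0n.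
have z2 s : L1 P (fun w => z s w ^+ 2).
  by under eq_fun do rewrite zE; exact: L1_indicM.
have zD w : (\sum_s shock_err s w * z s w) ^+ 2 = \1_B w * D w ^+ 2.
  rewrite /D /z indicE; case: (w \in B).
    by rewrite mul1r; congr (_ ^+ 2); apply: eq_bigr => s _; rewrite mul1r.
  by rewrite mul0r big1 ?expr0n// => s _; rewrite mul0r mulr0.
rewrite int_indicM//; under eq_integral do rewrite -zD.
rewrite int_err_sum//; under [in RHS]eq_integral do rewrite -sumEFin.
rewrite integral_sum//; last by move=> s; apply: integrableS (vr s).
apply: eq_bigr => s _; rewrite [RHS]int_indicM//.
have [mv v1 vb vz] := condvar_shock_err s.
have e2r : L1 P (fun w => (shock_err s w * z s w) ^+ 2).
  exact: (wbnd_sqr_L1 GT (w4_w2 GT (shock_err_w4 s)) (me s) (mz s) (z2 s)).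
have Bvr : L1 P (fun w => \1_B w * (v s w * r s w ^+ 2)) by exact: L1_indicM.
have H : (fun w => z s w ^+ 2 * (shock_err s w ^+ 2 - v s w)) =
  (fun w => (shock_err s w * z s w) ^+ 2 - \1_B w * (v s w * r s w ^+ 2)).
  apply/funext => w; rewrite zE.
  have -> : (shock_err s w * z s w) ^+ 2 = shock_err s w ^+ 2 * z s w ^+ 2 by ring.
  by rewrite zE; ring.
have := zmean_weight GT vz (gmeasX 2 (mz s)).
rewrite H => /(_ (L1B e2r Bvr)).
have -> : (\int[P]_x (z s x ^+ 2 * (shock_err s x ^+ 2 - v s x))%:E =
  \int[P]_x ((shock_err s x * z s x) ^+ 2 - \1_B x * (v s x * r s x ^+ 2))%:E)%E.
  by apply: eq_integral => w _; have := congr1 (fun h => h w) H => /= ->.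
rewrite intB// => /eqP; rewrite sube_eq ?add0e ?fin_num_adde_defr//; last first.
- exact: int_fin_num.
- by move=> /eqP.
Qed.

(** Orthogonality leaves the mean of N^-2 sum_s (sum_i w_is f_i)^2, where each square is at most n_s
    sum_i w_is f_i^2. The total weight N^-2 sum_s n_s^2 is at most (max n / sum n) (sum n / N)^2,
    and sum n <= N. *)
Lemma lln_bound f C e : 0 <= C -> 0 <= e -> (forall i, gmeas (gen_0 A) (f i)) ->
  (forall i, w4 P (gen_W A) (f i) C) ->
  {ae P, forall w : T, `|max_n w / sum_n w| <= e} ->
  (\int[P]_w ((N%:R^-1 * \sum_s shock_err s w * Wsum f s w) ^+ 2)%:E <=
   ((1 + err_bound) * ((1 + C) * e))%:E)%E.
Proof.
move=> C0 e0 mf fC ne; have GWT := @gen_W_measurable _ _ _ A.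
have mfT i : measurable_fun setT (f i) by case: (fC i).
pose z s w := N%:R^-1 * Wsum f s w.
have mz s : gmeas (gen_0 A) (z s).
  by apply: gmeasM; [exact: gmeas_cst|exact: g0_Wsum].
have H : wbnd P (gen_W A) (fun w => \sum_s (N%:R^-1 ^+ 2 * sector_size s w) *
    \sum_i share i s w * f i w ^+ 2) ((1 + C) * e).
  apply: pair_wbnd => //; first by rewrite addr_ge0.
  - by move=> i; exact: w4_w2.
  - by move=> s; apply: gmeasM; [exact: gmeas_cst|exact: gW_sector_size].
  - by move=> s w; rewrite mulr_ge0 ?sqr_ge0// sector_size_ge0.
  - apply: filterS ne => w we.
    have -> : \sum_s N%:R^-1 ^+ 2 * sector_size s w * sector_size s w =
        N%:R^-1 ^+ 2 * sum_n2 w.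
      by rewrite mulr_sumr; apply: eq_bigr => s _; rewrite expr2 mulrA.
    apply: le_trans (ler_wpM2l (sqr_ge0 _) (sum_n2_le w)) _.
    have [sn0|sn0] := eqVneq (sum_n w) 0; first by rewrite sn0 !mulr0.
    have sn : 0 < sum_n w by rewrite lt_neqAle eq_sym sn0 sum_n_ge0.
    have NN : 0 < N%:R :> R by exact: lt_le_trans sn (sum_n_le w).
    have -> : N%:R^-1 ^+ 2 * (max_n w * sum_n w) =
        (max_n w / sum_n w) * (sum_n w / N%:R) ^+ 2.
      by field; rewrite sn0 gt_eqF.
    apply: (@le_trans _ _ (e * 1)); last by rewrite mulr1.
    apply: ler_pM; last 1 first.
    + by rewrite exprn_ile1// ?divr_ge0// ?sum_n_ge0// ler_pdivrMr// mul1r sum_n_le.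
    + by rewrite divr_ge0 ?sum_n_ge0// bigmax_ge_id.
    + exact: sqr_ge0.
    + exact: le_trans (ler_norm _) we.
have zle w : \sum_s z s w ^+ 2 <= \sum_s (N%:R^-1 ^+ 2 * sector_size s w) *
    \sum_i share i s w * f i w ^+ 2.
  apply: ler_sum => s _; rewrite exprMn -mulrA ler_wpM2l ?sqr_ge0//.
  exact: (weighted_sqr_sum (fun i => f i w) (fun i => share_ge0 i s w)).
have mzT s : measurable_fun setT (z s) := gmeas_measurable GT (mz s).
have z2 s : L1 P (fun w => z s w ^+ 2).
  under eq_fun do rewrite exprMn; apply: L1Z.
  exact: (w4_L1sqr GWT (Wsum_w4 s C0 fC)).
have -> : (\int[P]_w ((N%:R^-1 * \sum_s shock_err s w * Wsum f s w) ^+ 2)%:E =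
  \int[P]_w ((\sum_s shock_err s w * z s w) ^+ 2)%:E)%E.
  apply: eq_integral => w _; congr (EFin (_ ^+ 2)); rewrite mulr_sumr.
  by apply: eq_bigr => s _; rewrite /z; ring.
apply: le_trans (int_err_sum_le mz z2) _.
rewrite EFinM lee_wpmul2l ?lee_fin ?addr_ge0//.
apply: le_trans (wbnd_int H); case: H => mH _ _ _.
apply: ge0_int_ae_le => //.
- by apply: measurable_sum => s; exact: measurable_funX.
- by move=> w; apply: sumr_ge0 => s _; exact: sqr_ge0.
- by move=> w; apply: le_trans (zle w); apply: sumr_ge0 => s _; exact: sqr_ge0.
- exact: aeW.
Qed.

(** The same scheme one power higher: the fourth power of sum_i w_is f_i is at most n_s^3 sum_i w_is
    f_i^4, so the total weight is sum_s n_s^4 / (sum_s n_s^2)^2 <= max n^2 / sum n^2. *)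
Lemma sqr_lln_bound f C e : 0 <= C -> 0 <= e -> (forall i, gmeas (gen_0 A) (f i)) ->
  (forall i, w4 P (gen_W A) (f i) C) ->
  {ae P, forall w : T, `|max_n2 w / sum_n2 w| <= e} ->
  (\int[P]_w (((\sum_s (shock_err s w ^+ 2 - v s w) * Wsum f s w ^+ 2)
     / sum_n2 w) ^+ 2)%:E <= (sqr_err_bound * (C * e))%:E)%E.
Proof.
move=> C0 e0 mf fC ne; have GWT := @gen_W_measurable _ _ _ A.
have mfT i : measurable_fun setT (f i) by case: (fC i).
pose z s w := Wsum f s w ^+ 2 / sum_n2 w.
have mz s : gmeas (gen_0 A) (z s).
  apply: gmeasM; first by apply: gmeasX; exact: g0_Wsum.
  by apply: gmeasV; exact: (gmeas_sub (@gen_W_sub0 _ _ _ A) (@gW_sum_n2 _ _ _ A)).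
have mzT s : measurable_fun setT (z s) := gmeas_measurable GT (mz s).
have H : wbnd P (gen_W A) (fun w => \sum_s (sector_size s w ^+ 3 / sum_n2 w ^+ 2) *
    \sum_i share i s w * f i w ^+ 4) (C * e).
  apply: pair_wbnd => //.
  - by move=> i; case: (fC i).
  - move=> s; apply: gmeasM; first by apply: gmeasX; exact: gW_sector_size.
    by apply: gmeasV; apply: gmeasX; exact: gW_sum_n2.
  - by move=> s w; rewrite divr_ge0 ?sqr_ge0// exprn_ge0// sector_size_ge0.
  - apply: filterS ne => w we.
    have -> : \sum_s sector_size s w ^+ 3 / sum_n2 w ^+ 2 * sector_size s w =
        (\sum_s sector_size s w ^+ 4) / sum_n2 w ^+ 2.
      by rewrite mulr_suml; apply: eq_bigr => s _; ring.
    have n22 : 0 <= (sum_n2 w ^+ 2)^-1 by rewrite invr_ge0 sqr_ge0.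
    apply: le_trans (ler_wpM2r n22 (sum_n4_le w)) _.
    have [sn0|sn0] := eqVneq (sum_n2 w) 0; first by rewrite sn0 mulr0 mul0r.
    have -> : max_n2 w * sum_n2 w / sum_n2 w ^+ 2 = max_n2 w / sum_n2 w by field.
    exact: le_trans (ler_norm _) we.
have zle w : \sum_s z s w ^+ 2 <= \sum_s (sector_size s w ^+ 3 / sum_n2 w ^+ 2) *
    \sum_i share i s w * f i w ^+ 4.
  apply: ler_sum => s _; rewrite /z expr_div_n -exprM [leRHS]mulrAC.
  by apply: ler_wpM2r; [rewrite invr_ge0 sqr_ge0|exact: Wsum_pow4_le].
have HL1 := wbnd_L1 H; case: (H) => mH H0 _ _.
have z2 s : L1 P (fun w => z s w ^+ 2).
  apply: (L1_dom _ HL1); first exact: measurable_funX.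
  move=> w; rewrite (ger0_norm (H0 w)) ger0_norm ?sqr_ge0//.
  apply: le_trans (zle w); rewrite (bigD1 s)//= lerDl.
  by apply: sumr_ge0 => t _; exact: sqr_ge0.
have -> : (\int[P]_w (((\sum_s (shock_err s w ^+ 2 - v s w) * Wsum f s w ^+ 2)
     / sum_n2 w) ^+ 2)%:E =
  \int[P]_w ((\sum_s (shock_err s w ^+ 2 - v s w) * z s w) ^+ 2)%:E)%E.
  apply: eq_integral => w _; congr (EFin (_ ^+ 2)); rewrite mulr_suml.
  by apply: eq_bigr => s _; rewrite /z mulrA.
apply: le_trans (int_sqr_err_sum_le mz z2) _.
have sq0 : 0 <= sqr_err_bound by rewrite mulr_ge0// addr_ge0// sqr_ge0.
rewrite (EFinM sqr_err_bound) lee_wpmul2l ?lee_fin//.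
apply: le_trans (wbnd_int H).
apply: ge0_int_ae_le => //.
- by apply: measurable_sum => s; exact: measurable_funX.
- by move=> w; apply: sumr_ge0 => s _; exact: sqr_ge0.
- exact: aeW.
Qed.

End Shocks.

(** * Decomposition of the estimators *)

Section RowDecomposition.
Context {R : realType} {K S : nat} (A : shift_share R K S).
Local Notation N := (regions A).
Local Notation T := (sample A).
Implicit Types (s : 'I_S) (i : 'I_N) (w : T) (gamma h c : 'cV[R]_K).

Lemma W_pinvK w : \rank (Wmx w) = S -> W_pinv w *m Wmx w = 1%:M.
Proof. by move=> rW; rewrite /W_pinv -mulmxA mulVmx// gram_unitmx. Qed.

Definition ols w (V : 'cV[R]_N) : 'cV[R]_K :=
  invmx ((Zmx w)^T *m Zmx w) *m ((Zmx w)^T *m V).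

(** Z'Z / N maps the estimation error to Z'(V - Z g) / N, so the lower bound near Q applies. It will
    be used with V = X, g = gamma, and with V = Y - X beta, g = 0. *)
Lemma ols_bound (Q : 'M[R]_K) (e : R) (k : R) w V g : (0 < N)%N ->
  (forall M : 'M[R]_K, (forall k l, `|M k l - Q k l| <= e) ->
    M \in unitmx /\ forall v : 'cV_K, norm1 v <= k * norm1 (M *m v)) ->
  (forall k l, `|(N%:R^-1 *: ((Zmx w)^T *m Zmx w)) k l - Q k l| <= e) ->
  norm1 (ols w V - g) <= k * norm1 (N%:R^-1 *: ((Zmx w)^T *m (V - Zmx w *m g))).
Proof.
move=> N0 H /H[unitM bound].
have Nn0 : (N%:R^-1 : R) \is a GRing.unit by rewrite unitfE invr_eq0 pnatr_eq0 -lt0n.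
rewrite unitmxZ// in unitM.
have -> : N%:R^-1 *: ((Zmx w)^T *m (V - Zmx w *m g)) =
    (N%:R^-1 *: ((Zmx w)^T *m Zmx w)) *m (ols w V - g).
  rewrite -scalemxAl; congr (_ *: _).
  by rewrite [RHS]mulmxBr /ols mulKVmx// mulmxBr mulmxA.
exact: bound.
Qed.

Definition gamma_err gamma w : 'cV[R]_K := ols w (Xv w) - gamma.

Definition pinv_noise k s w : R := \sum_i W_pinv w s i * noise i k w.

Definition pinv_Ug gamma s w : R := \sum_i W_pinv w s i * Ug gamma i w.

(** U times the OLS coefficient is split into U gamma and U times [gamma_err]: the pseudo-inverse
    makes the former small, while the pseudo-inverse of U alone is only bounded and needs the
    vanishing factor [gamma_err]. *)
Definition shock_hat_err gamma s w : R :=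
  - (\sum_k sctl A s k w * gamma_err gamma w k 0) +
  (- pinv_Ug gamma s w - \sum_k pinv_noise k s w * gamma_err gamma w k 0).

Lemma shock_hatE gamma s w : \rank (Wmx w) = S ->
  shock_hat w s 0 = shock_err gamma s w + shock_hat_err gamma s w.
Proof.
move=> rW; have E : shock_hat w = (shocks w - sctlmx w *m gamma) +
    (- (sctlmx w *m gamma_err gamma w) + (- (W_pinv w *m (Umx w *m gamma)) -
      (W_pinv w *m Umx w) *m gamma_err gamma w)).
  rewrite /shock_hat /Xddot -/(ols w (Xv w)).
  rewrite -[in LHS](subrK gamma (ols w (Xv w))) -/(gamma_err gamma w).
  have WK (x : 'cV_S) : W_pinv w *m (Wmx w *m x) = x.
    by rewrite mulmxA W_pinvK// mul1mx.
  move: (gamma_err gamma w) => g.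
  rewrite /Xv /Zmx mulmxBr WK mulmxDl mulmxDr -(mulmxA (Wmx w)) WK !mulmxDr.
  rewrite -(mulmxA (W_pinv w)).
  move: (sctlmx w *m _) (sctlmx w *m _) (W_pinv w *m _) (W_pinv w *m _) => a b c e.
  by apply/matrixP => i k; rewrite !mxE; ring.
rewrite E mxE; congr (_ + _).
  by rewrite /shock_err /shock_mean [in LHS]mxE [in X in X + _]mxE [X in _ + X = _]mxE.
rewrite mxE /shock_hat_err; congr (_ + _).
  by rewrite mxE mxE; congr (- _); apply: eq_bigr => k _; rewrite mxE.
rewrite mxE; congr (_ + _).
  by rewrite mxE mxE; congr (- _); apply: eq_bigr => i _; rewrite /Ug.
rewrite mxE mxE; congr (- _); apply: eq_bigr => k _; congr (_ * _).
by rewrite mxE; apply: eq_bigr => i _; congr (_ * _); rewrite mxE.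
Qed.

Definition R_hat_err (b : R) c s w : R :=
  - (b * Wsum (fun i w => Xv w i 0) s w) -
  \sum_k Wsum (fun i w => Zmx w i k) s w * c k 0.

Lemma R_hatE (b b' : R) c c' (f : 'I_N -> T -> R) s w :
  (forall i, residual b c w i 0 = f i w) ->
  R_hat b' c' w s 0 = Wsum f s w + R_hat_err (b' - b) (c' - c) s w.
Proof.
move=> rf; have E i : residual b' c' w i 0 =
    f i w - (b' - b) * Xv w i 0 - \sum_k Zmx w i k * (c' - c) k 0.
  rewrite -rf.
  have -> : residual b' c' w =
      residual b c w - (b' - b) *: Xv w - Zmx w *m (c' - c).
    rewrite /residual mulmxBr scalerBl; apply/matrixP => x y; rewrite !mxE; ring.
  have gen (u x y : 'cV[R]_N) (k : R) :
      (u - k *: x - y) i 0 = u i 0 - k * x i 0 - y i 0 by rewrite !mxE.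
  by rewrite gen; congr (_ - _); rewrite mxE.
rewrite /R_hat mxE /R_hat_err /Wsum.
under eq_bigr do rewrite mxE mxE E.
rewrite mulr_sumr -sumrN addrA -!big_split/=.
have -> : \sum_k (\sum_i share i s w * Zmx w i k) * (c' - c) k 0 =
    \sum_i \sum_k share i s w * Zmx w i k * (c' - c) k 0.
  by rewrite exchange_big/=; apply: eq_bigr => k _; rewrite mulr_suml.
rewrite -sumrB; apply: eq_bigr => i _.
rewrite !mulrBr mulr_sumr; congr (_ - _); first by ring.
by apply: eq_bigr => k _; rewrite mulrA.
Qed.

Lemma share_eq0 i s w : sector_size s w = 0 -> share i s w = 0.
Proof.
move/eqP; rewrite psumr_eq0; last by move=> j _; exact: share_ge0.
by move/allP => /(_ i); rewrite mem_index_enum => /(_ isT)/eqP.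
Qed.

Lemma Wsum_eq0 (f : 'I_N -> T -> R) s w : sector_size s w = 0 -> Wsum f s w = 0.
Proof.
by move=> n0; apply: big1 => i _; rewrite share_eq0// mul0r.
Qed.

Lemma R_hat_err_eq0 (b : R) c s w : sector_size s w = 0 -> R_hat_err b c s w = 0.
Proof.
move=> n0; rewrite /R_hat_err Wsum_eq0// mulr0 oppr0 sub0r big1 ?oppr0// => k _.
by rewrite Wsum_eq0// mul0r.
Qed.

(** The elementary inequality is applied to r_s / n_s and v_s / n_s and multiplied by n_s^2, which
    produces the weights of [Phi] and [Psi]. Empty sectors admit no such division; there r and v
    vanish and both sides are 0. *)
Lemma perturb_sum (a C : R) (x r u v : 'I_S -> T -> R) w :
  0 <= a -> 0 <= C ->
  (forall x r u v : R, `|((x + u) * (r + v)) ^+ 2 - (x * r) ^+ 2| <=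
    a * (x ^+ 4 + r ^+ 4) + C * (u ^+ 4 + v ^+ 4)) ->
  (forall s, sector_size s w = 0 -> r s w = 0 /\ v s w = 0) ->
  `|(\sum_s ((x s w + u s w) * (r s w + v s w)) ^+ 2) / sum_n2 w -
    (\sum_s (x s w * r s w) ^+ 2) / sum_n2 w| <=
  a * (Phi x w + Psi r w) + C * (Phi u w + Psi v w).
Proof.
move=> a0 C0 ineq rv0; rewrite -mulrBl -sumrB normrM.
have n2i : 0 <= (sum_n2 w)^-1 by rewrite invr_ge0 sum_n2_ge0.
rewrite (ger0_norm n2i).
apply: le_trans (ler_wpM2r n2i (ler_norm_sum _ _ _)) _.
rewrite /Phi /Psi -!big_split/= !mulr_sumr mulr_suml -big_split/=.
apply: ler_sum => s _.
have [n0|n0] := eqVneq (sector_size s w) 0.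
  have [-> ->] := rv0 s n0; rewrite n0 !mulr0 addr0 mulr0 !expr0n/= subrr normr0.
  by rewrite !(mul0r, mulr0, addr0, invr0).
set n := sector_size s w in n0 *.
have := ineq (x s w) (r s w / n) (u s w) (v s w / n).
have -> : ((x s w + u s w) * (r s w / n + v s w / n)) ^+ 2 -
    (x s w * (r s w / n)) ^+ 2 =
  (n ^+ 2)^-1 * (((x s w + u s w) * (r s w + v s w)) ^+ 2 - (x s w * r s w) ^+ 2).
  by field.
have n2 : 0 <= n ^+ 2 by exact: sqr_ge0.
rewrite normrM (ger0_norm (_ : 0 <= (n ^+ 2)^-1)) ?invr_ge0//.
move=> /(ler_wpM2l n2); rewrite mulrA divff ?sqrf_eq0// mul1r.
move=> /(ler_wpM2r n2i)/le_trans; apply.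
rewrite le_eqVlt; apply/orP; left; apply/eqP.
have [->|m0] := eqVneq (sum_n2 w) 0; first by rewrite invr0; field.
by field; rewrite m0 n0.
Qed.

Lemma sum4D_le (c : 'I_S -> R) (a b : 'I_S -> R) : (forall s, 0 <= c s) ->
  \sum_s c s * (a s + b s) ^+ 4 <=
  8 * (\sum_s c s * a s ^+ 4 + \sum_s c s * b s ^+ 4).
Proof.
move=> c0; rewrite -big_split mulr_sumr/=; apply: ler_sum => s _.
by apply: le_trans (ler_wpM2l (c0 s) (pow4D _ _)) _; rewrite -mulrDr mulrCA.
Qed.

Lemma sum4_comb_le (c : 'I_S -> R) (a : 'I_K -> 'I_S -> R) (h : 'I_K -> R) :
  (forall s, 0 <= c s) ->
  \sum_s c s * (\sum_k a k s * h k) ^+ 4 <=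
  K%:R ^+ 3 * \sum_k (h k ^+ 4 * \sum_s c s * a k s ^+ 4).
Proof.
move=> c0; have -> : K%:R ^+ 3 * (\sum_k h k ^+ 4 * \sum_s c s * a k s ^+ 4) =
    \sum_s c s * (K%:R ^+ 3 * \sum_k (a k s * h k) ^+ 4).
  under eq_bigr do rewrite mulr_sumr.
  rewrite exchange_big/= mulr_sumr; apply: eq_bigr => s _.
  rewrite mulrCA; congr (_ * _); rewrite mulr_sumr; apply: eq_bigr => k _.
  by rewrite exprMn; ring.
apply: ler_sum => s _; apply: ler_wpM2l => //.
by have := pow4_sum (fun k => a k s * h k); rewrite card_ord.
Qed.

Let Phi_c w s : 0 <= sector_size s w ^+ 2 / sum_n2 w.
Proof. by rewrite divr_ge0 ?sqr_ge0// sum_n2_ge0. Qed.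

Let Psi_c w s : 0 <= (sector_size s w ^+ 2)^-1 / sum_n2 w.
Proof. by rewrite divr_ge0 ?invr_ge0 ?sqr_ge0// sum_n2_ge0. Qed.

Lemma Phi_ge0 a w : 0 <= Phi a w.
Proof. by apply: sumr_ge0 => s _; rewrite mulr_ge0 ?pow4_ge0. Qed.

Lemma Psi_ge0 a w : 0 <= Psi a w.
Proof. by apply: sumr_ge0 => s _; rewrite mulr_ge0 ?pow4_ge0. Qed.

Lemma Phi_shock_hat_err gamma w : Phi (shock_hat_err gamma) w <=
  8 * (K%:R ^+ 3 * \sum_k (gamma_err gamma w k 0 ^+ 4 *
        Phi (fun s w => sctl A s k w) w) +
       8 * (Phi (pinv_Ug gamma) w +
         K%:R ^+ 3 * \sum_k (gamma_err gamma w k 0 ^+ 4 * Phi (pinv_noise k) w))).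
Proof.
apply: le_trans (sum4D_le _ _ (Phi_c w)) _; rewrite ler_pM2l//.
have N4 (y : R) : (- y) ^+ 4 = y ^+ 4 by rewrite -mulN1r exprMn -signr_odd expr0 mul1r.
apply: lerD.
  under eq_bigr do rewrite N4.
  exact: (sum4_comb_le (fun k s => sctl A s k w) _ (Phi_c w)).
apply: le_trans (sum4D_le _ _ (Phi_c w)) _; rewrite ler_pM2l//; apply: lerD.
  by under eq_bigr do rewrite N4.
under eq_bigr do rewrite N4.
exact: (sum4_comb_le (fun k s => pinv_noise k s w) _ (Phi_c w)).
Qed.

Lemma Psi_R_hat_err (b : R) c w : Psi (R_hat_err b c) w <=
  8 * (b ^+ 4 * Psi (Wsum (fun i w => Xv w i 0)) w +
    K%:R ^+ 3 * \sum_k (c k 0 ^+ 4 * Psi (Wsum (fun i w => Zmx w i k)) w)).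
Proof.
apply: le_trans (sum4D_le _ _ (Psi_c w)) _; rewrite ler_pM2l//.
have N4 (y : R) : (- y) ^+ 4 = y ^+ 4 by rewrite -mulN1r exprMn -signr_odd expr0 mul1r.
apply: lerD.
  rewrite le_eqVlt mulr_sumr; apply/orP; left; apply/eqP; apply: eq_bigr => s _.
  by rewrite N4 exprMn; ring.
under eq_bigr do rewrite N4.
exact: (sum4_comb_le (fun k s => Wsum (fun i w => Zmx w i k) s w) _ (Psi_c w)).
Qed.

End RowDecomposition.

(** * Measurability of the estimators *)

Section RowMeasurability.
Context {R : realType} {K S : nat} (A : shift_share R K S).
Local Notation N := (regions A).
Local Notation T := (sample A).
Local Notation mT := (@measurable _ (sample A)).

(** With G the full sigma-field, the calculus of [gmeas] and [gmx], matrix inverses included, proves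
    plain measurability. *)
Lemma gmeas_allP (f : T -> R) : gmeas mT f <-> measurable_fun setT f.
Proof.
have E : <<s mT >> = mT by apply: sigma_algebra_id; exact: sigma_algebra_measurable.
split=> mf; last first.
  by apply/gmeasP => B mB; rewrite E -[X in _ X]setTI; exact: mf.
by apply: (gmeas_measurable _ mf); rewrite E.
Qed.

Lemma mshare_mx : gmx mT (@Wmx _ _ _ A).
Proof. by move=> i s; under eq_fun do rewrite mxE; exact/gmeas_allP. Qed.

Lemma msctlmx : gmx mT (@sctlmx _ _ _ A).
Proof. by move=> i s; under eq_fun do rewrite mxE; exact/gmeas_allP. Qed.

Lemma mUmx : gmx mT (@Umx _ _ _ A).
Proof. by move=> i s; under eq_fun do rewrite mxE; exact/gmeas_allP. Qed.

Lemma mXv : gmx mT (@Xv _ _ _ A).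
Proof.
apply: gmx_mulmx; first exact: mshare_mx.
by move=> i s; under eq_fun do rewrite mxE; exact/gmeas_allP.
Qed.

Lemma mZmx : gmx mT (@Zmx _ _ _ A).
Proof.
apply: gmx_add; last exact: mUmx.
by apply: gmx_mulmx; [exact: mshare_mx|exact: msctlmx].
Qed.

Lemma mYv : gmx mT (@Yv _ _ _ A).
Proof.
move=> i j; under eq_fun do rewrite mxE; apply: gmeasD; first exact/gmeas_allP.
by apply: gmeas_sum => s; do 2?apply: gmeasM; exact/gmeas_allP.
Qed.

Lemma mgram : gmx mT (fun w : T => (Zmx w)^T *m Zmx w).
Proof. by apply: gmx_mulmx; [apply: gmx_tr|]; exact: mZmx. Qed.

Lemma mols (V : T -> 'cV[R]_N) : gmx mT V -> gmx mT (fun w => ols w (V w)).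
Proof.
move=> mV; apply: gmx_mulmx; first by apply: gmx_invmx; exact: mgram.
by apply: gmx_mulmx => //; apply: gmx_tr; exact: mZmx.
Qed.

Lemma mdelta_check b : gmx mT (fun w : T => delta_check b w).
Proof.
apply: mols; apply: gmx_sub; first exact: mYv.
by apply: gmx_scale; [exact: gmeas_cst|exact: mXv].
Qed.

Lemma mshock_hat : gmx mT (@shock_hat _ _ _ A).
Proof.
apply: gmx_mulmx.
  apply: gmx_mulmx; last by apply: gmx_tr; exact: mshare_mx.
  apply: gmx_invmx; apply: gmx_mulmx; last exact: mshare_mx.
  by apply: gmx_tr; exact: mshare_mx.
apply: gmx_sub; first exact: mXv.
by apply: gmx_mulmx; [exact: mZmx|apply: mols; exact: mXv].
Qed.

Lemma mR_hat (b : T -> R) (c : T -> 'cV[R]_K) : gmeas mT b -> gmx mT c ->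
  gmx mT (fun w => R_hat (b w) (c w) w).
Proof.
move=> mb mc; apply: gmx_mulmx; first by apply: gmx_tr; exact: mshare_mx.
apply: gmx_sub; last by apply: gmx_mulmx => //; exact: mZmx.
by apply: gmx_sub; [exact: mYv|apply: gmx_scale => //; exact: mXv].
Qed.

Lemma msum_n2 : gmeas mT (fun w : T => sum_n2 w).
Proof.
by apply/gmeas_allP; exact: (gmeas_measurable (@gen_W_measurable _ _ _ A) (@gW_sum_n2 _ _ _ A)).
Qed.

End RowMeasurability.

(** * Limits *)

Section Limit.
Context {R : realType} {K : nat} (A : forall S, shift_share R K S).
Variable gamma : 'cV[R]_K.
Local Notation P := (fun S => prob (A S)).
Local Notation N S := (regions (A S)).
Implicit Types f g : forall S, sample (A S) -> R.

Lemma Op1_wbnd f C :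
  (\forall S \near \oo, wbnd (prob (A S)) (gen_W (A S)) (f S) C) -> Op1 P f.
Proof.
move=> fC; apply: (@Op1_int _ _ _ _ _ C); apply: filterS fC => S fC.
by split; [case: fC|case: fC|exact: wbnd_int fC].
Qed.

Lemma op1_wbnd f :
  (forall e : R, 0 < e -> \forall S \near \oo,
    wbnd (prob (A S)) (gen_W (A S)) (f S) e) -> op1 P f.
Proof.
move=> fe; apply: op1_int => e e0; apply: filterS (fe e e0) => S fC.
by split; [case: fC|case: fC|exact: wbnd_int fC].
Qed.

Lemma Op1_avg_sqr (a : forall S, 'I_(N S) -> sample (A S) -> R) C : 0 <= C ->
  (forall S i, w4 (prob (A S)) (gen_W (A S)) (a S i) C) ->
  Op1 P (fun S w => \sum_i (N S)%:R^-1 * a S i w ^+ 2).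
Proof.
move=> C0 aC; apply: (@Op1_wbnd _ ((1 + C) * 1)); apply: nearW => S.
have GWT := @gen_W_measurable _ _ _ (A S).
apply: wbnd_comb => //; first by rewrite addr_ge0.
- by move=> i; exact: w4_w2.
- by move=> i; exact: gmeas_cst.
- apply: aeW => w; rewrite sumr_const card_ord -[leLHS]mulr_natr.
  by have [->|n0] := eqVneq (N S)%:R (0 : R); [rewrite mulr0|rewrite mulVf].
Qed.

Variables (beta : nat -> R) (nu Mx C8 : R).
Variable v : forall S, 'I_S -> sample (A S) -> R.
Local Notation dlt S := (delta (A S) (beta S)).
Hypothesis nu0 : 0 < nu.
Hypothesis C80 : 0 <= C8.
Hypothesis coefE : forall S i s, {ae prob (A S), forall w, coef i s w = beta S}.
Hypothesis meanX : forall S s,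
  is_condexp (prob (A S)) (F0 (A S)) (shock (A S) s) (shock_mean gamma s).
Hypothesis indepX : forall S, cond_independent (prob (A S)) (F0 (A S))
  (fun s => shock (A S) s : sample (A S) -> R).
Hypothesis momX : forall S (s : 'I_S), exists2 m,
  is_condexp (prob (A S)) (F0 (A S)) (fun w => `|shock (A S) s w| `^ (4 + nu)) m &
  {ae prob (A S), forall w, m w <= Mx}.
Hypothesis varX : forall S s,
  is_condvar (prob (A S)) (F0 (A S)) (shock (A S) s) (v s).
Hypothesis momY : forall S i, w4 (prob (A S)) (gen_W (A S)) (y0 i) C8.
Hypothesis momU : forall S i k, w4 (prob (A S)) (gen_W (A S)) (noise i k) C8.
Hypothesis momZ : forall S s k, w4 (prob (A S)) (gen_W (A S)) (sctl (A S) s k) C8.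
Hypothesis noise0 : forall k, gamma k 0 != 0 ->
  ((N S)%:R^-1 * \sum_(i < N S) expect (prob (A S)) (fun w => noise i k w ^+ 2))
    @[S --> \oo] --> (0 : R).
Hypothesis max1 : as_cvg0 P (fun S (w : sample (A S)) => max_n w / sum_n w).
Hypothesis max2 : as_cvg0 P (fun S (w : sample (A S)) => max_n2 w / sum_n2 w).
Variable Q : 'M[R]_K.
Hypothesis Qpos : posdefmx Q.
Hypothesis gramQ : forall k l, cvg_prob P
  (fun S w => ((N S)%:R^-1 *: ((Zmx w)^T *m Zmx w)) k l) (Q k l).
Hypothesis delta_checkE : forall k,
  op1 P (fun S w => (delta_check (beta S) w - dlt S) k 0).
Hypothesis sizes : forall S, (S <= N S)%N.
Hypothesis rankW : forall S, {ae prob (A S), forall w, \rank (Wmx w) = S}.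

Lemma regions_gt0 : \forall S \near \oo, (0 < N S)%N.
Proof. by exists 1%N => // S /= S0; exact: leq_trans (sizes S). Qed.

Lemma Z_w4 S (i : 'I_(N S)) k :
  w4 (prob (A S)) (gen_W (A S)) (fun w => Zmx w i k) (8 * (C8 + C8)).
Proof. exact: Zmx_w4. Qed.

Lemma C8Z : 0 <= 8 * (C8 + C8).
Proof. by rewrite mulr_ge0// addr_ge0. Qed.

Lemma err_w4 S (s : 'I_S) :
  w4 (prob (A S)) (gen_W (A S)) (shock_err gamma s) (err_bound Mx).
Proof.
have [me eC] := shock_err_w4 nu0 (@meanX S) (@momX S) s.
by split=> //; exact: wbnd_sub (@gen_W_sub0 _ _ _ (A S)) eC.
Qed.

Lemma err_bound_ge0 : 0 <= err_bound Mx.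
Proof. by rewrite mulr_ge0// addr_ge0// ?exprn_ge0// !addr_ge0. Qed.

(** V and g are quantified inside the event, so a single exceptional event serves every regressand,
    random ones included. *)
Lemma whp_ols : exists2 k : R, 0 <= k & whp P (fun S (w : sample (A S)) =>
  forall (V : 'cV[R]_(N S)) (g : 'cV[R]_K),
  norm1 (ols w V - g) <=
  k * norm1 ((N S)%:R^-1 *: ((Zmx w)^T *m (V - Zmx w *m g)))).
Proof.
have [e [k [e0 k0 H]]] := perturb_unitmx (posdefmx_unit Qpos).
exists k => //.
have near : whp P (fun S w => forall i j,
    `|((N S)%:R^-1 *: ((Zmx w)^T *m Zmx w)) i j - Q i j| <= e).
  apply: whp_all => i; apply: whp_all => j.
  apply: (@cvg_prob_op1 _ _ _ _ _ _ _ (gramQ i j)) => // S.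
  apply/gmeas_allP; apply: gmx_scale; [exact: gmeas_cst|exact: mgram].
apply: whp_imp (whp_and near (whp_near _ regions_gt0)) => S w [Qe N0] V g.
exact: ols_bound N0 H Qe.
Qed.

Lemma op1_avg_Ug : op1 P (fun S w => \sum_i (N S)%:R^-1 * Ug gamma i w ^+ 2).
Proof.
pose G2 := \sum_k gamma k 0 ^+ 2.
(* c masks the coordinates with gamma_k = 0, whose noise need not be small. They do not enter U_i'
   gamma, and Cauchy-Schwarz with G2 = |gamma|^2 treats the others. *)
pose c k : R := (gamma k 0 != 0)%:R.
have onoise k : op1 P (fun S w => c k * \sum_i (N S)%:R^-1 * noise i k w ^+ 2).
  rewrite /c; have [g0|g0] := eqVneq (gamma k 0) 0.
    by move=> e e0; apply: whpW => S w; rewrite mul0r normr0 ltW.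
  suff o : op1 P (fun S w => \sum_i (N S)%:R^-1 * noise i k w ^+ 2).
    by apply: op1_eq o _; apply: whpW => S w; rewrite mul1r.
  apply: op1_int => e e0; have := noise0 g0; move/cvgrPdist_le => /(_ e e0).
  apply: filterS => S; rewrite sub0r normrN => Se; split.
  - by apply: measurable_sum => i; apply: measurable_funM => //; exact: measurable_funX.
  - by move=> w; apply: sumr_ge0 => i _; rewrite mulr_ge0 ?sqr_ge0// invr_ge0.
  - apply: le_trans (le_trans (ler_norm _) Se : (_%:E <= _%:E)%E).
    rewrite ge0_int_sum; last 2 first.
    + by move=> i; apply: measurable_funM => //; exact: measurable_funX.
    + by move=> i w; rewrite mulr_ge0 ?sqr_ge0// invr_ge0.
    rewrite mulr_sumr -sumEFin; apply: lee_sum => i _.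
    rewrite ge0_intZ ?invr_ge0//; last 2 first.
    + exact: measurable_funX.
    + by move=> w; exact: sqr_ge0.
    rewrite EFinM /expect unlock fineK//.
    apply: (int_fin_num measurableT).
    exact: (w4_L1sqr (@gen_W_measurable _ _ _ (A S)) (momU i k)).
have oG : op1 P (fun S w => G2 * \sum_k c k * \sum_i (N S)%:R^-1 * noise i k w ^+ 2).
  apply: op1Mr; last by apply: op1_sum.
  by apply: (@Op1_cst _ _ _ _ (fun=> G2) `|G2|); exact: nearW.
apply: op1_dom oG _; apply: whpW => S w.
rewrite ger0_norm; last first.
  by apply: sumr_ge0 => i _; rewrite mulr_ge0 ?sqr_ge0// invr_ge0.
apply: le_trans (ler_norm _).
have -> : G2 * (\sum_k c k * \sum_i (N S)%:R^-1 * noise i k w ^+ 2) =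
   \sum_i (N S)%:R^-1 * ((\sum_k (noise i k w * c k) ^+ 2) * G2).
  rewrite mulr_sumr; under eq_bigr do rewrite !mulr_sumr.
  rewrite exchange_big/=; apply: eq_bigr => i _; rewrite mulr_suml mulr_sumr.
  apply: eq_bigr => k _; rewrite exprMn.
  have -> : c k ^+ 2 = c k by rewrite /c; case: (_ != _); rewrite ?expr1n ?expr0n.
  by ring.
apply: ler_sum => i _; rewrite ler_wpM2l ?invr_ge0//.
have -> : Ug gamma i w = \sum_k noise i k w * c k * gamma k 0.
  rewrite /Ug mxE; apply: eq_bigr => k _; rewrite mxE /c.
  by have [->|_] := eqVneq (gamma k 0) 0; rewrite ?mulr0 ?mulr1.
exact: cauchy_schwarz.
Qed.

Lemma op1_gamma_err k : op1 P (fun S w => gamma_err gamma w k 0).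
Proof.
have [c c0 bound] := whp_ols.
have oy l : op1 P (fun S w =>
    ((N S)%:R^-1 *: ((Zmx w)^T *m (Xv w - Zmx w *m gamma))) l 0).
  have o1 : op1 P (fun S w => (N S)%:R^-1 *
      \sum_s shock_err gamma s w * Wsum (fun i w => Zmx w i l) s w).
    apply: op1_sqr; apply: op1_int => e e0.
    (* b is the factor in [lln_bound], which at the rate e / b gives exactly e. *)
    pose b := (1 + err_bound Mx) * (1 + 8 * (C8 + C8)).
    have b0 : 0 < b by rewrite mulr_gt0// ltr_wpDr// ?err_bound_ge0// C8Z.
    have e0' : 0 < e / b by rewrite divr_gt0.
    apply: filterS (max1 e0') => S Se; split.
    - apply: measurable_funX; apply: measurable_funM => //.
      apply: measurable_sum => s; apply: measurable_funM.
        by case: (err_w4 s).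
      by apply: Wsum_measurable => i; case: (Z_w4 i l).
    - by move=> w; exact: sqr_ge0.
    - have := lln_bound nu0 (@meanX S) (@indepX S) (@momX S) C8Z
        (ltW e0') (fun i => @g0_Zmx _ _ _ (A S) i l) (fun i => Z_w4 i l) Se.
      move/le_trans; apply; rewrite lee_fin mulrA -/b mulrCA divff ?mulr1//.
      by rewrite gt_eqF.
  (* By Cauchy-Schwarz, the square is at most the average of Z^2, bounded in probability, times the
     average of (U' gamma)^2, which tends to 0. *)
  have o2 : op1 P (fun S w => \sum_i (N S)%:R^-1 * (Ug gamma i w * Zmx w i l)).
    apply: op1_sqr.
    apply: op1_dom (op1Mr (Op1_avg_sqr C8Z (fun S i => Z_w4 i l)) op1_avg_Ug) _.
    apply: whpW => S w; rewrite ger0_norm ?sqr_ge0//.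
    apply: le_trans (ler_norm _); rewrite -!mulr_sumr exprMn.
    have -> : (N S)%:R^-1 * (\sum_i Zmx w i l ^+ 2) *
       ((N S)%:R^-1 * (\sum_i Ug gamma i w ^+ 2)) =
       (N S)%:R^-1 ^+ 2 * ((\sum_i Ug gamma i w ^+ 2) * (\sum_i Zmx w i l ^+ 2)).
      by ring.
    by rewrite ler_wpM2l ?sqr_ge0//; exact: cauchy_schwarz.
  apply: op1_eq (op1D o1 (op1N o2)) _; apply: whpW => S w.
  have := @score_decomp _ _ _ _ gamma (fun w => col l (Zmx w)) (fun i => Zmx w i l) w
    (fun i => ltac:(by rewrite mxE)).
  rewrite -mulr_sumr -mulrBr => <-; rewrite mxE; congr (_ * _).
  rewrite mxE; apply: eq_bigr => i _.
  by rewrite mulrC; congr (_ * _); rewrite !mxE.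
have os : op1 P (fun S w => c * \sum_l `|((N S)%:R^-1 *:
    ((Zmx w)^T *m (Xv w - Zmx w *m gamma))) l 0|).
  apply: op1Mr.
    by apply: (@Op1_cst _ _ _ _ (fun=> c) `|c|); exact: nearW.
  apply: op1_sum => l; apply: op1_dom (oy l) _.
  by apply: whpW => S w; rewrite normr_id.
apply: op1_dom os _; apply: whp_imp bound => S w bw.
apply: le_trans (ler_norm _); apply: le_trans (bw (Xv w) gamma).
rewrite -/(gamma_err gamma w) /norm1 (bigD1 k)//= lerDl.
by apply: sumr_ge0.
Qed.

(** This makes the fourth moments of eps uniform in S. As delta is non-random, boundedness in
    probability already gives an ordinary bound. *)
Lemma delta_bounded : exists2 D : R, 0 <= D &
  \forall S \near \oo, norm1 (dlt S) <= D.
Proof.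
have [c c0 bound] := whp_ols.
have Oy l : Op1 P (fun S w => \sum_i (N S)%:R^-1 * Zmx w i l ^+ 2 +
    \sum_i (N S)%:R^-1 * y0 i w ^+ 2).
  apply: Op1D; first exact: Op1_avg_sqr C8Z (fun S i => Z_w4 i l).
  exact: Op1_avg_sqr C80 (fun S i => momY i).
have Os : Op1 P (fun S w => c * \sum_l (\sum_i (N S)%:R^-1 * Zmx w i l ^+ 2 +
    \sum_i (N S)%:R^-1 * y0 i w ^+ 2)).
  apply: Op1M; first by apply: (@Op1_cst _ _ _ _ (fun=> c) `|c|); exact: nearW.
  exact: Op1_sum.
have Od : Op1 P (fun S w => norm1 (delta_check (beta S) w)).
  apply: Op1_dom Os _.
  have res : whp P (fun S w => forall i,
      residual (beta S) 0 w i 0 = fit_err 0 i w).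
    by apply: whp_ae; apply: nearW => S; exact: residual_ae.
  apply: whp_imp (whp_and res bound) => S w [rw bw].
  rewrite ger0_norm ?norm1_ge0//; apply: le_trans (ler_norm _).
  (* With g = 0 the right-hand side is the norm of Z'Y(0) / N, and |z y| <= z^2 + y^2 reduces it to
     averages of squares. *)
  have := bw (Yv w - beta S *: Xv w) 0.
  rewrite subr0 => /le_trans; apply; apply: ler_wpM2l => //.
  apply: ler_sum => l _.
  have -> : ((N S)%:R^-1 *: ((Zmx w)^T *m (Yv w - beta S *: Xv w - Zmx w *m 0))) l 0
    = (N S)%:R^-1 * \sum_i Zmx w i l * y0 i w.
    rewrite mxE; congr (_ * _); rewrite mxE; apply: eq_bigr => i _.
    congr (_ * _); first by rewrite mxE.
    have := rw i; rewrite /residual /fit_err => ->.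
    by rewrite mulmx0 [X in _ - X]mxE subr0.
  rewrite mulr_sumr; apply: le_trans (ler_norm_sum _ _ _) _; rewrite -big_split/=.
  apply: ler_sum => i _; rewrite normrM -mulrDr ger0_norm ?invr_ge0//.
  rewrite ler_wpM2l ?invr_ge0// normrM.
  rewrite -(real_normK (num_real (Zmx w i l))) -(real_normK (num_real (y0 i w))).
  by have := sqr_ge0 (`|Zmx w i l| - `|y0 i w|); have := normr_ge0 (Zmx w i l);
    have := normr_ge0 (y0 i w); nra.
have Odl : Op1 P (fun S w => norm1 (dlt S)).
  have oc : Op1 P (fun S w => norm1 (delta_check (beta S) w) +
      \sum_k `|(delta_check (beta S) w - dlt S) k 0|).
    apply: Op1D => //; apply: Op1_sum => k; apply: op1_Op1.
    apply: op1_dom (delta_checkE k) _.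
    by apply: whpW => S w; rewrite normr_id.
  apply: Op1_dom oc _; apply: whpW => S w.
  rewrite ger0_norm ?norm1_ge0//; apply: le_trans (ler_norm _).
  have := norm1D (delta_check (beta S) w) (- (delta_check (beta S) w - dlt S)).
  by rewrite norm1N opprB addrC subrK.
have [M HM] := Op1_nonrandom Odl; exists `|M| => //.
apply: filterS HM => S; rewrite ger0_norm ?norm1_ge0// => /le_trans; apply.
exact: ler_norm.
Qed.

Lemma Op1_Phi_err : Op1 P (fun S w => Phi (shock_err gamma) w).
Proof.
apply: (@Op1_wbnd _ (err_bound Mx)); apply: nearW => S.
by apply: Phi_wbnd; [exact: err_bound_ge0|exact: err_w4].
Qed.

Lemma Op1_Phi_sctl k : Op1 P (fun S w => Phi (fun s w => sctl (A S) s k w) w).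
Proof.
apply: (@Op1_wbnd _ C8); apply: nearW => S.
by apply: Phi_wbnd => // s; exact: momZ.
Qed.

Lemma fit_w4 : exists2 C : R, 0 <= C & \forall S \near \oo, forall i,
  w4 (prob (A S)) (gen_W (A S)) (fit_err (dlt S) i) C.
Proof.
have [D D0 HD] := delta_bounded.
exists (8 * (C8 + D ^+ 3 * (8 * (C8 + C8) * D))).
  by rewrite mulr_ge0// addr_ge0// !mulr_ge0// ?exprn_ge0// addr_ge0.
by apply: filterS HD => S SD i; apply: fit_err_w4.
Qed.

Lemma Op1_Psi_fit : Op1 P (fun S w => Psi (Wsum (fit_err (dlt S))) w).
Proof.
have [C C0 HC] := fit_w4.
by apply: (@Op1_wbnd _ C); apply: filterS HC => S SC; exact: Psi_wbnd.
Qed.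

Lemma Op1_Psi_Z k : Op1 P (fun S w => Psi (Wsum (fun i w => Zmx w i k)) w).
Proof.
apply: (@Op1_wbnd _ (8 * (C8 + C8))); apply: nearW => S.
by apply: Psi_wbnd; [exact: C8Z|move=> i; exact: Z_w4].
Qed.

Lemma shock_bound_ge0 : 0 <= shock_bound Mx.
Proof. by rewrite addr_ge0. Qed.

Lemma Op1_Psi_X : Op1 P (fun S w => Psi (Wsum (fun i w => Xv w i 0)) w).
Proof.
apply: (@Op1_wbnd _ (shock_bound Mx)); apply: nearW => S.
apply: Psi_wbnd; first exact: shock_bound_ge0.
move=> i; have -> : (fun w : sample (A S) => Xv w i 0) =
    (fun w => \sum_s share i s w * shock (A S) s w).
  by apply/funext => w; rewrite mxE; apply: eq_bigr => s _; rewrite !mxE.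
apply: share_comb_w4; first exact: shock_bound_ge0.
move=> s; have [mX XC] := shock_w4 nu0 (@momX S) s.
by split=> //; exact: wbnd_sub (@gen_W_sub0 _ _ _ (A S)) XC.
Qed.

(** The common consequence of the two alternatives on the pseudo-inverse and U; the limit argument
    is run once from it. *)
Hypothesis pinvUg : op1 P (fun S w => Phi (pinv_Ug gamma) w).
Hypothesis pinvU : forall k, Op1 P (fun S w => Phi (pinv_noise k) w).

Lemma op1_Phi_shock_hat_err : op1 P (fun S w => Phi (shock_hat_err gamma) w).
Proof.
have cst (c : R) : Op1 P (fun S w => c).
  by apply: (@Op1_cst _ _ _ _ (fun=> c) `|c|); exact: nearW.
have term (B : 'I_K -> forall S, sample (A S) -> R) : (forall k, Op1 P (B k)) ->
    op1 P (fun S w => K%:R ^+ 3 * \sum_k (gamma_err gamma w k 0 ^+ 4 * B k S w)).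
  move=> OB; apply: op1Mr => //; apply: op1_sum => k.
  apply: op1_eq (op1Mr (OB k) (op1X 3 (op1_gamma_err k))) _.
  by apply: whpW => S w; rewrite mulrC.
have H := op1Mr (cst 8) (op1D (term _ Op1_Phi_sctl)
  (op1Mr (cst 8) (op1D pinvUg (term _ pinvU)))).
apply: op1_dom H _; apply: whpW => S w; rewrite ger0_norm ?Phi_ge0//.
by apply: le_trans (ler_norm _); exact: Phi_shock_hat_err.
Qed.

Variables (bt : forall S, sample (A S) -> R)
  (dt : forall S, sample (A S) -> 'cV[R]_K).
Hypothesis btE : op1 P (fun S w => bt w - beta S).
Hypothesis dtE : forall k, op1 P (fun S w => dt w k 0 - dlt S k 0).

Lemma op1_Psi_R_hat_err :
  op1 P (fun S w => Psi (R_hat_err (bt w - beta S) (dt w - dlt S)) w).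
Proof.
have cst (c : R) : Op1 P (fun S w => c).
  by apply: (@Op1_cst _ _ _ _ (fun=> c) `|c|); exact: nearW.
have tb : op1 P (fun S w => (bt w - beta S) ^+ 4 *
    Psi (Wsum (fun i w => Xv w i 0)) w).
  apply: op1_eq (op1Mr Op1_Psi_X (op1X 3 btE)) _.
  by apply: whpW => S w; rewrite mulrC.
have td k : op1 P (fun S w => (dt w - dlt S) k 0 ^+ 4 *
    Psi (Wsum (fun i w => Zmx w i k)) w).
  apply: op1_eq (op1Mr (Op1_Psi_Z k) (op1X 3 (dtE k))) _.
  by apply: whpW => S w; rewrite mulrC !mxE.
have H := op1Mr (cst 8) (op1D tb (op1Mr (cst (K%:R ^+ 3)) (op1_sum (index_enum _) td))).
apply: op1_dom H _; apply: whpW => S w; rewrite ger0_norm ?Psi_ge0//.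
by apply: le_trans (ler_norm _); exact: Psi_R_hat_err.
Qed.

Variable cv : forall S, sample (A S) -> R.
Hypothesis cvE : forall S, is_condvar (prob (A S)) (F0 (A S))
  (score gamma (fun w => residual (beta S) (dlt S) w)) (@cv S).

Lemma op1_variance_gap : op1 P (fun S w =>
  (\sum_s shock_hat w s 0 ^+ 2 * R_hat (bt w) (dt w) w s 0 ^+ 2) / sum_n2 w -
  cv w / sum_n2 w).
Proof.
pose r S (s : 'I_S) (w : sample (A S)) := Wsum (fit_err (dlt S)) s w.
have [C C0 fC] := fit_w4.
have o1 : op1 P (fun S w => (\sum_s (shock_err gamma s w ^+ 2 - v s w) * r S s w ^+ 2)
    / sum_n2 w).
  apply: op1_sqr; apply: op1_int => e e0.
  pose b := sqr_err_bound Mx * C + 1.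
  have sb0 : 0 <= sqr_err_bound Mx.
    by rewrite mulr_ge0// addr_ge0 ?err_bound_ge0 ?sqr_ge0.
  have b0 : 0 < b by rewrite ltr_wpDl// mulr_ge0.
  have e0' : 0 < e / b by rewrite divr_gt0.
  apply: filterS2 fC (max2 e0') => S SC Se; split.
  - apply: measurable_funX; apply: measurable_funM; last first.
      apply: (gmeas_measurable (@gen_W_measurable _ _ _ (A S))).
      by apply: gmeasV; exact: gW_sum_n2.
    apply: measurable_sum => s; apply: measurable_funM.
      apply: measurable_funB.
        by apply: measurable_funX; case: (err_w4 s).
      have [_ v1 _ _] := condvar_shock_err nu0 (@meanX S) (@momX S) (@varX S) s.
      exact: L1_measurable v1.
    by apply: measurable_funX; apply: Wsum_measurable => i; case: (SC i).
  - by move=> w; exact: sqr_ge0.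
  - have := sqr_lln_bound nu0 (@meanX S) (@indepX S) (@momX S) (@varX S) C0
      (ltW e0') (@g0_fit_err _ _ _ (A S) (dlt S)) SC Se.
    move/le_trans; apply; rewrite lee_fin mulrA.
    apply: (@le_trans _ _ (b * (e / b))).
      by rewrite ler_wpM2r ?(ltW e0')// lerDl.
    by rewrite mulrCA divff ?mulr1// gt_eqF.
have o2 : op1 P (fun S w =>
    (\sum_s ((shock_err gamma s w + shock_hat_err gamma s w) *
       (r S s w + R_hat_err (bt w - beta S) (dt w - dlt S) s w)) ^+ 2) / sum_n2 w -
    (\sum_s (shock_err gamma s w * r S s w) ^+ 2) / sum_n2 w).
  (* The main terms are only bounded in probability, so they must carry an arbitrarily small factor
     a; the constant D depends on a but multiplies terms that tend to 0. *)
  apply: (op1_interp (Op1D Op1_Phi_err Op1_Psi_fit)) => a a0.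
  have [D D0 ineq] := sqr_prod_perturb a0.
  exists (fun S w => D * (Phi (shock_hat_err gamma) w +
      Psi (R_hat_err (bt w - beta S) (dt w - dlt S)) w)).
    apply: op1Mr; first by apply: (@Op1_cst _ _ _ _ (fun=> D) `|D|); exact: nearW.
    exact: op1D op1_Phi_shock_hat_err op1_Psi_R_hat_err.
  apply: whpW => S w.
  apply: (@perturb_sum _ _ _ (A S) a D (shock_err gamma) (r S)
    (shock_hat_err gamma) (R_hat_err (bt w - beta S) (dt w - dlt S)) w
    (ltW a0) D0 ineq) => s n0.
  by split; [exact: Wsum_eq0|exact: R_hat_err_eq0].
apply: op1_eq (op1D o2 o1) _.
(* The formulas for the residual, the pseudo-inverse and the conditional variance hold only almost
   surely, the last one for large S, once the fourth moments of the residuals are bounded. *)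
have wr : whp P (fun S w => forall i,
    residual (beta S) (dlt S) w i 0 = fit_err (dlt S) i w).
  by apply: whp_ae; apply: nearW => S; exact: residual_ae.
have wk : whp P (fun S w => \rank (Wmx w) = S).
  by apply: whp_ae; apply: nearW => S; exact: rankW.
have wv : whp P (fun S w => cv w = \sum_s v s w * r S s w ^+ 2).
  apply: whp_ae; apply: filterS fC => S SC.
  exact: (condvar_scoreE nu0 (@meanX S) (@indepX S) (@momX S) (@varX S) C0 SC
    (fun i => Ug_w4 gamma C80 (fun k => momU i k)) (@coefE S) (@cvE S)).
apply: whp_imp (whp_and wr (whp_and wk wv)) => S w [rw [kw ->]].
have -> : \sum_s shock_hat w s 0 ^+ 2 * R_hat (bt w) (dt w) w s 0 ^+ 2 =
  \sum_s ((shock_err gamma s w + shock_hat_err gamma s w) *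
       (r S s w + R_hat_err (bt w - beta S) (dt w - dlt S) s w)) ^+ 2.
  apply: eq_bigr => s _; rewrite -exprMn (shock_hatE gamma s kw).
  by rewrite (R_hatE (bt w) (dt w) s rw).
have -> : \sum_s (shock_err gamma s w ^+ 2 - v s w) * r S s w ^+ 2 =
    \sum_s (shock_err gamma s w * r S s w) ^+ 2 - \sum_s v s w * r S s w ^+ 2.
  by rewrite -sumrB; apply: eq_bigr => s _; rewrite exprMn mulrBl.
by rewrite mulrBl addrA subrK.
Qed.

End Limit.

Lemma w4_condexp {R : realType} {K S : nat} (A : shift_share R K S)
    (x : sample A -> R) (M : R) : measurable_fun setT x ->
  (exists2 m, is_condexp (prob A) (sigma_W A) (fun w => x w ^+ 4) m &
    {ae prob A, forall w, m w <= M}) ->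
  w4 (prob A) (gen_W A) x `|M|.
Proof.
move=> mx [m cm mM]; split=> //.
apply: (wbnd_condexp (@gen_W_measurable _ _ _ A) _ _ cm) => //.
  by move=> w; exact: pow4_ge0.
by apply: filterS mM => w /le_trans; apply; exact: ler_norm.
Qed.

(** * The pseudo-inverse applied to the noise *)

Section PinvNoise.
Context {R : realType} {K : nat} (A : forall S, shift_share R K S).
Variable gamma : 'cV[R]_K.
Local Notation P := (fun S => prob (A S)).
Local Notation N S := (regions (A S)).

Lemma op1_Phi_pinv_Ug (L : R) (m : forall S, 'I_(N S) -> sample (A S) -> R) :
  (forall S, {ae prob (A S), forall w : sample (A S),
     \big[Num.max/0]_(s < S) \sum_(i < N S) `|W_pinv w s i| <= L}) ->
  (forall S i, is_condexp (prob (A S)) (sigma_W (A S))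
     (fun w => Ug gamma i w ^+ 4) (m S i)) ->
  as_cvg0 P (fun S w => \big[Num.max/0]_(i < N S) m S i w) ->
  op1 P (fun S w => Phi (pinv_Ug gamma) w).
Proof.
move=> WL cm m0; apply: op1_wbnd => e e0.
have GWT S := @gen_W_measurable _ _ _ (A S).
(* Conditional fourth moments at most e / b lead to the bound |L|^4 e / b <= e; adding 1 covers L =
   0. *)
pose b := `|L| ^+ 4 + 1; have b0 : 0 < b by rewrite ltr_wpDl// exprn_ge0.
have eb : 0 < e / b by rewrite divr_gt0.
apply: filterS (m0 _ eb) => S mS.
have Ui i : w4 (prob (A S)) (gen_W (A S)) (Ug gamma i) (e / b).
  split; first exact: (gmeas_measurable (@gen_0_measurable _ _ _ (A S)) (g0_Ug gamma i)).
  apply: (wbnd_condexp (GWT S) _ (ltW eb) (cm S i)); first by move=> w; exact: pow4_ge0.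
  apply: filterS mS => w; apply: le_trans; apply: le_trans (ler_norm _).
  exact: (le_bigmax _ (fun i => m S i w)).
have WL' : {ae prob (A S), forall w : sample (A S),
    \big[Num.max/0]_(s < S) \sum_(i < N S) `|W_pinv w s i| <= `|L|}.
  by apply: filterS (WL S) => w /le_trans; apply; exact: ler_norm.
have pC s : w4 (prob (A S)) (gen_W (A S)) (pinv_Ug gamma s)
    (`|L| ^+ 3 * (e / b * `|L|)).
  exact: pinv_comb_w4 (ltW eb) Ui (normr_ge0 L) WL'.
have H0 : 0 <= `|L| ^+ 3 * (e / b * `|L|).
  by rewrite mulr_ge0 ?exprn_ge0// mulr_ge0// ltW.
apply: wbnd_weaken (Phi_wbnd H0 pC).
have -> : `|L| ^+ 3 * (e / b * `|L|) = `|L| ^+ 4 * (e / b) by ring.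
apply: (@le_trans _ _ (b * (e / b))).
  by rewrite ler_wpM2r ?(ltW eb)// lerDl.
by rewrite mulrCA divff ?mulr1// gt_eqF.
Qed.

Lemma Op1_Phi_pinv_noise (L C : R) k : 0 <= C ->
  (forall S, {ae prob (A S), forall w : sample (A S),
     \big[Num.max/0]_(s < S) \sum_(i < N S) `|W_pinv w s i| <= L}) ->
  (forall S i, w4 (prob (A S)) (gen_W (A S)) (noise i k) C) ->
  Op1 P (fun S w => Phi (pinv_noise k) w).
Proof.
move=> C0 WL UC; apply: (@Op1_wbnd _ _ _ _ (`|L| ^+ 3 * (C * `|L|))).
apply: nearW => S.
apply: Phi_wbnd; first by rewrite !mulr_ge0 ?exprn_ge0.
move=> s; apply: pinv_comb_w4 => //.
by apply: filterS (WL S) => w /le_trans; apply; exact: ler_norm.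
Qed.

Hypothesis noise0 : forall S (i : 'I_(N S)) k,
  {ae prob (A S), forall w, noise i k w = 0}.

Let all_noise0 : whp P (fun S (w : sample (A S)) =>
  forall (i : 'I_(N S)) k, noise i k w = 0).
Proof.
apply: whp_ae; apply: nearW => S; apply: filter_forall => i.
by apply: filter_forall => k; exact: noise0.
Qed.

Let op1_0 : op1 P (fun S w => 0).
Proof. by move=> e e0; apply: whpW => S w; rewrite normr0 ltW. Qed.

Let Phi0 S (a : 'I_S -> sample (A S) -> R) w : (forall s, a s w = 0) -> Phi a w = 0.
Proof. by move=> a0; apply: big1 => s _; rewrite a0 expr0n mulr0. Qed.

Lemma op1_Phi_pinv_Ug0 : op1 P (fun S w => Phi (pinv_Ug gamma) w).
Proof.
apply: op1_eq op1_0 _; apply: whp_imp all_noise0 => S w U0; apply: Phi0 => s.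
apply: big1 => i _; have -> : Ug gamma i w = 0; last by rewrite mulr0.
by rewrite /Ug mxE big1// => k _; rewrite mxE U0 mul0r.
Qed.

Lemma op1_Phi_pinv_noise0 k : op1 P (fun S w => Phi (pinv_noise k) w).
Proof.
apply: op1_eq op1_0 _; apply: whp_imp all_noise0 => S w U0; apply: Phi0 => s.
by apply: big1 => i _; rewrite U0 mulr0.
Qed.

End PinvNoise.

Theorem proposition5 (R : realType) (K : nat)
    (A : forall S : nat, shift_share R K S)
    (gamma : 'cV[R]_K) (beta : nat -> R)
    (condvar_score : forall S, sample (A S) -> R)
    (beta_tilde : forall S, {RV prob (A S) >-> R})
    (delta_tilde : forall S, 'I_K -> {RV prob (A S) >-> R}) :
  let P := fun S => prob (A S) in
  let N := fun S => regions (A S) in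
  let dlt := fun S => delta (A S) (beta S) in
  let eps := fun S => fun w : sample (A S) => residual (beta S) (dlt S) w in
  let VN := fun S (w : sample (A S)) => condvar_score S w / sum_n2 w in
  (* homogeneous effects *)
  (forall S i s, {ae P S, forall w, coef i s w = beta S}) ->
  (* (2) *)
  (forall S s,
     is_condexp (P S) (F0 (A S)) (shock (A S) s)
       (fun w => (sctlmx w *m gamma) s 0) /\
     is_condexp (P S) (sigma_sctl (A S) s) (shock (A S) s)
       (fun w => (sctlmx w *m gamma) s 0)) ->
  (* (3) *)
  (forall k, gamma k 0 != 0 ->
     ((N S)%:R^-1 * \sum_(i < N S) expect (P S) (fun w => noise i k w ^+ 2))
       @[S --> \oo] --> (0 : R) /\
     as_cvg0 P (fun S w => (Num.sqrt (sum_n2 w))^-1 *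
       \sum_(i < N S) expect (P S) (fun w => noise i k w ^+ 2))) ->
  (* (4) *)
  (forall S, cond_independent (P S) (F0 (A S))
     (fun s => shock (A S) s : sample (A S) -> R)) ->
  (* (5) *)
  as_cvg0 P (fun S w => max_n w / sum_n w) ->
  as_cvg0 P (fun S w => max_n2 w / sum_n2 w) ->
  (* (6) *)
  (exists M : R, forall S (i : 'I_(N S)) (s : 'I_S),
     {ae P S, forall w, `|coef i s w| <= M}) ->
  (* (7) *)
  (exists2 v : forall S, 'I_S -> sample (A S) -> R,
     forall S s, is_condvar (P S) (F0 (A S)) (shock (A S) s) (v S s) &
     exists2 l : R, 0 < l &
       cvg_prob P (fun S w => (N S)%:R^-1 *
         \sum_(i < N S) \sum_(s < S) v S s w * share i s w ^+ 2) l) ->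
  (* (8) *)
  (exists2 nu : R, 0 < nu & exists M : R, forall S (s : 'I_S),
     exists2 m, is_condexp (P S) (F0 (A S))
                  (fun w => `|shock (A S) s w| `^ (4 + nu)) m &
                {ae P S, forall w, m w <= M}) ->
  (exists M : R, forall S,
     [/\ forall i, exists2 m,
           is_condexp (P S) (sigma_W (A S)) (fun w => y0 i w ^+ 4) m &
           {ae P S, forall w, m w <= M},
         forall i k, exists2 m,
           is_condexp (P S) (sigma_W (A S)) (fun w => noise i k w ^+ 4) m &
           {ae P S, forall w, m w <= M} &
         forall s k, exists2 m,
           is_condexp (P S) (sigma_W (A S)) (fun w => sctl (A S) s k w ^+ 4) m &
           {ae P S, forall w, m w <= M}]) ->
  (* (9) *)
  (exists2 Q : 'M[R]_K, posdefmx Q &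
     forall k l, cvg_prob P
       (fun S w => ((N S)%:R^-1 *: ((Zmx w)^T *m Zmx w)) k l) (Q k l)) ->
  (* (10) *)
  (exists q : nat -> R,
     [/\ q @ \oo --> (0 : R),
         forall k, bigO_prob P
           (fun S w => (delta_check (beta S) w - dlt S) k 0) q &
         as_cvg0 P (fun S w => q S ^+ 2 * (N S)%:R / sum_n2 w *
           \sum_(i < N S) expect (P S) (fun w => Ug gamma i w ^+ 2))]) ->
  cvg_prob P (fun S w =>
    (gamma^T *m (Umx w)^T *m eps S w) 0 0 / Num.sqrt (sum_n2 w)) 0 ->
  (* (11) *)
  (forall S, is_condvar (P S) (F0 (A S)) (score gamma (eps S))
     (condvar_score S)) ->
  (exists l : R, cvg_prob P VN l) ->
  (* (12) *)
  (forall S, (S <= N S)%N /\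
     {ae P S, forall w : sample (A S), \rank (Wmx w) = S}) ->
  (* (13) *)
  ((exists L : R, forall S, {ae P S, forall w : sample (A S),
      \big[Num.max/0]_(s < S) \sum_(i < N S) `|W_pinv w s i| <= L}) /\
   (exists2 m : forall S, 'I_(N S) -> sample (A S) -> R,
      forall S i, is_condexp (P S) (sigma_W (A S))
        (fun w => Ug gamma i w ^+ 4) (m S i) &
      as_cvg0 P (fun S w => \big[Num.max/0]_(i < N S) m S i w))
   \/ (forall S (i : 'I_(N S)) k, {ae P S, forall w, noise i k w = 0})) ->
  (* consistency *)
  cvg_prob P (fun S w => beta_tilde S w - beta S) 0 ->
  (forall k, cvg_prob P (fun S w => delta_tilde S k w - dlt S k 0) 0) ->
  cvg_prob P (fun S w =>
    (\sum_(s < S) shock_hat w s 0 ^+ 2 *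
       R_hat (beta_tilde S w) (\col_k delta_tilde S k w) w s 0 ^+ 2) /
      sum_n2 w - VN S w) 0.
Proof.
move=> P N dlt eps VN coefE cond2 cond3 indepX max1 max2 _ [v varX _]
  [nu nu0 [Mx momX]] [M mom8] [Q Qpos gramQ] [q [q0 dcheck _]] _ cvE _ rankW
  cond13 btE dtE.
have momY S i : w4 (prob (A S)) (gen_W (A S)) (y0 i) `|M|.
  by apply: w4_condexp => //; case: (mom8 S) => H _ _; exact: H.
have momU S i k : w4 (prob (A S)) (gen_W (A S)) (noise i k) `|M|.
  by apply: w4_condexp => //; case: (mom8 S) => _ H _; exact: H.
have momZ S s k : w4 (prob (A S)) (gen_W (A S)) (sctl (A S) s k) `|M|.
  by apply: w4_condexp => //; case: (mom8 S) => _ _ H; exact: H.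
have M0 : 0 <= `|M| by exact: normr_ge0.
have dcheckE k : op1 P (fun S w => (delta_check (beta S) w - dlt S) k 0).
  apply: bigO_prob_op1 q0 (dcheck k) => S; apply/gmeas_allP.
  by apply: gmx_sub; [exact: mdelta_check|exact: gmx_cst].
have [pinvUg pinvU] : op1 P (fun S w => Phi (pinv_Ug gamma) w) /\
    forall k, Op1 P (fun S w => Phi (pinv_noise k) w).
  case: cond13 => [[[L WL] [m cm m0]]|U0].
    split; first exact: op1_Phi_pinv_Ug WL cm m0.
    by move=> k; exact: Op1_Phi_pinv_noise M0 WL (fun S i => momU S i k).
  split; first exact: op1_Phi_pinv_Ug0.
  by move=> k; apply: op1_Op1; exact: op1_Phi_pinv_noise0.
have bt1 : op1 P (fun S w => beta_tilde S w - beta S).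
  apply: op1_eq (cvg_prob_op1 _ btE) _.
    by move=> S; exact: measurable_funB.
  by apply: whpW => S w; rewrite subr0.
have dt1 k : op1 P (fun S w => (\col_k delta_tilde S k w) k 0 - dlt S k 0).
  apply: op1_eq (cvg_prob_op1 _ (dtE k)) _.
    by move=> S; exact: measurable_funB.
  by apply: whpW => S w; rewrite subr0 mxE.
have gap := op1_variance_gap nu0 M0 coefE (fun S s => (cond2 S s).1) indepX momX
  varX momY momU momZ (fun k gk => (cond3 k gk).1) max1 max2 Qpos gramQ dcheckE
  (fun S => (rankW S).1) (fun S => (rankW S).2) pinvUg pinvU bt1 dt1 cvE.
(* [op1] is silent on measurability, but the return to [cvg_prob] needs it. For the estimators it is
   computed from their formulas, for the conditional variance it is part of being a version. *)
apply: op1_cvg_prob; last first.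
  by apply: op1_eq gap _; apply: whpW => S w; rewrite subr0.
move=> S; apply/gmeas_allP; have mn := gmeasV (@msum_n2 _ _ _ (A S)).
apply: gmeasB; apply: gmeasM => //.
  apply: gmeas_sum => s; apply: gmeasM; apply: gmeasX; first exact: mshock_hat.
  apply: mR_hat; first exact/gmeas_allP.
  by move=> k j; under eq_fun do rewrite mxE; exact/gmeas_allP.
case: (cvE S) => m _ [_ cv1 _ _]; apply/gmeas_allP.
exact: L1_measurable cv1.
Qed.
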